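(* There exist universal constants $c,C>0$ such that the following holds. Let $r\ge2$ and $n_1,\dots,n_r\ge2$ be integers, let $\varepsilon\in(0,1)$ and $K\ge1$, and let $T\in\mathbb R^{n_1\times\cdots\times n_r}$ be a tensor whose entries are i.i.d. copies of a mean-zero random variable $Z$ with $\sigma^2:=\mathbb E Z^2<\infty$ and $\mathbb E|Z|^{2+\varepsilon}\le K\sigma^{2+\varepsilon}$. Set $M:=2\,\mathbb E\|T\|_\infty$ and $n:=\max_{i\in[r]}n_i$. Then $$c\Big(\sqrt{n\,\mathbb E[\mathrm{clip}_M(Z)^2]}+M\Big)\le\mathbb E\,\|T\|_{\mathrm{inj}}\le C\Big(r^3\sqrt{n\,\mathbb E[\mathrm{clip}_M(Z)^2]}+\frac{r^5\log^2(r/\varepsilon)}{\varepsilon^6}\,K M\Big).$$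
   Context: $[r]=\{1,\dots,r\}$; $\log$ is the natural logarithm. $\|T\|_\infty$ is the maximum absolute value of the entries of $T$. For $\tau\ge0$, $\mathrm{clip}_\tau:\mathbb R\to\mathbb R$ is $\mathrm{clip}_\tau(x)=x$ if $|x|\le\tau$, $\mathrm{clip}_\tau(x)=\tau$ if $x>\tau$, and $\mathrm{clip}_\tau(x)=-\tau$ if $x<-\tau$. The injective norm of $T\in\mathbb R^{n_1\times\cdots\times n_r}$ is $\|T\|_{\mathrm{inj}}=\max\{|\langle T,x_1\otimes\cdots\otimes x_r\rangle| : x_k\in\mathbb R^{n_k},\ \|x_k\|_2=1 \text{ for all } k\in[r]\}$, where $\langle\cdot,\cdot\rangle$ is the entrywise (Euclidean) inner product. *)

(* Defs.v *)
From HB Require Import structures.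
From mathcomp Require Import all_boot all_order all_algebra.
From mathcomp Require Import all_classical all_reals all_analysis.
Set Implicit Arguments.
Unset Strict Implicit.
Unset Printing Implicit Defensive.
Import Order.TTheory GRing.Theory Num.Def Num.Theory.
Import numFieldNormedType.Exports.
Local Open Scope classical_set_scope.
Local Open Scope ring_scope.

Definition clip {R : realType} (tau x : R) : R :=
  if `|x| <= tau then x else if tau < x then tau else - tau.

Definition tensor_index (r : nat) (n : 'I_r -> nat) :=
  {dffun forall k : 'I_r, 'I_(n k)}.

Definition tensor (R : realType) (r : nat) (n : 'I_r -> nat) :=
  tensor_index n -> R.

Definition tensor_inner (R : realType) (r : nat) (n : 'I_r -> nat)
    (S T : tensor R n) : R :=
  \sum_(i : tensor_index n) S i * T i.

Definition rank1_tensor (R : realType) (r : nat) (n : 'I_r -> nat)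
    (x : forall k : 'I_r, 'rV[R]_(n k)) : tensor R n :=
  fun i => \prod_(k < r) x k ord0 (i k).

(* The canonical norm of 'rV[R]_m is the sup norm, hence this definition. *)
Definition norm2 (R : realType) (m : nat) (x : 'rV[R]_m) : R :=
  Num.sqrt (\sum_(j < m) x ord0 j ^+ 2).

Definition tensor_norm_inf (R : realType) (r : nat) (n : 'I_r -> nat)
    (T : tensor R n) : R :=
  \big[Num.max/0]_(i : tensor_index n) `|T i|.

Definition inj_norm_values (R : realType) (r : nat) (n : 'I_r -> nat)
    (T : tensor R n) : set R :=
  [set `|tensor_inner T (rank1_tensor x)| |
     x in [set x : forall k : 'I_r, 'rV[R]_(n k) | forall k, norm2 (x k) = 1]].

(* The supremum is attained: see [inj_norm_attained]. *)
Definition inj_norm (R : realType) (r : nat) (n : 'I_r -> nat)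
    (T : tensor R n) : R :=
  sup (inj_norm_values T).

Definition identically_distributed {R : realType} {d d' : measure_display}
    {Omega : measurableType d} {Omega' : measurableType d'}
    {P : probability Omega R} {P' : probability Omega' R}
    (X : {RV P >-> R}) (Y : {RV P' >-> R}) : Prop :=
  forall A : set R, measurable A -> distribution P X A = distribution P' Y A.

Definition mutually_independent {R : realType} {d : measure_display}
    {Omega : measurableType d} {P : probability Omega R} {I : finType}
    (X : I -> {RV P >-> R}) : Prop :=
  forall (J : {set I}) (A : I -> set R), (forall i, measurable (A i)) ->
    P (\bigcap_(i in [set` J]) (X i @^-1` A i)) =
    (\prod_(i in J) P (X i @^-1` A i))%E.

Section inj_norm_attained.
Variables (R : realType) (r : nat) (n : 'I_r -> nat).

Let sphere (m : nat) : set 'rV[R]_m := [set x | norm2 x = 1].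

Let continuous_norm2 (m : nat) : continuous (@norm2 R m).
Proof.
move=> x; apply: (@continuous_comp _ _ _ (fun y : 'rV[R]_m =>
  \sum_(j < m) y ord0 j ^+ 2) (@Num.sqrt R)); last exact: sqrt_continuous.
apply: continuous_big => [|j _ {}x]; first exact: (@add_continuous R).
apply: (@continuous_comp _ _ _ (fun y : 'rV[R]_m => y ord0 j) (fun t => t ^+ 2)).
  exact: coord_continuous.
exact: exprn_continuous.
Qed.

Let norm2_coord (m : nat) (x : 'rV[R]_m) j : norm2 x = 1 -> `|x ord0 j| <= 1.
Proof.
move=> x1; rewrite -x1 -sqrtr_sqr ler_sqrt; last by apply: sumr_ge0 => *; exact: sqr_ge0.
by rewrite (bigD1 j) //= lerDl; apply: sumr_ge0 => *; exact: sqr_ge0.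
Qed.

Let compact_sphere (m : nat) : compact (@sphere m).
Proof.
have sub : @sphere m `<=` [set v : 'rV[R]_m | forall i, `[-1, 1]%classic (v ord0 i)].
  by move=> x /= x1 i; rewrite /= in_itv /= -ler_norml; exact: norm2_coord.
apply: (subclosed_compact _ _ sub); last first.
  by apply: (@rV_compact R m (fun=> `[-1, 1]%classic)) => i; exact: segment_compact.
by rewrite (_ : @sphere m = @norm2 R m @^-1` [set 1]) //;
  apply: closed_comp => [x _|]; [exact: continuous_norm2|exact: closed_eq].
Qed.

Lemma inj_norm_attained (T : tensor R n) : (forall k, (0 < n k)%N) ->
  inj_norm_values T (inj_norm T) /\ ubound (inj_norm_values T) (inj_norm T).
Proof.
move=> n0.
pose U := prod_topology (fun k : 'I_r => 'rV[R]_(n k) : topologicalType).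
pose f (x : U) := `|tensor_inner T (rank1_tensor x)|.
have cf : continuous f.
  move=> x; apply: (@continuous_comp _ _ _ (fun y : U =>
    tensor_inner T (rank1_tensor y)) (fun t : R => `|t|)); last first.
    exact: norm_continuous.
  apply: continuous_big => [|i _ {}x]; first exact: (@add_continuous R).
  apply: (@cvgM _ _ (nbhs x) _ (cst (T i)) (fun y : U => rank1_tensor y i)).
    exact: cvg_cst.
  apply: continuous_big => [|k _ {}x]; first exact: mul_continuous.
  apply: (@continuous_comp _ _ _ (fun y : U => y k)
    (fun v : 'rV[R]_(n k) => v ord0 (i k))); last exact: coord_continuous.
  exact: (@proj_continuous _ (fun k : 'I_r => 'rV[R]_(n k) : topologicalType)).
have cS : compact [set x : U | forall k, @sphere (n k) (x k)].
  by apply: (@tychonoff _ (fun k : 'I_r => 'rV[R]_(n k) : topologicalType)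
    (fun k => @sphere (n k))) => k; exact: compact_sphere.
have S0 : [set x : U | forall k, @sphere (n k) (x k)] !=set0.
  pose x k : 'rV[R]_(n k) := delta_mx ord0 (Ordinal (n0 k)).
  exists x => k /=.
  rewrite /sphere /= /norm2 (bigD1 (Ordinal (n0 k))) //= big1 ?addr0.
    by rewrite mxE !eqxx expr1n sqrtr1.
  by move=> j /negbTE jk; rewrite mxE jk andbF expr0n.
have [x /[1!inE] Sx fx] := compact_EVT_max (f := f) S0 cS (continuous_subspaceT cf).
have ub : ubound (inj_norm_values T) (f x).
  by move=> _ [y Sy <-]; apply: fx; rewrite inE.
have Vx : inj_norm_values T (f x) by exists x.
suff -> : inj_norm T = f x by [].
by apply/le_anti/andP; split; [apply: ge_sup => //; exists (f x)|apply: ub_le_sup => //; exists (f x)].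
Qed.
End inj_norm_attained.

(* Main.v *)
Require Import Defs.
From HB Require Import structures.
From mathcomp Require Import all_boot all_order all_algebra.
From mathcomp Require Import all_classical all_reals all_analysis.
From mathcomp Require Import measurable_realfun ring lra.
Set Implicit Arguments.
Unset Strict Implicit.
Unset Printing Implicit Defensive.
Import Order.TTheory GRing.Theory Num.Def Num.Theory.
Import numFieldNormedType.Exports.
Local Open Scope classical_set_scope.
Local Open Scope ring_scope.

(** Lower bound: the injective norm dominates every entry and the Euclidean norm
    of every fiber (a line of entries along one mode).

    Upper bound: let Y be the tensor clipped at M; the excess T - Y contributes O(M)
    in l1 norm. Restrict the unit vectors x_k to a grid of mesh 1 / (2 r sqrt n), put
    y_i = Y_i * prod_k x_k(i_k), and let rho be of the order of the largest fiber norm.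
    - Entries with |y_i| <= rho / n are handled by Bernstein's inequality and a union
      bound over the whole grid.
    - If |y_i| > rho * x_k(i_k) ^ 2 for some k, then
      |y_i| <= Y_i ^ 2 * prod_(l <> k) x_l(i_l) ^ 2 / rho, and these entries sum to at
      most r * (largest fiber norm) ^ 2 / rho.
    - The other entries are grouped by J, where min_k |x_k(i_k)| is about 2 ^ (- J).
      Level J depends only on the s_J coordinates of size at least 2 ^ (- J), so its
      union bound costs about s_J * ln (r n / s_J), and sum_J s_J / 4 ^ J <= 4 r / 3
      makes the total independent of the number of levels.
    The 2 + eps moment is used only to bound the largest fiber norm. *)

(** * Independence and expectations *)

(** The obstacle is a logarithmic loss: the entropy per active coordinate contains ln n, so the
    contribution of a level must be made smaller by the same factor. The exponential moment allows
    this: entries between lo and hi can be tilted by lam / hi, which divides the entropy by lam and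
    multiplies the mean term by expR lam. With L ^ 2 the ratio of the top of a level to rho / n, the
    level is cut at the geometric mean of its two ends. Below the cut the entries are so small that
    lam = 1 suffices; above it lam = 1 + ln L is affordable and absorbs the 2 ln L contained in the
    entropy. The same tilt, with lam proportional to eps * ln n, treats the rare large entries of a
    fiber; there the 2 + eps moment supplies the power of n that pays for expR lam. Deviations are
    not controlled through tail probabilities: exponential moments are averaged with weights of
    total mass at most 1, and a member of weight p is bounded at the price - ln p. Clipping destroys
    the zero mean, but the drift of an entry is at most its mean excess m, and N m <= M for N
    entries, so by Cauchy-Schwarz the total drift is at most M. *)

Section independence.
Local Open Scope ereal_scope.
Context (R : realType) (d : measure_display) (Omega : measurableType d)
  (P : probability Omega R).
Import HBNNSimple.

(** The integral of a nonnegative function is a supremum over the simple functions below it, so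
    monotonicity holds for arbitrary functions. This is how the injective norm, a supremum over
    spheres, is compared with measurable bounds. *)
Lemma ge0_le_integralT (f g : Omega -> \bar R) :
  (forall w, 0 <= f w) -> (forall w, f w <= g w) ->
  \int[P]_w f w <= \int[P]_w g w.
Proof.
move=> f0 fg; rewrite !ge0_integralTE//; last by move=> w; exact: le_trans (fg w).
apply: ereal_sup_le => _ [h hf <-].
by exists h => // w; exact: le_trans (fg w).
Qed.

Let integral_mul_nnsfun (X : {RV P >-> R}) (G : Omega -> R) (c : \bar R) :
  measurable_fun setT G -> (forall w, (0 <= G w)%R) -> c \is a fin_num -> 0 <= c ->
  (forall A, measurable A ->
     \int[P]_w (G w * \1_A (X w))%:E = c * P (X @^-1` A)) ->
  forall h : {nnsfun R >-> R},
  \int[P]_w (G w * h (X w))%:E = c * \int[P]_w (h (X w))%:E.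
Proof.
move=> mG G0 cf c0 HA h.
have mX A : measurable A -> measurable (X @^-1` A).
  by move=> mA; rewrite -(setTI (_ @^-1` _)); exact: measurable_funP.
have mI k : measurable_fun setT (fun w => \1_(h @^-1` [set k]) (X w) : R).
  by apply: measurableT_comp => //; exact: measurable_indic.
transitivity (\sum_(k \in range h) \int[P]_w (k * (G w * \1_(h @^-1` [set k]) (X w)))%:E).
  rewrite -ge0_integral_fsum//.
  - apply: eq_integral => w _; rewrite fsumEFin//; congr EFin.
    rewrite {1}(fimfunE h (X w)) mulr_fsumr.
    by apply: eq_fsbigr => k _; rewrite mulrCA.
  - by move=> k; apply/measurable_EFinP; do 2 (apply: measurable_funM => //).
  - move=> k w _; rewrite mulrCA EFinM mule_ge0 ?lee_fin//.
    by have := nnfun_muleindic_ge0 h k (X w); rewrite -EFinM lee_fin.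
transitivity (\sum_(k \in range h) (c * \int[P]_w (k * \1_(h @^-1` [set k]) (X w))%:E)).
  apply: eq_fsbigr => k /[!inE] -[y _ yk].
  have k0 : (0 <= k)%R by rewrite -yk.
  have p1 w : setT w -> 0 <= (G w * \1_(h @^-1` [set k]) (X w))%:E.
    by move=> _; rewrite lee_fin mulr_ge0.
  have p2 w : setT w -> 0 <= (\1_(h @^-1` [set k]) (X w))%:E :> \bar R.
    by move=> _; rewrite lee_fin.
  have m1 : measurable_fun setT (fun w => (G w * \1_(h @^-1` [set k]) (X w))%:E).
    by apply/measurable_EFinP; apply: measurable_funM.
  have m2 : measurable_fun setT (fun w => (\1_(h @^-1` [set k]) (X w))%:E : \bar R).
    exact/measurable_EFinP.
  under eq_integral do rewrite EFinM.
  rewrite (ge0_integralZl_EFin P measurableT p1 m1 k0).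
  under [in RHS]eq_integral do rewrite EFinM.
  rewrite (ge0_integralZl_EFin P measurableT p2 m2 k0).
  rewrite HA// muleCA; congr (_ * (_ * _)).
  by rewrite -[X in P X]setIT -(@integral_indic _ _ _ P _ measurableT)//; exact: mX.
rewrite -ge0_mule_fsumr; last first.
  move=> k; apply: integral_ge0 => w _.
  by have := nnfun_muleindic_ge0 h k (X w); rewrite EFinM.
congr (_ * _).
rewrite -ge0_integral_fsum//.
- apply: eq_integral => w _; rewrite fsumEFin//; congr EFin.
  by rewrite [RHS](fimfunE h (X w)).
- by move=> k; apply/measurable_EFinP; apply: measurable_funM => //.
- move=> k w _.
  by have := nnfun_muleindic_ge0 h k (X w); rewrite EFinM.
Qed.

(** Simple functions and monotone convergence carry the identity from indicators to [phi]. The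
    hypothesis on indicators expresses that [G] is uncorrelated with every event of [X]; at
    [A = setT] it shows that [c] is the mean of [G]. *)
Lemma integral_mul_comp (X : {RV P >-> R}) (G : Omega -> R) (c : \bar R) :
  measurable_fun setT G -> (forall w, (0 <= G w)%R) -> c \is a fin_num -> 0 <= c ->
  (forall A, measurable A ->
     \int[P]_w (G w * \1_A (X w))%:E = c * P (X @^-1` A)) ->
  forall phi : R -> R, measurable_fun setT phi -> (forall x, (0 <= phi x)%R) ->
  \int[P]_w (G w * phi (X w))%:E = c * \int[P]_w (phi (X w))%:E.
Proof.
move=> mG G0 cf c0 HA phi mphi phi0.
have mE : measurable_fun setT (EFin \o phi) by exact/measurable_EFinP.
pose f_ := nnsfun_approx measurableT mE.
have cv y : (f_ n y)%:E @[n --> \oo] --> (phi y)%:E.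
  by apply: (cvg_nnsfun_approx measurableT mE) => // z _; rewrite lee_fin.
have nd y : {homo f_ ^~ y : m n / (m <= n)%N >-> (m <= n)%R}.
  by move=> m n mn; exact/lefP/nd_nnsfun_approx.
have mf n : measurable_fun setT (fun w => f_ n (X w)).
  by apply: measurableT_comp => //.
transitivity (limn (fun n => \int[P]_w (G w * f_ n (X w))%:E)).
  rewrite -monotone_convergence//.
  - apply: eq_integral => w _; apply/esym/cvg_lim => //=.
    under eq_fun do rewrite EFinM.
    by rewrite EFinM; apply: cvgeZl.
  - by move=> n; apply/measurable_EFinP; apply: measurable_funM.
  - by move=> n w _; rewrite lee_fin mulr_ge0.
  - by move=> w _ m n mn; rewrite lee_fin ler_wpM2l// nd.
transitivity (limn (fun n => c * \int[P]_w (f_ n (X w))%:E)).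
  by congr (limn _); apply/funext => n; exact: integral_mul_nnsfun.
have cvi : \int[P]_w (f_ n (X w))%:E @[n --> \oo] --> \int[P]_w (phi (X w))%:E.
  have -> : \int[P]_w (phi (X w))%:E = \int[P]_w (limn (fun n => (f_ n (X w))%:E)).
    by apply: eq_integral => w _; apply/esym/cvg_lim.
  apply: cvg_monotone_convergence => //.
  - by move=> n; apply/measurable_EFinP.
  - by move=> n w _; rewrite lee_fin.
  - by move=> w _ m n mn; rewrite lee_fin nd.
rewrite limeMl//; first by congr (_ * _); exact/cvg_lim.
by apply/cvg_ex; eexists; exact: cvi.
Qed.

Lemma integral_prod_independent (I : finType) (X : I -> {RV P >-> R})
    (phi : I -> R -> R) (c : I -> R) :
  mutually_independent X ->
  (forall i, measurable_fun setT (phi i)) -> (forall i x, (0 <= phi i x)%R) ->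
  (forall i, \int[P]_w (phi i (X i w))%:E = (c i)%:E) ->
  \int[P]_w (\prod_i phi i (X i w))%:E = (\prod_i c i)%:E.
Proof.
move=> ind mphi phi0 Hc.
have c0 i : (0 <= c i)%R.
  by rewrite -lee_fin -Hc; apply: integral_ge0 => w _; rewrite lee_fin.
(* Coordinates are converted one at a time: those in [s] already carry [phi i], the others an
   indicator. Keeping [A] arbitrary in the induction lets the induction hypothesis, with [A j]
   replaced by [B], supply the identity on indicators that [integral_mul_comp] asks of [X j]. *)
pose psi (s : seq I) (A : I -> set R) i : R -> R := if i \in s then phi i else \1_(A i).
pose e (s : seq I) (A : I -> set R) i := if i \in s then c i else fine (P (X i @^-1` A i)).
have psi0 s A i x : (0 <= psi s A i x)%R.
  by rewrite /psi; case: ifP => // _; rewrite indicE.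
have e0 s A i : (0 <= e s A i)%R by rewrite /e; case: ifP => // _; exact: fine_ge0.
have mpsi s (A : I -> set R) i : (forall i, measurable (A i)) -> measurable_fun setT (psi s A i).
  by move=> mA; rewrite /psi; case: ifP => // _; exact: measurable_indic.
suff H s A : (forall i, measurable (A i)) ->
    \int[P]_w (\prod_i psi s A i (X i w))%:E = (\prod_i e s A i)%:E.
  have := H (enum I) (fun=> setT) (fun=> measurableT).
  rewrite (eq_bigr c); last by move=> i _; rewrite /e mem_enum.
  move=> <-; apply: eq_integral => w _; congr EFin; apply: eq_bigr => i _.
  by rewrite /psi mem_enum.
elim: s A => [|j s IH] A mA.
  have mXA i : measurable (X i @^-1` A i).
    by rewrite -(setTI (_ @^-1` _)); exact: measurable_funP.
  have := ind [set: I]%SET A mA.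
  have -> : (\prod_(i in [set: I]%SET) P (X i @^-1` A i) = (\prod_i e [::] A i)%:E).
    rewrite -prodEFin; apply: eq_big => [i|i _]; first by rewrite !inE.
    by rewrite /e/= fineK// fin_num_measure.
  move=> <-.
  rewrite -[X in P X]setIT -(@integral_indic _ _ _ P _ measurableT); last first.
    by apply: fin_bigcap_measurable => //; exact: finite_finset.
  apply: eq_integral => w _; congr EFin.
  rewrite indicE; have [/asboolP H|/asboolPn H] := boolP (`[< forall i, A i (X i w) >]).
    rewrite mem_set; last by move=> i _; exact: H.
    by rewrite big1// => i _; rewrite /psi/= indicE mem_set.
  rewrite memNset; last by move=> K; apply: H => i; apply: K; rewrite /= inE.
  apply/eqP; rewrite prodf_seq_eq0.
  move/existsNP: H => [i Ai]; apply/hasP; exists i; first by rewrite mem_index_enum.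
  by rewrite /psi/= indicE memNset.
have [js|js] := boolP (j \in s).
  have E i : (i \in j :: s) = (i \in s).
    by rewrite inE; case: eqP => // ->; rewrite js.
  rewrite (eq_bigr (e s A)); last by move=> i _; rewrite /e E.
  rewrite -IH//; apply: eq_integral => w _; congr EFin.
  by apply: eq_bigr => i _; rewrite /psi E.
rewrite [in RHS](bigD1 j)//= mulrC EFinM {2}/e mem_head.
under eq_integral do rewrite (bigD1 j)//= mulrC {2}/psi mem_head.
rewrite (@integral_mul_comp _ _ (\prod_(i | i != j) e (j :: s) A i)%:E)//.
- by rewrite Hc.
- under eq_fun do rewrite big_mkcond/=.
  apply: measurable_prod => i _; case: (i != j) => //.
  by apply: measurableT_comp => //; exact: mpsi.
- by move=> w; exact: prodr_ge0.
- by rewrite lee_fin; exact: prodr_ge0.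
move=> B mB; pose A' i := if i == j then B else A i.
have mA' i : measurable (A' i) by rewrite /A'; case: ifP.
have mXB : measurable (X j @^-1` B).
  by rewrite -(setTI (_ @^-1` _)); exact: measurable_funP.
have := IH A' mA'; rewrite (bigD1 j)//=.
have -> : e s A' j = fine (P (X j @^-1` B)) by rewrite /e (negbTE js) /A' eqxx.
rewrite mulrC EFinM fineK ?fin_num_measure//.
rewrite (eq_bigr (e (j :: s) A)); last first.
  by move=> i /negbTE ij; rewrite /e /A' inE ij.
move=> <-; apply: eq_integral => w _; congr EFin.
rewrite [in RHS](bigD1 j)//= [RHS]mulrC; congr (_ * _)%R; last first.
  by rewrite /psi (negbTE js) /A' eqxx.
by apply: eq_bigr => i /negbTE ij; rewrite /psi /A' inE ij.
Qed.
End independence.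

(** * Nonnegative random variables with a bound on the mean *)

Section mean_le.
Context (R : realType) (d : measure_display) (Omega : measurableType d)
  (P : probability Omega R).
Implicit Types (f g : Omega -> R) (a b c : R).

(** The random error terms of the upper bound are carried in this form; it is stable under sums, so
    the errors of all levels add up without a further union bound. *)
Definition mean_le f a := [/\ measurable_fun setT f, forall w, 0 <= f w &
  (\int[P]_w (f w)%:E <= a%:E)%E].

Lemma mean_le_cst c : 0 <= c -> mean_le (fun=> c) c.
Proof.
move=> c0; split => //.
by rewrite integral_cst//= probability_setT mule1.
Qed.

Lemma mean_leD f g a b : mean_le f a -> mean_le g b ->
  mean_le (fun w => f w + g w) (a + b).
Proof.
move=> [mf f0 fa] [mg g0 gb]; split; first exact: measurable_funD.
  by move=> w; rewrite addr_ge0.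
under eq_integral do rewrite EFinD.
rewrite ge0_integralD//.
- by rewrite EFinD leeD.
- by move=> w _; rewrite lee_fin.
- exact/measurable_EFinP.
- by move=> w _; rewrite lee_fin.
- exact/measurable_EFinP.
Qed.

Lemma mean_leZ c f a : 0 <= c -> mean_le f a -> mean_le (fun w => c * f w) (c * a).
Proof.
move=> c0 [mf f0 fa]; split; first exact: measurable_funM.
  by move=> w; rewrite mulr_ge0.
under eq_integral do rewrite EFinM.
rewrite ge0_integralZl_EFin//.
- by rewrite EFinM lee_wpmul2l.
- by move=> w _; rewrite lee_fin.
- exact/measurable_EFinP.
Qed.

Lemma mean_le_sum (I : finType) (f : I -> Omega -> R) (a : I -> R) :
  (forall i, mean_le (f i) (a i)) ->
  mean_le (fun w => \sum_i f i w) (\sum_i a i).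
Proof.
move=> H; have mf i : measurable_fun setT (f i) by have [] := H i.
have f0 i w : 0 <= f i w by have [] := H i.
split; first by apply: measurable_sum.
  by move=> w; apply: sumr_ge0.
under eq_integral do rewrite -sumEFin.
rewrite ge0_integral_sum//.
- by rewrite -sumEFin; apply: lee_sum => i _; have [] := H i.
- by move=> i; exact/measurable_EFinP.
- by move=> i w _; rewrite lee_fin.
Qed.

Lemma mean_le_trans f a b : a <= b -> mean_le f a -> mean_le f b.
Proof. by move=> ab [mf f0 fa]; split => //; apply: le_trans fa _; rewrite lee_fin. Qed.
End mean_le.

(** * Exponential moments and the weighted union bound *)

Section uniform_mgf.
Local Open Scope ereal_scope.
Context (R : realType) (d : measure_display) (Omega : measurableType d)
  (P : probability Omega R) (d' : measure_display) (Omega' : measurableType d')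
  (P' : probability Omega' R).

Lemma integral_identically_distributed (X : {RV P >-> R}) (Z : {RV P' >-> R})
    (phi : R -> R) : identically_distributed X Z ->
  measurable_fun setT phi -> (forall x, (0 <= phi x)%R) ->
  \int[P]_w (phi (X w))%:E = \int[P']_w (phi (Z w))%:E.
Proof.
move=> XZ mphi phi0.
have mE : measurable_fun setT (EFin \o phi) by exact/measurable_EFinP.
have E0 y : 0 <= (EFin \o phi) y by rewrite lee_fin.
rewrite -[LHS](ge0_integral_distribution X mE E0).
rewrite -[RHS](ge0_integral_distribution Z mE E0).
by apply: eq_measure_integral => A mA _; exact: XZ.
Qed.

(* Union bound without tail estimates: [u <= expR u] bounds every member of the
   family by one nonnegative random variable of mean at most 1. *)
Lemma uniform_mgf (I S : finType) (X : I -> {RV P >-> R}) (Z : {RV P' >-> R})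
    (f : S -> I -> R -> R) (b : S -> I -> R) (p : S -> R) :
  mutually_independent X -> (forall i, identically_distributed (X i) Z) ->
  (forall s i, measurable_fun setT (f s i)) ->
  (forall s i, \int[P']_w (expR (f s i (Z w)))%:E <= (1 + b s i)%:E) ->
  (forall s, (0 <= p s)%R) -> (\sum_s p s <= 1)%R ->
  exists2 Xi : Omega -> R, mean_le P Xi 1 &
    forall w s, (0 < p s)%R ->
      (\sum_i f s i (X i w) <= \sum_i b s i - ln (p s) + Xi w)%R.
Proof.
move=> ind idd mf Hf p0 p1.
pose g s w := expR (\sum_i (f s i (X i w) - b s i))%R.
have mfX s i : measurable_fun setT (fun w => f s i (X i w)).
  by apply: measurableT_comp => //.
have mg s : measurable_fun setT (g s).
  apply: measurableT_comp => //; apply: measurable_sum => i.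
  exact: measurable_funB.
(* Each [g s] is normalized to mean at most 1, by independence and [1 + b <= expR b], and the
   average with weights [p] inherits this. Keeping only the term [p s * g s w], which is [expR] of
   the quantity to bound, gives the inequality for [s]. *)
exists (fun w => \sum_s p s * g s w)%R; first split.
- by apply: measurable_sum => s; exact: measurable_funM.
- by move=> w; apply: sumr_ge0 => s _; rewrite mulr_ge0// expR_ge0.
- under eq_integral do rewrite -sumEFin.
  rewrite ge0_integral_sum//; last 2 first.
  + by move=> s; apply/measurable_EFinP; exact: measurable_funM.
  + by move=> s w _; rewrite lee_fin mulr_ge0// expR_ge0.
  apply: (@le_trans _ _ (\sum_s (p s)%:E)); last by rewrite sumEFin lee_fin.
  apply: lee_sum => s _.
  under eq_integral do rewrite EFinM.
  rewrite ge0_integralZl_EFin//; last 2 first.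
  + by move=> w _; rewrite lee_fin expR_ge0.
  + exact/measurable_EFinP.
  rewrite -[leRHS]mule1 lee_wpmul2l ?lee_fin//.
  have me i : measurable_fun setT (fun x => expR (f s i x)) by apply: measurableT_comp.
  have XZ i : \int[P]_w (expR (f s i (X i w)))%:E = \int[P']_w (expR (f s i (Z w)))%:E.
    exact: (@integral_identically_distributed _ _ (fun x => expR (f s i x))).
  pose c i := fine (\int[P']_w (expR (f s i (Z w)))%:E).
  have cE i : \int[P']_w (expR (f s i (Z w)))%:E = (c i)%:E.
    rewrite /c fineK// ge0_fin_numE; first exact: le_lt_trans (Hf s i) (ltry _).
    by apply: integral_ge0 => w _; rewrite lee_fin expR_ge0.
  have c0 i : (0 <= c i)%R.
    by apply: fine_ge0; apply: integral_ge0 => w _; rewrite lee_fin expR_ge0.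
  have -> : \int[P]_w (g s w)%:E =
      \int[P]_w ((expR (- \sum_i b s i))%:E * (\prod_i expR (f s i (X i w)))%:E).
    apply: eq_integral => w _; rewrite -EFinM; congr EFin.
    by rewrite /g sumrB expRD mulrC expR_sum.
  rewrite ge0_integralZl_EFin//; last 2 first.
  + by move=> w _; rewrite lee_fin prodr_ge0// => i _; exact: expR_ge0.
  + apply/measurable_EFinP; apply: measurable_prod => i _.
    by apply: measurableT_comp.
  rewrite (@integral_prod_independent _ _ _ _ _ _ (fun i x => expR (f s i x)) c)//.
  + rewrite -EFinM lee_fin expRN mulrC ler_pdivrMr ?expR_gt0// mul1r expR_sum.
    apply: ler_prod => i _; rewrite c0/=.
    apply: (@le_trans _ _ (1 + b s i)%R); last exact: expR_ge1Dx.
    by rewrite -lee_fin -cE.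
  + by move=> i; rewrite XZ.
- move=> w s ps.
  rewrite -lerBlDl; apply: (@le_trans _ _ (p s * g s w)%R); last first.
    rewrite (bigD1 s)//= lerDl; apply: sumr_ge0 => t _.
    by rewrite mulr_ge0// expR_ge0.
  have -> : (p s * g s w = expR (\sum_i f s i (X i w) - (\sum_i b s i - ln (p s))))%R.
    rewrite opprB addrCA expRD lnK//; congr (_ * _)%R.
    by rewrite /g sumrB.
  by apply: le_trans (expR_ge1Dx _); rewrite lerDr.
Qed.
End uniform_mgf.

(** * Rank-one tensors and the grid net *)

Section grid.
Context (R : realType).

(** [None] is the coordinate 0 and [Some (b, j)] has sign [b] and magnitude [j.+1] times the mesh.
    Zero thus has a single code, and the support is read off by comparison with [None]. *)
Definition gridval (h : R) (B : nat) (o : option (bool * 'I_B)) : R :=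
  if o is Some bj then (-1) ^+ bj.1 * (h * bj.2.+1%:R) else 0.

(** Rounding goes towards zero, so that the rounding of a unit vector stays in the unit ball. *)
Lemma gridval_round (h x : R) (B : nat) : 0 < h -> `|x| <= h * B%:R ->
  exists o : option (bool * 'I_B), `|gridval h o| <= `|x| /\ `|x - gridval h o| <= h.
Proof.
move=> h0 xB.
have u0 : 0 <= `|x| / h by rewrite divr_ge0// ltW.
have /andP[m1 m2] := truncn_itv u0.
have xE : x = (-1) ^+ (x < 0)%R * `|x|.
  case: ltP => x0; rewrite ?expr1 ?expr0 ?mul1r ?mulN1r.
    by rewrite ltr0_norm// opprK.
  by rewrite ger0_norm.
case: (posnP (truncn (`|x| / h))) => [m0|mp].
  exists None; rewrite /gridval normr0 subr0; split => //.
  by move: m2; rewrite m0 ltr_pdivrMr// mul1r => /ltW.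
have mB : ((truncn (`|x| / h)).-1 < B)%N.
  rewrite prednK// -(ler_nat R); apply: le_trans m1 _.
  by rewrite ler_pdivrMr// mulrC.
exists (Some ((x < 0)%R, Ordinal mB)); rewrite /gridval/= prednK//.
set m := truncn _ in m1 m2 mp mB *.
rewrite ler_pdivlMr// in m1; rewrite ltr_pdivrMr// in m2.
split.
  by rewrite normrM normrX normrN1 expr1n mul1r ger0_norm 1?mulrC// mulr_ge0// ltW.
rewrite {1}xE -mulrBr normrM normrX normrN1 expr1n mul1r.
rewrite ger0_norm; last by rewrite subr_ge0 mulrC.
by rewrite lerBlDl; move: m2; rewrite -natr1 mulrDl mul1r mulrC => /ltW.
Qed.
End grid.

Section rank_one.
Context (R : realType) (r : nat) (ns : 'I_r -> nat).
Implicit Types (T : tensor R ns) (x y : forall k, 'I_(ns k) -> R).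

Definition wt x (i : tensor_index ns) : R := \prod_(k < r) x k (i k).

(** The coordinates are put into one tagged type, where a product of sums expands over non-dependent
    functions; [fprod] then brings back the dependent indices. *)
Lemma sum_prod_tensor (F : forall k, 'I_(ns k) -> R) :
  \sum_(i : tensor_index ns) \prod_k F k (i k) = \prod_k \sum_j F k j.
Proof.
under [RHS]eq_bigr => k _ do rewrite (big_tag (fun k => F k : ('I_(ns k) : finType) -> R)).
rewrite bigA_distr_big_dep.
rewrite (reindex (@dffun_of_fprod _ (fun k => 'I_(ns k) : finType))); last first.
  exact/onW_bij/dffun_of_fprod_bij.
have := @big_fprod R 0 1 *%R +%R 'I_r (fun k => 'I_(ns k) : finType)
  (fun k => [ffun j => F k j]).
move=> H; transitivity (\sum_(t : fprod (fun k => 'I_(ns k) : finType))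
   \prod_(k in 'I_r) [ffun j => F k j] (t k)).
  apply: eq_bigr => t _; apply: eq_bigr => k _; rewrite !ffunE.
  done.
rewrite H; apply: eq_bigr => g /familyP gP; apply: eq_bigr => k _.
have := gP k; rewrite inE => /eqP.
by move=> e; rewrite !untagE ffunE.
Qed.

Lemma wt_sqr_sum x : \sum_i wt x i ^+ 2 = \prod_k \sum_j x k j ^+ 2.
Proof.
by rewrite -sum_prod_tensor; apply: eq_bigr => i _; rewrite /wt -prodrXl.
Qed.

Lemma inj_norm_ge0 T : (forall k, 0 < ns k)%N -> 0 <= inj_norm T.
Proof. by move=> n0; have [[y _ <-] _] := inj_norm_attained T n0. Qed.

Lemma inj_norm_wt T y : (forall k, 0 < ns k)%N ->
  `|\sum_i T i * wt y i| <= inj_norm T * \prod_k Num.sqrt (\sum_j y k j ^+ 2).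
Proof.
move=> n0; have [_ ub] := inj_norm_attained T n0.
pose N k := Num.sqrt (\sum_j y k j ^+ 2).
have s0 k : 0 <= \sum_j y k j ^+ 2 by apply: sumr_ge0 => j _; exact: sqr_ge0.
have [/existsP[k /eqP Nk]|/existsPn NN] := boolP [exists k, N k == 0].
  rewrite big1 ?normr0; last first.
    move=> i _; rewrite /wt (bigD1 k)//=.
    suff -> : y k (i k) = 0 by rewrite mul0r mulr0.
    move/eqP: Nk; rewrite sqrtr_eq0 => le0.
    have /eqP := (@le_anti _ _ _ _ (introT andP (conj le0 (s0 k)))).
    rewrite psumr_eq0; last by move=> j _; exact: sqr_ge0.
    by move=> /allP/(_ (i k) (mem_index_enum _)); rewrite sqrf_eq0 => /eqP.
  apply: mulr_ge0; first exact: inj_norm_ge0.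
  by apply: prodr_ge0 => j _; exact: sqrtr_ge0.
have Np k : 0 < N k by rewrite lt_def NN sqrtr_ge0.
pose x k : 'rV[R]_(ns k) := \row_j (y k j / N k).
have xn k : norm2 (x k) = 1.
  rewrite /norm2 (eq_bigr (fun j => y k j ^+ 2 / N k ^+ 2)); last first.
    by move=> j _; rewrite mxE expr_div_n.
  by rewrite -mulr_suml /N sqr_sqrtr// divff ?sqrtr1// gt_eqF// -sqrtr_gt0; exact: Np.
have -> : \sum_i T i * wt y i = tensor_inner T (rank1_tensor x) * \prod_k N k.
  rewrite /tensor_inner mulr_suml; apply: eq_bigr => i _.
  rewrite -mulrA; congr (_ * _); rewrite /wt /rank1_tensor -big_split/=.
  by apply: eq_bigr => k _; rewrite mxE divfK// gt_eqF.
have N0 : 0 <= \prod_k N k by apply: prodr_ge0 => k _; exact: sqrtr_ge0.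
rewrite normrM (ger0_norm N0) ler_wpM2r//.
by apply: ub; exists x.
Qed.

(** A maximizer [y] is replaced by its rounding [x] one mode at a time. Each swap changes the
    pairing by at most the injective norm times the distance of [y k] to [x k], hence times
    [h * sqrt n <= 1 / (2 r)]. The [r] swaps lose at most half of the norm, whence the factor 2. *)
Lemma inj_norm_grid T (n : nat) (h : R) (B : nat) :
  (0 < r)%N -> (forall k, 0 < ns k <= n)%N ->
  0 < h -> 1 <= h * B%:R -> h * Num.sqrt n%:R <= (2 * r%:R)^-1 ->
  exists z : {ffun {k : 'I_r & 'I_(ns k)} -> option (bool * 'I_B)},
    let x k (j : 'I_(ns k)) := gridval h (z (Tagged (fun k => 'I_(ns k)) j)) in
    (forall k, \sum_j x k j ^+ 2 <= 1) /\
    inj_norm T <= 2 * `|\sum_i T i * wt x i|.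
Proof.
move=> r0 nsn h0 hB hn.
have n0 k : (0 < ns k)%N by have /andP[] := nsn k.
have [[y0 y1 yT] _] := inj_norm_attained T n0.
pose y (k : 'I_r) (j : 'I_(ns k)) : R := y0 k ord0 j.
have ys k : \sum_j y k j ^+ 2 = 1.
  have := y1 k; rewrite /norm2 => /(congr1 (fun t => t ^+ 2)).
  by rewrite sqr_sqrtr ?expr1n// sumr_ge0// => j _; exact: sqr_ge0.
have yle k j : `|y k j| <= 1.
  rewrite -(expr_le1 (n := 2))// real_normK ?num_real//.
  by rewrite -(ys k) (bigD1 j)//= lerDl sumr_ge0// => ? _; exact: sqr_ge0.
have /choice[z0 Hz0] : forall c : {k : 'I_r & 'I_(ns k)},
    exists o : option (bool * 'I_B), `|gridval h o| <= `|y (tag c) (tagged c)| /\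
      `|y (tag c) (tagged c) - gridval h o| <= h.
  by move=> c; apply: gridval_round => //; exact: le_trans (yle _ _) hB.
pose z := [ffun c => z0 c]; exists z => x.
have xy k j : `|x k j| <= `|y k j|.
  by rewrite /x ffunE; have [] := Hz0 (Tagged (fun k => 'I_(ns k)) j).
have xyh k j : `|y k j - x k j| <= h.
  by rewrite /x ffunE; have [] := Hz0 (Tagged (fun k => 'I_(ns k)) j).
have xs k : \sum_j x k j ^+ 2 <= 1.
  rewrite -(ys k); apply: ler_sum => j _.
  by rewrite -[leLHS]real_normK ?num_real// -[leRHS]real_normK ?num_real// lerXn2r// nnegrE.
split => //.
pose S := inj_norm T; have S0 : 0 <= S by exact: inj_norm_ge0.
pose v (m : nat) (k : 'I_r) (j : 'I_(ns k)) : R := if (k < m)%N then x k j else y k j.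
have vs m k : \sum_j v m k j ^+ 2 <= 1 by rewrite /v; case: (k < m)%N => //; rewrite ys.
have step m : (m < r)%N ->
    `|\sum_i T i * wt (v m) i| <= `|\sum_i T i * wt (v m.+1) i| + S * (2 * r%:R)^-1.
  move=> mr; pose k0 := Ordinal mr.
  pose u (k : 'I_r) (j : 'I_(ns k)) : R := if k == k0 then y k j - x k j else v m k j.
  have -> : \sum_i T i * wt (v m) i =
      \sum_i T i * wt (v m.+1) i + \sum_i T i * wt u i.
    rewrite -big_split/=; apply: eq_bigr => i _; rewrite -mulrDr; congr (_ * _).
    rewrite /wt !(bigD1 (P := xpredT) k0)//=.
    have e1 : \prod_(k < r | k != k0) v m.+1 k (i k) = \prod_(k < r | k != k0) v m k (i k).
      apply: eq_bigr => k kk0; rewrite /v ltnS leq_eqVlt.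
      by rewrite (_ : (k == m :> nat) = false)//; apply/negbTE.
    have e2 : \prod_(k < r | k != k0) u k (i k) = \prod_(k < r | k != k0) v m k (i k).
      by apply: eq_bigr => k /negbTE kk0; rewrite /u kk0.
    rewrite e1 e2 -mulrDl; congr (_ * _).
    by rewrite /u eqxx /v/= ltnn ltnSn addrC subrK.
  apply: le_trans (ler_normD _ _) _; rewrite lerD2l.
  apply: le_trans (inj_norm_wt T u n0) _; rewrite ler_wpM2l//.
  rewrite (bigD1 k0)//= -[leRHS]mulr1 ler_pM ?sqrtr_ge0//.
  - by apply: prodr_ge0 => k _; exact: sqrtr_ge0.
  - apply: le_trans hn; rewrite /u eqxx.
    rewrite -[leRHS]ger0_norm ?mulr_ge0 ?sqrtr_ge0 ?(ltW h0)//.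
    rewrite -sqrtr_sqr ler_sqrt ?sqr_ge0// exprMn sqr_sqrtr//.
    apply: (@le_trans _ _ (\sum_(j < ns k0) h ^+ 2)).
      apply: ler_sum => j _; rewrite -[leLHS]real_normK ?num_real//.
      by rewrite lerXn2r ?nnegrE// ltW.
    rewrite sumr_const card_ord -[leLHS]mulr_natr ler_wpM2l ?sqr_ge0// ler_nat.
    by have /andP[] := nsn k0.
  - apply: prodr_ile1 => k /negbTE kk0; rewrite sqrtr_ge0/= /u kk0.
    by rewrite -[leRHS]sqrtr1 ler_sqrt; first exact: vs.
have all m : (m <= r)%N -> S <= `|\sum_i T i * wt (v m) i| + m%:R * (S * (2 * r%:R)^-1).
  elim: m => [_|m IH mr].
    rewrite mul0r addr0 /S -yT.
    suff -> : \sum_i T i * wt (v 0%N) i = tensor_inner T (rank1_tensor y0) by [].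
    apply: eq_bigr => i _; congr (_ * _).
  have := IH (ltnW mr); have := step m mr; rewrite -natr1 mulrDl mul1r.
  set a := `|_|; set b := `|_|; set c := S * _; lra.
have rp : 0 < r%:R :> R by rewrite ltr0n.
have := all r (leqnn r).
have -> : r%:R * (S * (2 * r%:R)^-1) = S / 2 by field; rewrite gt_eqF.
have -> : \sum_i T i * wt (v r) i = \sum_i T i * wt x i.
  apply: eq_bigr => i _; congr (_ * _); apply: eq_bigr => k _.
  by rewrite /v ltn_ord.
by rewrite -/S; lra.
Qed.
End rank_one.

(** * Entropy of grid vectors *)

Section entropy.
Context (R : realType) (C : finType) (B : nat).
Local Notation V := (option (bool * 'I_B)).
Implicit Types z : {ffun C -> V}.

Definition mag (o : V) : nat := if o is Some bj then bj.2.+1 else 0%N.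

Definition nz z : nat := #|[pred c | z c != None]|.

(* [entropy D Q s] exceeds the logarithm of the number of integer vectors with at
   most D coordinates, s of them nonzero, and square sum at most Q. *)
Definition entropy (D Q : R) (s : nat) : R :=
  s%:R * ln (4 * expR 2 * Num.sqrt (Q / s%:R) / (s%:R / D)).

(** The weights of the union bound, depending on the support size only. The zero configuration has
    weight 0 and so receives no probabilistic bound; all sums weighted by it vanish. *)
Definition prior (D Q : R) z : R :=
  if (0 < nz z)%N && (\sum_c (mag (z c))%:R ^+ 2 <= Q) then
    expR (- entropy D Q (nz z)) else 0.

Lemma sum_option (T : finType) (F : option T -> R) :
  \sum_o F o = F None + \sum_t F (Some t).
Proof.
rewrite (bigD1 None)//=; congr (_ + _).
have := @big_imset R 0 +%R T (option T) Some [set: T]%SET F.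
rewrite (eq_bigl (fun o => o != None)).
  by move=> ->; [apply: eq_bigl => t; rewrite inE|move=> t u _ _ []].
move=> [t|]/=; first by apply/imsetP; exists t.
by apply/negbTE/negP => /imsetP[].
Qed.

(** The whole series equals [1 / (exp (1 / a) - 1)], and [exp (1 / a) >= 1 + 1 / a]. *)
Lemma sum_expR_geom (a : R) (m : nat) : 0 < a ->
  \sum_(j < m) expR (- (j.+1%:R / a)) <= a.
Proof.
move=> a0; set t := expR (- a^-1).
have t1 : t < 1 by rewrite /t -expR0 ltr_expR oppr_lt0 invr_gt0.
have t0 : 0 < t by exact: expR_gt0.
have -> : \sum_(j < m) expR (- (j.+1%:R / a)) = \sum_(j < m) t * t ^+ j.
  apply: eq_bigr => j _; rewrite -exprS /t -expRM_natl.
  by congr expR; rewrite mulrN.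
rewrite -mulr_sumr.
have H : (1 - t) * \sum_(j < m) t ^+ j <= 1.
  rewrite -[leLHS]opprK -mulNr opprB -subrX1 opprB lerBlDr lerDl exprn_ge0//.
  exact: ltW.
have Ht : t <= a * (1 - t).
  have := expR_ge1Dx a^-1; rewrite -[expR a^-1]opprK.
  have -> : expR a^-1 = t^-1 by rewrite /t expRN invrK.
  rewrite opprK => E.
  have : (1 + a^-1) * t <= 1 by rewrite -[leRHS](mulVf (lt0r_neq0 t0)) ler_wpM2r// ltW.
  rewrite -(ler_pM2l a0) mulrA mulrDr divff ?gt_eqF// mulr1.
  by nra.
apply: (@le_trans _ _ (a * ((1 - t) * \sum_(j < m) t ^+ j))).
  rewrite mulrA ler_wpM2r// sumr_ge0// => j _; rewrite exprn_ge0//; exact: ltW.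
by rewrite -[leRHS]mulr1 ler_wpM2l// ltW.
Qed.

(** A generating function count. For support size [s] the prior is dominated by a product over
    coordinates of weights [om]: 1 at zero and [q * exp (- mag / a)] elsewhere, where
    [a = sqrt (Q / s)] bounds the root mean square magnitude on the support. One coordinate has
    total weight at most [1 + s / D <= exp (s / D)], all of them together at most [e ^ s]. *)
Lemma sum_prior (D Q : R) : 0 < D -> 0 < Q -> #|C|%:R <= D ->
  \sum_z prior D Q z <= 1.
Proof.
move=> D0 Q0 CD.
have nzC z : (nz z < #|C|.+1)%N by rewrite ltnS max_card.
have key s : (0 < s)%N ->
    \sum_(z | nz z == s) prior D Q z <= 2^-1 ^+ s.
  move=> s0.
  have sp : 0 < s%:R :> R by rewrite ltr0n.
  pose a := Num.sqrt (Q / s%:R); have a0 : 0 < a by rewrite sqrtr_gt0 divr_gt0.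
  pose p := s%:R / D; have p0 : 0 < p by rewrite divr_gt0.
  pose q := p / (2 * a); have q0 : 0 < q by rewrite divr_gt0// mulr_gt0.
  pose om (o : V) := if o is Some bj then q * expR (- (bj.2.+1%:R / a)) else 1.
  have om0 o : 0 <= om o by case: o => [bj|]//=; rewrite mulr_ge0 ?expR_ge0// ltW.
  have omE o : om o = q ^+ (o != None) * expR (- ((mag o)%:R / a)).
    by case: o => [bj|] /=; rewrite ?expr1// mul0r oppr0 expR0 mulr1 expr0.
  have sumom : \sum_o om o <= expR p.
    rewrite sum_option/=; apply: le_trans (expR_ge1Dx _); rewrite lerD2l.
    rewrite -big_distrr/=.
    rewrite (eq_bigr (fun bj : bool * 'I_B => expR (- (bj.2.+1%:R / a))))//.
    rewrite -(pair_bigA _ (fun (b : bool) (j : 'I_B) => expR (- (j.+1%:R / a))))/=.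
    rewrite sumr_const card_bool.
    apply: (@le_trans _ _ (q * (a *+ 2))).
      by rewrite ler_wpM2l ?(ltW q0)// lerMn2r/= sum_expR_geom.
    by rewrite /q -[a *+ 2]mulr_natl divfK// gt_eqF// mulr_gt0.
  have pr z : nz z == s -> prior D Q z <= 2^-1 ^+ s * expR (- s%:R) * \prod_c om (z c).
    move=> /eqP zs; rewrite /prior zs s0/=; case: ifP => [zQ|_]; last first.
      by rewrite !mulr_ge0 ?prodr_ge0 ?expR_ge0// exprn_ge0// invr_ge0.
    under eq_bigr do rewrite omE.
    rewrite big_split/= -expR_sum sumrN -mulr_suml.
    have -> : \prod_c q ^+ (z c != None) = q ^+ s.
      rewrite -zs /nz -prodr_const; rewrite [RHS]big_mkcond/=.
      by apply: eq_bigr => c _; rewrite inE; case: (z c != None).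
    have mags : (\sum_c (mag (z c))%:R) / a <= s%:R.
      rewrite ler_pdivrMr//.
      have aQ : a ^+ 2 = Q / s%:R by rewrite sqr_sqrtr// ltW// divr_gt0.
      have : \sum_c ((mag (z c))%:R : R) <=
        \sum_c ((mag (z c))%:R ^+ 2 / a + a *+ (z c != None)) / 2.
        apply: ler_sum => c _; case: (z c) => [bj|]/=; last first.
          by rewrite expr0n/= mul0r mulr0n addr0 mul0r.
        rewrite mulr1n ler_pdivlMr// -(ler_pM2r a0) mulrDl divfK ?gt_eqF//.
        have := sqr_ge0 (bj.2.+1%:R - a); set m := _%:R; by nra.
      move=> /le_trans; apply.
      rewrite -mulr_suml big_split/= -mulr_suml.
      have -> : \sum_c a *+ (z c != None) = s%:R * a.
        rewrite -zs /nz mulr_natl -sumr_const [RHS]big_mkcond/=.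
        by apply: eq_bigr => c _; rewrite inE; case: (z c != None).
      rewrite ler_pdivrMr//.
      have : (\sum_c (mag (z c))%:R ^+ 2) / a <= s%:R * a.
        rewrite ler_pdivrMr// -mulrA -expr2 aQ mulrC divfK// gt_eqF//.
      by lra.
    rewrite /entropy -/a -/p.
    (* The base [4 * e ^ 2 * a / p] of the entropy is [2 * e * e / q]. The 2 makes the sum over
       [s >= 1] at most 1, one [e] pays for the total mass [e ^ s], and the other for the product of
       the factors [exp (- mag / a)], which is at least [e ^ (- s)] by [mags]. *)
    have -> : expR (- (s%:R * ln (4 * expR 2 * a / p))) =
        2^-1 ^+ s * expR (- s%:R) * (q ^+ s * expR (- s%:R)).
      rewrite -mulrN expRM_natl expRN lnK; last first.
        by rewrite posrE divr_gt0// !mulr_gt0// expR_gt0.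
      have -> : expR (- s%:R) = expR (-1) ^+ s :> R by rewrite -expRM_natl mulrN1.
      rewrite -!exprMn; congr (_ ^+ s).
      rewrite /q (_ : 2%R = 1 + 1)// expRD expRN.
      by field; rewrite !gt_eqF// expR_gt0.
    rewrite ler_wpM2l ?mulr_ge0 ?exprn_ge0 ?invr_ge0 ?expR_ge0//.
    rewrite ler_wpM2l ?exprn_ge0 ?(ltW q0)//.
    by rewrite ler_expR lerN2.
  apply: le_trans (ler_sum _ pr) _.
  rewrite -mulr_sumr.
  have le1 : \sum_(z | nz z == s) \prod_c om (z c) <= \sum_(z : {ffun C -> V}) \prod_c om (z c).
    rewrite [leLHS]big_mkcond/=; apply: ler_sum => z _; case: ifP => // _.
    exact: prodr_ge0.
  apply: le_trans (ler_wpM2l _ le1) _.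
    by rewrite mulr_ge0 ?exprn_ge0 ?invr_ge0 ?expR_ge0.
  rewrite -(bigA_distr_bigA (fun c o => om o)).
  rewrite prodr_const -mulrA -[leRHS]mulr1 ler_wpM2l ?exprn_ge0 ?invr_ge0//.
  rewrite expRN mulrC ler_pdivrMr ?expR_gt0// mul1r.
  apply: (@le_trans _ _ (expR p ^+ #|C|)).
    by rewrite lerXn2r ?nnegrE ?expR_ge0//; apply: sumr_ge0.
  rewrite -expRM_natl ler_expR /p mulrCA -[leRHS]mulr1 ler_wpM2l// ?(ltW sp)//.
  by rewrite ler_pdivrMr// mul1r.
rewrite (partition_big (fun z => Ordinal (nzC z)) predT)//=.
rewrite big_ord_recl/= big1 ?add0r; last first.
  by move=> z /eqP/(congr1 val)/= z0; rewrite /prior z0.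
apply: (@le_trans _ _ (\sum_(i < #|C|) 2^-1 ^+ i.+1)).
  apply: ler_sum => i _; apply: le_trans (key i.+1 isT).
  by rewrite (eq_bigl (fun z => nz z == i.+1)).
have : \sum_(i < #|C|) 2^-1 ^+ i.+1 = 1 - 2^-1 ^+ #|C| :> R.
  elim: #|C| => [|m IH]; first by rewrite big_ord0 expr0 subrr.
  by rewrite big_ord_recr/= IH exprS; field.
by move=> ->; rewrite lerBlDr lerDl exprn_ge0// invr_ge0.
Qed.
End entropy.

(** * Fibers and levels *)

Section fibers.
Context (R : realType) (r : nat) (ns : 'I_r -> nat).

Definition same_fiber (k : 'I_r) (i j : tensor_index ns) : bool :=
  [forall l, (l != k) ==> (j l == i l)].

Lemma same_fiberE k i j :
  ((same_fiber k i j)%:R : R) = \prod_l (if l == k then 1 else (j l == i l)%:R).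
Proof.
have [/forallP H|/forallPn[l]] := boolP (same_fiber k i j).
  rewrite big1// => l _; case: eqP => // /eqP lk.
  by have := H l; rewrite lk/= => ->.
rewrite negb_imply => /andP[lk jl].
by rewrite (bigD1 l)//= (negbTE lk) (negbTE jl) mul0r.
Qed.

Lemma same_fiberC k i j : same_fiber k i j = same_fiber k j i.
Proof. by apply: eq_forallb => l; rewrite [j l == _]eq_sym. Qed.

Lemma card_fiber k i : \sum_j ((same_fiber k i j)%:R : R) = (ns k)%:R.
Proof.
under eq_bigr do rewrite same_fiberE.
rewrite (sum_prod_tensor (fun l (j : 'I_(ns l)) => if l == k then 1 else (j == i l)%:R)).
rewrite (bigD1 k)//= eqxx sumr_const card_ord big1 ?mulr1// => l /negbTE ->.
rewrite (bigD1 (i l))//= eqxx big1 ?addr0// => j /negbTE ->//.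
Qed.

(** The weight is constant along fibers in mode [k], and summing over all base points meets each
    fiber [ns k] times. Hence both sides are multiplied by [ns k], which is also the factor produced
    by the free coordinate when the weights are summed. *)
Lemma fiber_sum_le (Y : tensor R ns) (x : forall k, 'I_(ns k) -> R) (F : R) k :
  (0 < ns k)%N -> 0 <= F -> (forall l, \sum_j x l j ^+ 2 <= 1) ->
  (forall i, \sum_(j | same_fiber k i j) Y j ^+ 2 <= F) ->
  \sum_i Y i ^+ 2 * \prod_(l | l != k) x l (i l) ^+ 2 <= F.
Proof.
move=> nk F0 x1 HF.
have nk0 : 0 < (ns k)%:R :> R by rewrite ltr0n.
pose c (i : tensor_index ns) := \prod_(l | l != k) x l (i l) ^+ 2.
have c0 i : 0 <= c i by apply: prodr_ge0 => l _; exact: sqr_ge0.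
rewrite -(ler_pM2r nk0).
have -> : (\sum_i Y i ^+ 2 * c i) * (ns k)%:R =
    \sum_i c i * \sum_(j | same_fiber k i j) Y j ^+ 2.
  rewrite mulr_suml.
  under eq_bigr => i _ do rewrite -(card_fiber k i) mulr_sumr.
  rewrite exchange_big/=; apply: eq_bigr => i _.
  rewrite mulr_sumr [RHS]big_mkcond/=; apply: eq_bigr => j _.
  rewrite same_fiberC; case: ifP => [/forallP ij|_]; last by rewrite mulr0.
  rewrite mulr1 mulrC; congr (_ * _); apply: eq_bigr => l lk.
  by have /implyP/(_ lk)/eqP -> := ij l.
apply: (@le_trans _ _ (\sum_i c i * F)).
  by apply: ler_sum => i _; rewrite ler_wpM2l.
rewrite -mulr_suml mulrC ler_wpM2l//.
have -> : \sum_i c i = \sum_(i : tensor_index ns) \prod_l (if l == k then 1 else x l (i l) ^+ 2).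
  apply: eq_bigr => i _; rewrite /c big_mkcond/=; apply: eq_bigr => l _.
  by case: eqP.
rewrite (sum_prod_tensor (fun l (j : 'I_(ns l)) => if l == k then 1 else x l j ^+ 2)).
rewrite (bigD1 k)//= eqxx sumr_const card_ord -[leRHS]mulr1 ler_wpM2l//.
apply: prodr_ile1 => l /negbTE lk; rewrite lk x1 andbT.
by apply: sumr_ge0 => j _; exact: sqr_ge0.
Qed.
End fibers.

(** * Dyadic levels of a rank-one tensor *)

Section levels.
Context (R : realType) (r : nat) (ns : 'I_r -> nat).
Implicit Types x y : forall k, 'I_(ns k) -> R.

Definition big_at (e : R) x (i : tensor_index ns) : bool :=
  [forall k, e <= `|x k (i k)|].

(** [J] is the least exponent for which all factors have size at least [2 ^ (- J)]. The guard
    [0 < J] matters because [0.-1] is 0: without it level 0 would be empty. *)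
Definition at_level (J : nat) x i : bool :=
  big_at (2^-1 ^+ J) x i && ~~ ((0 < J)%N && big_at (2^-1 ^+ J.-1) x i).

Lemma exp_half_le (J J' : nat) : (J <= J')%N -> 2^-1 ^+ J' <= 2^-1 ^+ J :> R.
Proof. by move=> JJ; apply: ler_wiXn2l => //; lra. Qed.

Lemma exp_half_gt0 (J : nat) : 0 < 2^-1 ^+ J :> R.
Proof. by rewrite exprn_gt0// invr_gt0. Qed.

Lemma sum_at_level x i m : \sum_(J < m.+1) ((at_level J x i)%:R : R) = (big_at (2^-1 ^+ m) x i)%:R.
Proof.
elim: m => [|m IH]; first by rewrite big_ord1 /at_level ltnn andbT.
rewrite big_ord_recr/= IH /at_level ltn0Sn/=.
have [/forallP H|_] := boolP (big_at (2^-1 ^+ m) x i); last by rewrite andbT add0r.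
rewrite andbF addr0; suff -> : big_at (2^-1 ^+ m.+1) x i by [].
by apply/forallP => k; apply: le_trans (H k); exact: exp_half_le.
Qed.

Lemma at_level_exists x i m : big_at (2^-1 ^+ m) x i -> exists2 J, (J <= m)%N & at_level J x i.
Proof.
move=> H; have [J HJ Jm] := ex_minnP (ex_intro (fun J => big_at (2^-1 ^+ J) x i) m H).
exists J; first exact: Jm.
rewrite /at_level HJ/=; case: J HJ Jm => // J _ Jm /=; apply/negP => /Jm.
by rewrite ltnn.
Qed.

Lemma at_level_coord_le x i J : at_level J x i -> (forall k j, `|x k j| <= 1) -> (0 < r)%N ->
  exists k, `|x k (i k)| <= 2 * 2^-1 ^+ J.
Proof.
move=> /andP[_ H] x1 r0; case: J H => [_|J] /=.
  by exists (Ordinal r0); rewrite expr0 mulr1; apply: le_trans (x1 _ _) _; rewrite ler1n.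
move=> /forallPn[k]; rewrite -ltNge => /ltW H; exists k.
by rewrite exprS mulrA divff// mul1r.
Qed.

Lemma sum_wt_at_level x m : (forall k, \sum_j x k j ^+ 2 <= 1) ->
  \sum_(J < m.+1) \sum_i (at_level J x i)%:R * wt x i ^+ 2 <= 1.
Proof.
move=> x1; rewrite exchange_big/=.
apply: (@le_trans _ _ (\sum_i wt x i ^+ 2)).
  apply: ler_sum => i _; rewrite -mulr_suml sum_at_level.
  by case: big_at; rewrite ?mul1r// mul0r sqr_ge0.
rewrite wt_sqr_sum; apply: prodr_ile1 => k _; rewrite x1 andbT.
by apply: sumr_ge0 => j _; exact: sqr_ge0.
Qed.

(** A geometric series of ratio 1/4 whose first term is at most [min 1 (a ^ 2)]. The induction peels
    off [J = 0] and rescales [a] to [2 * a]. *)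
Lemma sum_quarter_le (a : R) m : 0 <= a ->
  \sum_(J < m) 4^-1 ^+ J * (2^-1 ^+ J <= a)%R%:R <= 4 / 3 * Num.min 1 (a ^+ 2).
Proof.
elim: m a => [|m IH] a a0.
  by rewrite big_ord0 mulr_ge0// ?divr_ge0// le_min ler01 sqr_ge0.
rewrite big_ord_recl/= !expr0 mul1r.
have -> : \sum_(i < m) 4^-1 ^+ bump 0 i * (2^-1 ^+ bump 0 i <= a)%R%:R =
    4^-1 * \sum_(J < m) 4^-1 ^+ J * (2^-1 ^+ J <= 2 * a)%R%:R :> R.
  rewrite mulr_sumr; apply: eq_bigr => i _; rewrite /bump/= add1n !exprS mulrA.
  by congr (_ * _%:R); rewrite -(ler_pM2l (_ : 0 < 2 :> R))// mulrA divff// mul1r.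
have := IH (2 * a) (mulr_ge0 (ler0n _ 2) a0).
set s := \sum_(_ < _) _.
have [a1|a1] := lerP 1 a => H.
  have -> : Num.min 1 (a ^+ 2) = 1 by apply/min_idPl; rewrite expr_ge1.
  have : Num.min 1 ((2 * a) ^+ 2) <= 1 by rewrite ge_min lexx.
  by move: H => /=; rewrite mulr1n; lra.
have -> : Num.min 1 (a ^+ 2) = a ^+ 2.
  by apply/min_idPr; rewrite expr_le1// ltW.
have : Num.min 1 ((2 * a) ^+ 2) <= (2 * a) ^+ 2 by rewrite ge_min lexx orbT.
by move: H => /=; rewrite mulr0n exprMn; lra.
Qed.
End levels.

(** * Splitting the entries of the weighted tensor by size *)

Section cutoffs.
Context (R : realType).

Definition light_part (lo y : R) : R := if `|y| <= lo then y else 0.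

Definition band (lo hi y : R) : R := if lo < `|y| <= hi then `|y| else 0.

Lemma band_ge0 lo hi y : 0 <= band lo hi y.
Proof. by rewrite /band; case: ifP. Qed.

Lemma band_split lo mid hi y : lo < `|y| <= hi ->
  `|y| <= band lo mid y + band mid hi y.
Proof.
move=> /andP[l h]; rewrite /band l h andbT/=.
by case: (lerP `|y| mid) => m; rewrite ?lerDl ?lerDr//; case: ifP.
Qed.
End cutoffs.

Section decomposition.
Context (R : realType) (r : nat) (ns : 'I_r -> nat).
Implicit Types x : forall k, 'I_(ns k) -> R.

(** The cut [kap] inside each level is left free here; it is chosen later to balance the exponential
    moments of the two bands. *)
Lemma heavy_decomposition (rho : R) (n m : nat) (Y : R) x
    (kap : nat -> R) (i : tensor_index ns) :
  (0 < r)%N -> (0 < n)%N -> 0 < rho -> (n <= 4 ^ m)%N ->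
  (forall k j, `|x k j| <= 1) ->
  `|Y * wt x i - light_part (rho / n%:R) (Y * wt x i)| <=
    \sum_k Y ^+ 2 * \prod_(l | l != k) x l (i l) ^+ 2 / rho +
    \sum_(J < m.+1) (at_level J x i)%:R *
      (band (rho / n%:R) (kap J) (Y * wt x i) +
       band (kap J) (4 * rho * 4^-1 ^+ J) (Y * wt x i)).
Proof.
move=> r0 n0 rho0 nm x1; set y := Y * wt x i; set tau := rho / n%:R.
have F0 k : 0 <= Y ^+ 2 * \prod_(l | l != k) x l (i l) ^+ 2 / rho.
  apply: divr_ge0 (ltW rho0); apply: mulr_ge0 (sqr_ge0 _) _.
  by apply: prodr_ge0 => l _; exact: sqr_ge0.
have G0 (J : 'I_m.+1) : 0 <= (at_level J x i)%:R *
      (band tau (kap J) y + band (kap J) (4 * rho * 4^-1 ^+ J) y).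
  by rewrite mulr_ge0// addr_ge0// band_ge0.
rewrite /light_part; have [ty|ty] := lerP `|y| tau.
  by rewrite subrr normr0 addr_ge0// sumr_ge0.
rewrite subr0.
have n1 : 0 < n%:R :> R by rewrite ltr0n.
have tau0 : 0 < tau by rewrite divr_gt0.
have y0 : 0 < `|y| by exact: lt_trans ty.
have [/existsP[k]|/existsPn H] := boolP [exists k, rho * x k (i k) ^+ 2 < `|y|].
  move=> Hk; apply: (@le_trans _ _ (Y ^+ 2 * \prod_(l | l != k) x l (i l) ^+ 2 / rho)).
    have xk0 : x k (i k) != 0.
      apply: contraTneq y0 => xk0; rewrite /y /wt (bigD1 k)//= xk0 mul0r mulr0.
      by rewrite normr0 ltxx.
    have xk2 : 0 < x k (i k) ^+ 2 by rewrite lt_def sqrf_eq0 xk0 sqr_ge0.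
    rewrite ler_pdivlMr//.
    have e : y ^+ 2 = Y ^+ 2 * \prod_(l | l != k) x l (i l) ^+ 2 * x k (i k) ^+ 2.
      by rewrite /y exprMn /wt (bigD1 k)//= exprMn -prodrXl mulrA mulrAC mulrA.
    rewrite -(ler_pM2r xk2) -e -[y ^+ 2]real_normK ?num_real// -mulrA expr2.
    by rewrite ler_wpM2l// ltW.
  rewrite [X in _ <= X + _](bigD1 k)//= -addrA lerDl.
  by apply: addr_ge0; apply: sumr_ge0 => // l _; exact: F0.
have {}H k : `|y| <= rho * x k (i k) ^+ 2 by rewrite leNgt; exact: H.
(* Now [rho / n < |y| <= rho * x_k ^ 2] for every [k] forces [x_k ^ 2 > 1 / n >= 4 ^ (- m)], so [i]
   lies on a level [J <= m]. Some factor there is at most [2 * 2 ^ (- J)], and its square gives the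
   top [4 * rho / 4 ^ J] of the level. *)
have b : big_at (2^-1 ^+ m) x i.
  apply/forallP => k; rewrite -(@ler_pXn2r _ 2)// ?nnegrE ?(ltW (exp_half_gt0 _ _))//.
  rewrite real_normK ?num_real// -exprM mulnC exprM.
  have -> : 2^-1 ^+ 2 = 4^-1 :> R by rewrite -[4]/(2 * 2)%:R natrM invfM expr2.
  have := lt_le_trans ty (H k); rewrite /tau ltr_pM2l// => /ltW.
  apply: le_trans; rewrite exprVn lef_pV2 ?posrE ?exprn_gt0// -natrX ler_nat//.
have [J Jm lJ] := at_level_exists b.
have [k kJ] := at_level_coord_le lJ x1 r0.
apply: (@le_trans _ _ (band tau (kap J) y + band (kap J) (4 * rho * 4^-1 ^+ J) y)).
  apply: band_split; rewrite ty/=; apply: le_trans (H k) _.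
  rewrite mulrAC -[leRHS]mulrC ler_wpM2l ?(ltW rho0)//.
  have : `|x k (i k)| ^+ 2 <= (2 * 2^-1 ^+ J) ^+ 2.
    by rewrite lerXn2r ?nnegrE// mulr_ge0// ltW// exp_half_gt0.
  rewrite real_normK ?num_real// exprMn -exprM mulnC exprM.
  have -> : 2^-1 ^+ 2 = 4^-1 :> R by rewrite expr2 -invfM -natrM.
  by rewrite -natrX.
have Jm' : (J < m.+1)%N by [].
rewrite [X in _ <= _ + X](bigD1 (Ordinal Jm'))//= lJ mul1r addrCA lerDl.
rewrite addr_ge0 ?sumr_ge0// => j _; exact: G0.
Qed.
End decomposition.

(** * Restricting a grid vector to its large coordinates *)

Section grid_restriction.
Context (R : realType) (r : nat) (ns : 'I_r -> nat) (h : R) (B : nat).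
Local Notation C := {k : 'I_r & 'I_(ns k)}.
Implicit Types z : {ffun C -> option (bool * 'I_B)}.
Hypothesis h0 : 0 < h.

Definition gridvec z k (j : 'I_(ns k)) : R :=
  gridval h (z (Tagged (fun k => 'I_(ns k)) j)).

(** Sums over level [J] do not change under restriction at [2 ^ (- J)]. The union bound can
    therefore be applied to the restricted configuration, whose prior depends only on the number of
    large coordinates. *)
Definition grid_restrict (e : R) z : {ffun C -> option (bool * 'I_B)} :=
  [ffun c => if e <= `|gridval h (z c)| then z c else None].

Lemma normr_gridval (o : option (bool * 'I_B)) : `|gridval h o| = h * (mag o)%:R :> R.
Proof.
case: o => [[b j]|] /=; last by rewrite normr0 mulr0.
rewrite normrM normrX normrN1 expr1n mul1r ger0_norm// mulr_ge0// ltW//.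
Qed.

Lemma gridvec_restrict e z k (j : 'I_(ns k)) :
  gridvec (grid_restrict e z) j = if e <= `|gridvec z j| then gridvec z j else 0 :> R.
Proof. by rewrite /gridvec /grid_restrict ffunE; case: ifP. Qed.

Lemma big_at_restrict e e' z i : 0 < e -> e <= e' ->
  big_at e' (@gridvec (grid_restrict e z)) i = big_at e' (@gridvec z) i.
Proof.
move=> e0 ee; apply: eq_forallb => k; rewrite gridvec_restrict; case: ifP => // /negbT.
rewrite -ltNge => H; rewrite normr0 !leNgt (lt_le_trans e0 ee)/=.
by rewrite (lt_le_trans H ee).
Qed.

Lemma at_level_restrict J z i :
  at_level J (@gridvec (grid_restrict (2^-1 ^+ J) z)) i = at_level J (@gridvec z) i.
Proof.
rewrite /at_level !big_at_restrict ?exp_half_gt0//.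
by apply: exp_half_le; exact: leq_pred.
Qed.

Lemma wt_restrict J z i : at_level J (@gridvec z) i ->
  wt (@gridvec (grid_restrict (2^-1 ^+ J) z)) i = wt (@gridvec z) i.
Proof.
move=> /andP[/forallP H _]; apply: eq_bigr => k _.
by rewrite gridvec_restrict H.
Qed.

Lemma nz_restrict e z : 0 < e ->
  (nz (grid_restrict e z))%:R = \sum_c (e <= `|gridval h (z c)|)%R%:R :> R.
Proof.
move=> e0; rewrite /nz -sum1_card natr_sum big_mkcond/=; apply: eq_bigr => c _.
rewrite inE/= ffunE; case: (z c) => [bj|] /=; first by case: (e <= _).
by rewrite normr0 leNgt e0.
Qed.

Lemma sum_coord (F : C -> R) :
  \sum_c F c = \sum_k \sum_(j < ns k) F (Tagged (fun k => 'I_(ns k)) j).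
Proof.
rewrite (sig_big_dep xpredT (fun _ _ => true) (fun k j => F (Tagged (fun k => 'I_(ns k)) j)))/=.
by apply: eq_bigr => -[].
Qed.

Lemma sum_gridval_sqr z : (forall k, \sum_j @gridvec z k j ^+ 2 <= 1) ->
  \sum_c gridval h (z c) ^+ 2 <= r%:R.
Proof.
move=> H; rewrite sum_coord -[r in leRHS]card_ord -sumr_const.
by apply: ler_sum => k _; exact: H.
Qed.

(** Exchanging the sums, a coordinate [x] is counted on the levels with [2 ^ (- J) <= |x|], which
    contribute at most [4 / 3 * x ^ 2]; the squares sum to at most [r]. *)
Lemma sum_nz_restrict z m : (forall k, \sum_j @gridvec z k j ^+ 2 <= 1) ->
  \sum_(J < m) 4^-1 ^+ J * (nz (grid_restrict (2^-1 ^+ J) z))%:R <= 4 / 3 * r%:R :> R.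
Proof.
move=> H; under eq_bigr do rewrite nz_restrict ?exp_half_gt0// mulr_sumr.
rewrite exchange_big/=.
apply: (@le_trans _ _ (\sum_c 4 / 3 * gridval h (z c) ^+ 2)); last first.
  by rewrite -mulr_sumr ler_wpM2l ?divr_ge0// sum_gridval_sqr.
apply: ler_sum => c _; apply: le_trans (sum_quarter_le _ (normr_ge0 _)) _.
by rewrite ler_wpM2l ?divr_ge0// real_normK ?num_real// ge_min lexx orbT.
Qed.

Lemma prior_restrict D Q e z : (forall k, \sum_j @gridvec z k j ^+ 2 <= 1) ->
  r%:R <= h ^+ 2 * Q -> (0 < nz (grid_restrict e z))%N ->
  prior D Q (grid_restrict e z) = expR (- entropy D Q (nz (grid_restrict e z))).
Proof.
move=> H hQ z0; rewrite /prior z0/= ifT//.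
rewrite -(ler_pM2l (_ : 0 < h ^+ 2)) ?exprn_gt0//; apply: le_trans hQ.
apply: le_trans (sum_gridval_sqr H).
rewrite mulr_sumr; apply: ler_sum => c _; rewrite -exprMn -normr_gridval.
rewrite real_normK ?num_real// ffunE; case: ifP => //=.
by rewrite expr0n/= sqr_ge0.
Qed.

Lemma grid_restrict0 z : grid_restrict 0 z = z.
Proof. by apply/ffunP => c; rewrite ffunE normr_ge0. Qed.
End grid_restriction.
Arguments gridvec {R r ns} h {B} z k j.

(** * The entropy cost, per configuration and summed over levels *)

Section entropy_bounds.
Context (R : realType).

Lemma ln_le_subr1 (x : R) : 0 < x -> ln x <= x - 1.
Proof.
move=> x0; have := @le_ln1Dx R (x - 1); rewrite addrCA subrr addr0; apply.
by rewrite ltrBrDl subrr.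
Qed.

(** For this [Q] the logarithm is that of [8 * e ^ 2 * r * u ^ (3 / 2)] with [u = D / s]. The 5 is 2
    plus a bound for [3 * ln 2], and [ln r] is crudely replaced by [r]. *)
Lemma entropy_le (D : R) (r s : nat) : (0 < s)%N -> (0 < r)%N -> 0 < D ->
  entropy D (4 * r%:R ^+ 2 * D) s <=
  s%:R * (5 + r%:R + 3 / 2 * ln (D / s%:R)).
Proof.
move=> s0 r0 D0; have sp : 0 < s%:R :> R by rewrite ltr0n.
have rp : 0 < r%:R :> R by rewrite ltr0n.
rewrite /entropy ler_wpM2l ?(ltW sp)//.
set u := D / s%:R; have u0 : 0 < u by rewrite divr_gt0.
have -> : Num.sqrt (4 * r%:R ^+ 2 * D / s%:R) = 2 * r%:R * Num.sqrt u.
  rewrite -mulrA sqrtrM ?mulr_ge0 ?sqr_ge0// -/u; congr (_ * _).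
  have -> : 4 * r%:R ^+ 2 = (2 * r%:R) ^+ 2 :> R by ring.
  by rewrite sqrtr_sqr ger0_norm// mulr_ge0.
have -> : 4 * expR 2 * (2 * r%:R * Num.sqrt u) / (s%:R / D) =
    2 * 2 * 2 * expR 2 * r%:R * Num.sqrt u * u.
  by rewrite /u; field; rewrite !gt_eqF.
clearbody u; have v0 : 0 < Num.sqrt u by rewrite sqrtr_gt0.
have e0 : 0 < expR 2 :> R by exact: expR_gt0.
have p2 : 0 < 2 :> R by [].
rewrite !lnM ?posrE ?mulr_gt0// expRK.
have : ln u = 2 * ln (Num.sqrt u).
  by rewrite -{1}(sqr_sqrtr (ltW u0)) lnXn// mulr_natl.
have := @ln_le_subr1 2 p2; have := ln_le_subr1 rp.
by lra.
Qed.

Lemma mul_ln_le (D s : R) : 0 < s -> 0 < D -> s * ln (D / s) <= D.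
Proof.
move=> s0 D0; have := ln_le_subr1 (divr_gt0 D0 s0); rewrite -(ler_pM2l s0).
have -> : s * (D / s - 1) = D - s by field; rewrite gt_eqF.
by lra.
Qed.

Lemma entropy_le_dim (D : R) (r s : nat) : (0 < s)%N -> (0 < r)%N -> 0 < D ->
  s%:R <= D -> entropy D (4 * r%:R ^+ 2 * D) s <= D * (7 + r%:R).
Proof.
move=> s0 r0 D0 sD; have sp : 0 < s%:R :> R by rewrite ltr0n.
apply: le_trans (entropy_le s0 r0 D0) _; have := mul_ln_le sp D0.
have : s%:R * (5 + r%:R) <= D * (5 + r%:R) by rewrite ler_wpM2r// addr_ge0.
by set l := ln _; lra.
Qed.

(* With [A = s / 4 ^ J], the term [A * ln (1 / A)] is absorbed by
   [A * ln L + 1 / L]. *)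
Lemma level_entropy_le (n r s J : nat) (L : R) :
  (0 < n)%N -> (0 < r)%N -> 1 <= L -> L ^+ 2 = 4 * n%:R * 4^-1 ^+ J ->
  4 * 4^-1 ^+ J / (1 + ln L) *
    entropy (r%:R * n%:R) (4 * r%:R ^+ 2 * (r%:R * n%:R)) s <=
  4 * ((5 + 5 / 2 * r%:R) * (4^-1 ^+ J * s%:R) + 3 / 2 * L^-1).
Proof.
move=> n0 r0 L1 LE; have L0 : 0 < L by exact: lt_le_trans ltr01 L1.
have rp : 0 < r%:R :> R by rewrite ltr0n.
have np : 0 < n%:R :> R by rewrite ltr0n.
have q0 : 0 < 4^-1 ^+ J :> R by rewrite exprn_gt0// invr_gt0.
have l0 : 0 <= ln L by rewrite ln_ge0.
have lp : 0 < 1 + ln L by lra.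
case: s => [|s].
  by rewrite /entropy mul0r mulr0 !mulr0 add0r !mulr_ge0// invr_ge0 ltW.
have D0 : 0 < r%:R * n%:R :> R by rewrite mulr_gt0.
set S := s.+1%:R; have S0 : 0 < S :> R by rewrite ltr0n.
have := @entropy_le (r%:R * n%:R) r s.+1 isT r0 D0; set H := entropy _ _ _; rewrite -/S => Hle.
set A := 4^-1 ^+ J * S; have A0 : 0 < A by rewrite mulr_gt0.
(* Indeed [r * n / s = (r / 4) * L ^ 2 / A]. The part [2 * ln L] is what the division by [1 + ln L]
   is designed to cancel. *)
have lnD : ln (r%:R * n%:R / S) <= r%:R + 2 * ln L - ln A.
  have -> : r%:R * n%:R / S = r%:R / 4 * L * L * A^-1.
    rewrite (_ : r%:R / 4 * L * L = r%:R / 4 * L ^+ 2); last by rewrite expr2 mulrA.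
    by rewrite LE /A; field; rewrite !gt_eqF.
  move: A A0 => A A0.
  rewrite !lnM ?posrE ?mulr_gt0 ?invr_gt0// !lnV ?posrE//.
  have -> : ln 4 = 2 * ln 2 :> R.
    by rewrite (_ : 4 = 2 ^+ 2) ?lnXn ?mulr_natl//; ring.
  have := ln_le_subr1 rp; have : 0 <= ln 2 :> R by rewrite ln_ge0// ler1n.
  by lra.
have Aln : - (A * ln A) <= A * ln L + L^-1.
  move: A A0 {lnD} => A A0.
  have AL : 0 < A * L by rewrite mulr_gt0.
  have := @ln_le_subr1 (A * L)^-1; rewrite invr_gt0 => /(_ AL).
  rewrite lnV ?posrE// lnM ?posrE// -(ler_pM2l A0) mulrBr mulr1.
  rewrite invfM mulrA divff ?gt_eqF// mul1r.
  by rewrite mulrN mulrDr; lra.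
have {Hle}Hle : 4^-1 ^+ J * H <= A * (5 + r%:R + 3 / 2 * ln (r%:R * n%:R / S)).
  by rewrite /A -mulrA ler_pM2l.
have : 4^-1 ^+ J * H <= (1 + ln L) * ((5 + 5 / 2 * r%:R) * A + 3 / 2 * L^-1).
  apply: le_trans Hle _.
  have : A * ln (r%:R * n%:R / S) <= A * (r%:R + 2 * ln L - ln A) by rewrite ler_pM2l.
  have Li : 0 <= L^-1 by rewrite invr_ge0 ltW.
  have : 0 <= ln L * A by rewrite mulr_ge0// ltW.
  have : 0 <= ln L * A * r%:R by rewrite !mulr_ge0// ltW.
  have : 0 <= ln L * L^-1 by rewrite mulr_ge0.
  move: Aln Li A0.
  set d := ln (_ / _); set i := L^-1; set l := ln L; set a := ln A; set rr := r%:R.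
  by clearbody A d i l a rr; lra.
rewrite -(ler_pdivrMl _ _ lp).
by set X := (5 + _) * A + _; set y := 4^-1 ^+ J; rewrite -!mulrA => K;
  rewrite ler_pM2l// [y * _]mulrCA.
Qed.

(** Of the two terms left by [level_entropy_le], the first is summed by [sum_nz_restrict] and the
    second by the sum of the [1 / L J]; neither grows with the number of levels. *)
Lemma sum_level_entropy_le (r : nat) (ns : 'I_r -> nat) (h : R) (B n m : nat)
    (L : nat -> R) (z : {ffun {k : 'I_r & 'I_(ns k)} -> option (bool * 'I_B)}) :
  0 < h -> (0 < n)%N -> (2 <= r)%N ->
  (forall J, (J <= m)%N -> 1 <= L J /\ L J ^+ 2 = 4 * n%:R * 4^-1 ^+ J) ->
  \sum_(J < m.+1) (L J)^-1 <= 2 ->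
  (forall k, \sum_j (@gridvec R r ns h B z k j) ^+ 2 <= 1) ->
  \sum_(J < m.+1) 4 * 4^-1 ^+ J / (1 + ln (L J)) *
    entropy (r%:R * n%:R) (4 * r%:R ^+ 2 * (r%:R * n%:R)) (nz (grid_restrict h (2^-1 ^+ J) z))
  <= 40 * r%:R ^+ 2.
Proof.
move=> h0 n0 r2 HL sL H; have r0 : (0 < r)%N by exact: ltn_trans r2.
apply: (@le_trans _ _ (\sum_(J < m.+1) 4 * ((5 + 5 / 2 * r%:R) *
    (4^-1 ^+ J * (nz (grid_restrict h (2^-1 ^+ J) z))%:R) + 3 / 2 * (L J)^-1))).
  apply: ler_sum => J _; have [L1 LE] := HL J (leq_ord J).
  exact: level_entropy_le.
rewrite -mulr_sumr big_split/= -!mulr_sumr.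
have := @sum_nz_restrict R r ns h B z m.+1 H.
set a := \sum_(_ < _) _; move: sL; set b := \sum_(_ < _) _ => sL sa.
have rr : 2 <= r%:R :> R by rewrite ler_nat.
have : (5 + 5 / 2 * r%:R) * a <= (5 + 5 / 2 * r%:R) * (4 / 3 * r%:R).
  by rewrite ler_wpM2l// addr_ge0// mulr_ge0// divr_ge0.
by move: rr; set q := r%:R; nra.
Qed.
End entropy_bounds.

(** * Uniform bounds for clipped tensors *)

Section pointwise.
Context (R : realType).

Lemma measurable_light_part (lo : R) : measurable_fun setT (light_part lo).
Proof.
apply: measurable_fun_ifT => //.
by apply: measurable_fun_ler => //; exact: normr_measurable.
Qed.

Lemma measurable_band (lo hi : R) : measurable_fun setT (band lo hi).
Proof.
apply: measurable_fun_ifT => //.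
apply: measurable_and.
  by apply: measurable_fun_ltr => //; exact: normr_measurable.
by apply: measurable_fun_ler => //; exact: normr_measurable.
Qed.

Lemma measurable_clip (M : R) : measurable_fun setT (clip M).
Proof.
apply: measurable_fun_ifT => //.
  by apply: measurable_fun_ler => //; exact: normr_measurable.
by apply: measurable_fun_ifT => //; exact: measurable_fun_ltr.
Qed.

(** From [1 - u <= exp (- u)] and [(1 - u) * (1 + u + 2 * u ^ 2) = 1 + u ^ 2 * (1 - 2 * u) >= 1]. *)
Lemma expR_le_quad (u : R) : u <= 2^-1 -> expR u <= 1 + u + 2 * u ^+ 2.
Proof.
move=> u2; have := expR_ge1Dx (- u); rewrite expRN => H.
have e0 := expR_gt0 u.
have : (1 - u) * expR u <= 1.
  by rewrite -ler_pdivlMr// mul1r.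
have : 0 < 1 - u by lra.
move=> p K; rewrite -(ler_pM2l p); apply: le_trans K _.
have : 0 <= u ^+ 2 * (1 - 2 * u) by rewrite mulr_ge0 ?sqr_ge0//; lra.
by rewrite !expr2; lra.
Qed.

(** The linear term is that of [y], not of its truncation, so that only the small mean of the
    clipped entry appears after integration. Beyond [lo] the left side is 1, and there
    [y ^ 2 / lo ^ 2] outweighs a negative linear term. The sign [s] serves to bound absolute
    values. *)
Lemma expR_light_part (lo y s : R) : 0 < lo -> s ^+ 2 = 1 ->
  expR (s * light_part lo y / (2 * lo)) <=
    1 + s / (2 * lo) * y + (lo ^+ 2)^-1 * y ^+ 2.
Proof.
move=> lo0 s1.
have l2 : 0 < 2 * lo by lra.
have := @expR_le_quad (s * light_part lo y / (2 * lo)).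
have slo t : `|t| <= lo -> s * t <= lo.
  move=> tlo; apply: le_trans tlo; apply: le_trans (ler_norm (s * t)) _.
  by rewrite normrM -[`|s|]sqrtr_sqr s1 sqrtr1 mul1r.
have sl : s * light_part lo y <= lo.
  by apply: slo; rewrite /light_part; case: ifP => // _; rewrite normr0 ltW.
rewrite ler_pdivrMr// (_ : 2^-1 * (2 * lo) = lo); last by field.
move=> /(_ sl) /le_trans; apply.
set k := (lo ^+ 2)^-1; have k0 : 0 < k by rewrite invr_gt0 exprn_gt0.
have -> : 2 * (s * light_part lo y / (2 * lo)) ^+ 2 = k * (light_part lo y ^+ 2 / 2).
  by rewrite !exprMn s1 /k; field; rewrite gt_eqF.
rewrite /light_part; have [yl|yl] := lerP `|y| lo.
  by rewrite [s * y / _]mulrAC lerD2l ler_pM2l//; have := sqr_ge0 y; lra.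
rewrite expr0n/= !mul0r !mulr0 mul0r !addr0 -addrA lerDl.
have y2 : lo * `|y| <= y ^+ 2.
  by rewrite -[y ^+ 2]real_normK ?num_real// expr2 ler_wpM2r// ltW.
have sy : - `|y| <= s * y.
  rewrite lerNl; apply: le_trans (ler_norm (- (s * y))) _.
  by rewrite normrN normrM -[`|s|]sqrtr_sqr s1 sqrtr1 mul1r.
have -> : s / (2 * lo) * y + k * y ^+ 2 = k * (s * y * lo / 2 + y ^+ 2).
  by rewrite /k; field; rewrite gt_eqF.
rewrite mulr_ge0 ?(ltW k0)//.
have : 0 <= lo * (s * y + `|y|) by rewrite mulr_ge0 ?(ltW lo0)// -lerBlDr sub0r.
have : 0 <= lo * `|y| by rewrite mulr_ge0// ltW.
by lra.
Qed.

(** The tilted value [u] is at most [lam], so [exp u <= 1 + u * exp lam], and on the band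
    [|y| <= y ^ 2 / lo]. Thus a second moment is all that enters. *)
Lemma expR_band (lo hi lam y : R) : 0 < lo -> 0 < hi -> 0 < lam ->
  expR (lam / hi * band lo hi y) <= 1 + lam * expR lam / (lo * hi) * y ^+ 2.
Proof.
move=> lo0 hi0 lam0.
have c0 : 0 <= lam * expR lam / (lo * hi) * y ^+ 2.
  by rewrite mulr_ge0 ?sqr_ge0// divr_ge0 ?mulr_ge0 ?expR_ge0// ltW.
rewrite /band; case: ifP => [/andP[yl yh]|_]; last by rewrite mulr0 expR0 lerDl.
set u := lam / hi * `|y|.
have u0 : 0 <= u by rewrite mulr_ge0// divr_ge0// ltW.
have ul : u <= lam by rewrite /u mulrAC ler_pdivrMr// ler_wpM2l// ltW.
have : expR u <= 1 + u * expR u.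
  have := expR_ge1Dx (- u); rewrite expRN => H; have e0 := expR_gt0 u.
  have : (1 - u) * expR u <= 1 by rewrite -ler_pdivlMr// mul1r.
  by lra.
move=> /le_trans; apply; rewrite lerD2l.
apply: (@le_trans _ _ (u * expR lam)); first by rewrite ler_wpM2l// ler_expR.
have y2 : lo * `|y| <= y ^+ 2.
  by rewrite -[y ^+ 2]real_normK ?num_real// expr2 ler_wpM2r// ltW.
have -> : lam * expR lam / (lo * hi) * y ^+ 2 = lam * expR lam / hi * (y ^+ 2 / lo).
  by field; rewrite !gt_eqF.
rewrite /u mulrAC [lam / hi * _]mulrAC ler_wpM2l//.
  by rewrite divr_ge0 ?mulr_ge0 ?expR_ge0// ltW.
by rewrite ler_pdivlMr// mulrC.
Qed.
End pointwise.

Section uniform_bounds.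
Context (R : realType) (r : nat) (ns : 'I_r -> nat)
  (d : measure_display) (Omega : measurableType d) (P : probability Omega R)
  (d' : measure_display) (Omega' : measurableType d') (P' : probability Omega' R)
  (Z : {RV P' >-> R}) (T : tensor_index ns -> {RV P >-> R}).
Variables (n B : nat) (h M m V : R).
Hypothesis ind : mutually_independent T.
Hypothesis idd : forall i, identically_distributed (T i) Z.
Hypothesis r2 : (2 <= r)%N.
Hypothesis nsn : forall k, (0 < ns k <= n)%N.
(** The distribution of the clipped entry enters in this form: mean at most [m] in absolute value
    and second moment at most [V], stated for the quadratics that dominate the exponentials. *)
Hypothesis int_quad : forall a c : R, 0 <= c ->
  (\int[P']_w (1 + a * clip M (Z w) + c * clip M (Z w) ^+ 2)%:E
     <= (1 + `|a| * m + c * V)%:E)%E.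

Local Notation C := {k : 'I_r & 'I_(ns k)}.
Local Notation config := {ffun C -> option (bool * 'I_B)}.
Local Notation X z := (@gridvec R r ns h B z).
Local Notation D := (r%:R * n%:R : R).
Local Notation Q := (4 * r%:R ^+ 2 * D).
Local Notation H := (entropy D Q).

Let r0 : (0 < r)%N. Proof. exact: ltn_trans r2. Qed.
Let n0 : (0 < n)%N.
Proof. by have /andP[a b] := nsn (Ordinal r0); exact: leq_trans a b. Qed.
Let D0 : 0 < D. Proof. by rewrite mulr_gt0// ltr0n. Qed.
Let Q0 : 0 < Q. Proof. by rewrite !mulr_gt0 ?exprn_gt0 ?ltr0n. Qed.

Lemma card_coord_le : #|{: C}|%:R <= D.
Proof.
rewrite -sum1_card natr_sum sum_coord.
rewrite -natrM -[r in leRHS]card_ord natrM -sum1_card natr_sum mulr_suml.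
apply: ler_sum => k _; rewrite sumr_const card_ord mul1r ler_nat.
by have /andP[] := nsn k.
Qed.

(** The family is doubled by a sign to control the absolute value, which is why the prior is
    halved. *)
Lemma uniform_light (tau : R) : 0 < tau ->
  exists2 Xi : Omega -> R, mean_le P Xi 1 &
    forall w (z : config), 0 < prior D Q z ->
    `|\sum_i light_part tau (clip M (T i w) * wt (X z) i)| <=
      2 * tau * (\sum_i (`|wt (X z) i| / (2 * tau) * m + wt (X z) i ^+ 2 / tau ^+ 2 * V)
                 - ln (prior D Q z / 2) + Xi w).
Proof.
move=> t0; have t2 : 0 < 2 * tau by rewrite mulr_gt0.
pose f (s : bool * config) i (t : R) : R :=
  (-1) ^+ s.1 * light_part tau (clip M t * wt (X s.2) i) / (2 * tau).
pose b (s : bool * config) i : R :=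
  `|wt (X s.2) i| / (2 * tau) * m + wt (X s.2) i ^+ 2 / tau ^+ 2 * V.
pose p (s : bool * config) : R := prior D Q s.2 / 2.
have pr0 z : 0 <= prior D Q z by rewrite /prior; case: ifP => // _; exact: expR_ge0.
have [||||Xi Xi1 HXi] := @uniform_mgf R _ _ P _ _ P' _ _ T Z f b p ind idd.
- move=> s i; rewrite /f.
  apply: measurable_funM => //; apply: measurable_funM => //.
  apply: (@measurableT_comp _ _ _ _ _ _ (light_part tau)); first exact: measurable_light_part.
  by apply: measurable_funM => //; exact: measurable_clip.
- move=> s i; set w := wt (X s.2) i.
  pose a := (-1) ^+ s.1 / (2 * tau) * w; pose c := w ^+ 2 / tau ^+ 2.
  apply: le_trans (ge0_le_integralT P'
    (g := fun t => (1 + a * clip M (Z t) + c * clip M (Z t) ^+ 2)%:E) _ _) _.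
  + by move=> t; rewrite lee_fin expR_ge0.
  + move=> t; rewrite lee_fin /f.
    apply: le_trans (expR_light_part _ t0 _) _.
      by rewrite -exprM mulnC exprM sqrrN !expr1n.
    rewrite le_eqVlt; apply/orP; left; apply/eqP.
    by rewrite -/w /a /c; field; rewrite gt_eqF.
  apply: le_trans (@int_quad a c _) _; first by rewrite divr_ge0 ?sqr_ge0.
  rewrite lee_fin /b -/w -addrA lerD2l /a !normrM normrX normrN1 expr1n mul1r.
  by rewrite [`|_^-1|]ger0_norm ?invr_ge0 ?(ltW t2)// [_^-1 * _]mulrC.
- by move=> s; rewrite divr_ge0.
- rewrite /p -(pair_bigA _ (fun (b : bool) (z : config) => prior D Q z / 2))/=.
  rewrite sumr_const card_bool -mulr_suml -[leLHS]mulr_natr divfK//.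
  exact: sum_prior card_coord_le.
exists Xi => // w z pz.
have pz2 : 0 < prior D Q z / 2 by rewrite divr_gt0.
rewrite ler_norml; apply/andP; split.
  rewrite lerNl; have := HXi w (true, z) pz2; rewrite /f /b /p/=.
  rewrite -mulr_suml ler_pdivrMr// [leRHS]mulrC; apply: le_trans.
  by rewrite -mulr_sumr expr1 mulN1r.
have := HXi w (false, z) pz2; rewrite /f /b /p/=.
rewrite -mulr_suml ler_pdivrMr// [leRHS]mulrC; apply: le_trans.
by rewrite -mulr_sumr expr0 mul1r.
Qed.

(** [lam] divides the union bound cost [- ln (prior D Q z)] but multiplies the mean term by
    [expR lam]; the two bands of a level use different values. *)
Lemma uniform_band (lo hi lam : R) (J : nat) : 0 < lo -> 0 < hi -> 0 < lam ->
  exists2 Xi : Omega -> R, mean_le P Xi 1 &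
    forall w (z : config), 0 < prior D Q z ->
    \sum_i (at_level J (X z) i)%:R * band lo hi (clip M (T i w) * wt (X z) i) <=
      expR lam * V / lo * (\sum_i (at_level J (X z) i)%:R * wt (X z) i ^+ 2) +
      hi / lam * (- ln (prior D Q z) + Xi w).
Proof.
move=> lo0 hi0 lam0; have lh : 0 < lam / hi by rewrite divr_gt0.
pose f (z : config) i (t : R) : R :=
  (at_level J (X z) i)%:R * (lam / hi * band lo hi (clip M t * wt (X z) i)).
pose b (z : config) i : R :=
  (at_level J (X z) i)%:R * wt (X z) i ^+ 2 * (lam * expR lam / (lo * hi) * V).
have pr0 z : 0 <= prior D Q z by rewrite /prior; case: ifP => // _; exact: expR_ge0.
have [||||Xi Xi1 HXi] := @uniform_mgf R _ _ P _ _ P' _ _ T Z f b (prior D Q) ind idd.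
- move=> z i; rewrite /f.
  apply: measurable_funM => //; apply: measurable_funM => //.
  apply: (@measurableT_comp _ _ _ _ _ _ (band lo hi)); first exact: measurable_band.
  by apply: measurable_funM => //; exact: measurable_clip.
- move=> z i; set w := wt (X z) i.
  pose k := (at_level J (X z) i)%:R * (lam * expR lam / (lo * hi) * w ^+ 2).
  have k0 : 0 <= k by rewrite mulr_ge0// mulr_ge0 ?sqr_ge0// divr_ge0 ?mulr_ge0 ?expR_ge0// ltW.
  apply: le_trans (ge0_le_integralT P'
    (g := fun t => (1 + 0 * clip M (Z t) + k * clip M (Z t) ^+ 2)%:E) _ _) _.
  + by move=> t; rewrite lee_fin expR_ge0.
  + move=> t; rewrite lee_fin /f mul0r addr0 /k; case: at_level; last by rewrite !mul0r expR0 addr0.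
    rewrite !mul1r; apply: le_trans (expR_band _ lo0 hi0 lam0) _.
    by rewrite -/w exprMn [clip _ _ ^+ 2 * _]mulrC mulrA.
  apply: le_trans (@int_quad 0 k k0) _.
  rewrite normr0 mul0r addr0 lee_fin lerD2l /k /b -/w.
  by rewrite le_eqVlt; apply/orP; left; apply/eqP; ring.
- exact: pr0.
- exact: sum_prior card_coord_le.
exists Xi => // w z pz.
have := HXi w z pz; rewrite /f /b -mulr_suml.
under eq_bigr do rewrite mulrCA.
rewrite -mulr_sumr -ler_pdivlMl// invf_div => /le_trans; apply.
rewrite le_eqVlt; apply/orP; left; apply/eqP.
by field; rewrite !gt_eqF.
Qed.
End uniform_bounds.

(** [L J ^ 2] is the ratio of the top [4 * rho / 4 ^ J] of level [J] to [rho / n]. Minimality of [m]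
    gives [4 ^ m <= 4 * n], so [L] is still at least 1 at the last level, and the increasing
    geometric sum of the [1 / L J] is at most twice the bound 1 of its last term. *)
Lemma levels_bounds (R : realType) (n : nat) (m := up_log 4 n)
    (L := fun J => 2 * Num.sqrt n%:R * 2^-1 ^+ J : R) : (2 <= n)%N ->
  [/\ (n <= 4 ^ m)%N,
      forall J, (J <= m)%N -> 1 <= L J /\ L J ^+ 2 = 4 * n%:R * 4^-1 ^+ J &
      \sum_(J < m.+1) (L J)^-1 <= 2].
Proof.
move=> n2; have np : 0 < n%:R :> R by rewrite ltr0n; exact: ltn_trans n2.
have s0 : 0 < Num.sqrt n%:R :> R by rewrite sqrtr_gt0.
have m0 : (0 < m)%N.
  rewrite lt0n; apply/eqP => m0; have := up_logP n (isT : (1 < 4)%N).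
  by rewrite -/m m0 expn0 leqNgt n2.
have nm : (n <= 4 ^ m)%N by exact: up_logP.
have mn : (4 ^ m <= 4 * n)%N.
  by have := up_log_gtn (isT : (1 < 4)%N) n2; rewrite -/m -(prednK m0) expnS leq_pmul2l//= => /ltnW.
have LE J : L J ^+ 2 = 4 * n%:R * 4^-1 ^+ J.
  rewrite /L !exprMn sqr_sqrtr ?(ltW np)// -exprM mulnC exprM.
  rewrite (_ : 2 ^+ 2 = 4 :> R); last by ring.
  by rewrite (_ : 2^-1 ^+ 2 = 4^-1 :> R)//; field.
have m4 : 2 ^+ m <= 2 * Num.sqrt n%:R :> R.
  rewrite -(@ler_pXn2r _ 2)// ?nnegrE ?exprn_ge0 ?mulr_ge0 ?sqrtr_ge0//.
  rewrite exprMn sqr_sqrtr ?(ltW np)// -exprM mulnC exprM -!natrX -natrM ler_nat.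
  exact: mn.
have L0 J : 0 < L J by rewrite /L !mulr_gt0// exp_half_gt0.
split => //.
  move=> J Jm; split => //.
  rewrite /L exprVn ler_pdivlMr ?exprn_gt0// mul1r; apply: le_trans m4.
  by apply: ler_weXn2l => //; rewrite ler1n.
have -> : \sum_(J < m.+1) (L J)^-1 = (2 * Num.sqrt n%:R)^-1 * \sum_(J < m.+1) 2 ^+ J :> R.
  by rewrite mulr_sumr; apply: eq_bigr => J _; rewrite /L invfM exprVn invrK.
have -> : \sum_(J < m.+1) 2 ^+ J = 2 ^+ m.+1 - 1 :> R.
  by rewrite subrX1 (_ : 2 - 1 = 1) ?mul1r//; lra.
rewrite ler_pdivrMl ?mulr_gt0//; apply: (@le_trans _ _ (2 ^+ m.+1)); first by lra.
by rewrite exprS mulrC ler_wpM2r.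
Qed.

Lemma expR1_le4 (R : realType) : expR 1 <= 4 :> R.
Proof.
have := @expR_le_quad R 2^-1 (lexx _).
have -> : 1 + 2^-1 + 2 * 2^-1 ^+ 2 = 2 :> R by field.
move=> H; have -> : expR 1 = expR 2^-1 * expR 2^-1 :> R.
  by rewrite -expRD; congr expR; field.
have := expR_ge0 (2^-1 : R); by nra.
Qed.

(** * The uniform bound for the clipped tensor on the grid *)

Section core.
Context (R : realType) (r : nat) (ns : 'I_r -> nat)
  (d : measure_display) (Omega : measurableType d) (P : probability Omega R)
  (d' : measure_display) (Omega' : measurableType d') (P' : probability Omega' R)
  (Z : {RV P' >-> R}) (T : tensor_index ns -> {RV P >-> R}).
Variables (n B : nat) (h M m V rho : R) (F : Omega -> R).
Hypothesis ind : mutually_independent T.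
Hypothesis idd : forall i, identically_distributed (T i) Z.
Hypothesis r2 : (2 <= r)%N.
Hypothesis n2 : (2 <= n)%N.
Hypothesis nsn : forall k, (0 < ns k <= n)%N.
Hypothesis V0 : 0 <= V.
Hypothesis M0 : 0 < M.
Hypothesis m0 : 0 <= m.
Hypothesis Nm : #|{: tensor_index ns}|%:R * m <= M.
Hypothesis int_quad : forall a c : R, 0 <= c ->
  (\int[P']_w (1 + a * clip M (Z w) + c * clip M (Z w) ^+ 2)%:E
     <= (1 + `|a| * m + c * V)%:E)%E.
Hypothesis rho0 : 0 < rho.
Hypothesis Vrho : n%:R * V <= rho ^+ 2.
Hypothesis meanF : mean_le P F (rho ^+ 2).
Hypothesis fiberF : forall w k i,
  \sum_(j | same_fiber k i j) clip M (T j w) ^+ 2 <= F w.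
Hypothesis hE : h = (2 * r%:R * Num.sqrt n%:R)^-1.

Local Notation C := {k : 'I_r & 'I_(ns k)}.
Local Notation config := {ffun C -> option (bool * 'I_B)}.
Local Notation X z := (@gridvec R r ns h B z).
Local Notation D := (r%:R * n%:R : R).
Local Notation Q := (4 * r%:R ^+ 2 * D).
Local Notation H := (entropy D Q).
Local Notation tau := (rho / n%:R).
Local Notation top := (up_log 4 n).
Let L (J : nat) : R := 2 * Num.sqrt n%:R * 2^-1 ^+ J.

Let r0 : (0 < r)%N. Proof. exact: ltn_trans r2. Qed.
Let n0 : (0 < n)%N. Proof. exact: ltn_trans n2. Qed.
Let rp : 0 < r%:R :> R. Proof. by rewrite ltr0n. Qed.
Let np : 0 < n%:R :> R. Proof. by rewrite ltr0n. Qed.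
Let D0 : 0 < D. Proof. by rewrite mulr_gt0. Qed.
Let h0 : 0 < h. Proof. by rewrite hE invr_gt0 !mulr_gt0// sqrtr_gt0. Qed.
Let tau0 : 0 < tau. Proof. by rewrite divr_gt0. Qed.
Let Vtau : V / tau <= rho.
Proof. by rewrite invf_div mulrA ler_pdivrMr// -expr2 mulrC. Qed.

Let hQ : r%:R <= h ^+ 2 * Q.
Proof.
rewrite hE exprVn exprMn sqr_sqrtr ?(ltW np)//.
by rewrite le_eqVlt; apply/orP; left; apply/eqP; field; rewrite !gt_eqF.
Qed.

Definition unit_config (z : config) := forall k, \sum_j X z k j ^+ 2 <= 1.

Let prior_gt0 e (z : config) : unit_config z -> (0 < nz (grid_restrict h e z))%N ->
  0 < prior D Q (grid_restrict h e z) /\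
  - ln (prior D Q (grid_restrict h e z)) = H (nz (grid_restrict h e z)).
Proof.
move=> z1 zn; rewrite prior_restrict//; split; first exact: expR_gt0.
by rewrite expRK opprK.
Qed.

Let prior_le1 (z : config) : prior D Q z <= 1.
Proof.
have Q0 : 0 < Q by rewrite !mulr_gt0 ?exprn_gt0.
apply: le_trans (sum_prior B D0 Q0 (card_coord_le R nsn)).
by rewrite (bigD1 z)//= lerDl sumr_ge0// => y _; rewrite /prior; case: ifP.
Qed.

Let wt_neq0_nz (z : config) i : wt (X z) i != 0 -> (0 < nz z)%N.
Proof.
move=> w0; rewrite lt0n; apply: contra w0 => /eqP/card0_eq z0.
rewrite /wt (bigD1 (Ordinal r0))//=.
have := z0 (Tagged (fun k => 'I_(ns k)) (i (Ordinal r0))).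
by rewrite !inE => /negbFE/eqP e; rewrite /gridvec e /= mul0r.
Qed.

Let sum_wt (z : config) : unit_config z -> \sum_i wt (X z) i ^+ 2 <= 1.
Proof.
move=> z1; rewrite wt_sqr_sum; apply: prodr_ile1 => k _; rewrite z1 andbT.
by apply: sumr_ge0 => j _; exact: sqr_ge0.
Qed.

Let gridvec_le1 (z : config) : unit_config z -> forall k j, `|X z k j| <= 1.
Proof.
move=> z1 k j; rewrite -(expr_le1 (n := 2))// real_normK ?num_real//.
apply: le_trans (z1 k); rewrite (bigD1 j)//= lerDl sumr_ge0// => ? _; exact: sqr_ge0.
Qed.

(** The total drift caused by clipping. It is Cauchy-Schwarz in additive form:
    [|w| * m <= (w ^ 2 * M + m ^ 2 / M) / 2], where the squares [w ^ 2] sum to at most 1 and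
    [N * m <= M]. *)
Let sum_wt_mean (z : config) : unit_config z -> \sum_i `|wt (X z) i| * m <= M.
Proof.
move=> z1.
apply: (@le_trans _ _ (\sum_i (wt (X z) i ^+ 2 * M + m ^+ 2 / M) / 2)).
  apply: ler_sum => i _; rewrite -[wt _ _ ^+ 2]real_normK ?num_real//.
  set a := `|_|; rewrite ler_pdivlMr// -(ler_pM2r M0) mulrDl divfK ?gt_eqF//.
  have := sqr_ge0 (a * M - m); by rewrite !expr2; lra.
rewrite -mulr_suml ler_pdivrMr// big_split/= -mulr_suml.
have S1 : (\sum_i wt (X z) i ^+ 2) * M <= M.
  by rewrite -[leRHS]mul1r ler_wpM2r ?(ltW M0)// sum_wt.
rewrite sumr_const -[E in _ + E]mulr_natl; move: S1; set S := _ * M => S1.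
have [N0|Npos] := posnP #|{: tensor_index ns}|.
  by move: M0 S1; rewrite N0 mul0r; clearbody S; lra.
have N1 : 1 <= #|{: tensor_index ns}|%:R :> R by rewrite ler1n.
move: Nm; set N := _%:R in N1 * => Nm'.
have mM : m <= M by apply: le_trans Nm'; rewrite ler_peMl.
have : N * (m ^+ 2 / M) <= M.
  rewrite mulrA ler_pdivrMr// expr2 mulrA.
  by apply: le_trans (ler_wpM2r m0 Nm') _; rewrite ler_wpM2l// ltW.
by lra.
Qed.

Lemma core_bound : exists U : Omega -> R,
  mean_le P U (M + 120 * r%:R ^+ 2 * rho) /\
  forall w (z : config), unit_config z ->
    `|\sum_i clip M (T i w) * wt (X z) i| <= U w.
Proof.
have [ntop HL sL] := levels_bounds R n2; rewrite -/(L _) in HL sL.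
have rr : 2 <= r%:R :> R by rewrite ler_nat.
have L1 (J : 'I_top.+1) : 1 <= L J by have [] := HL J (leq_ord J).
have LE (J : 'I_top.+1) : L J ^+ 2 = 4 * n%:R * 4^-1 ^+ J by have [] := HL J (leq_ord J).
have L0 (J : 'I_top.+1) : 0 < L J by exact: lt_le_trans ltr01 (L1 J).
have lam0 (J : 'I_top.+1) : 1 <= 1 + ln (L J) by rewrite lerDl ln_ge0.
have hi0 (J : nat) : 0 < 4 * rho * 4^-1 ^+ J by rewrite !mulr_gt0// exprn_gt0// invr_gt0.
(* The geometric mean of [tau] and the top of level [J]. By [ln L <= L - 1] it is at most the top
   divided by [1 + ln L], so the lower band, with [lam = 1], costs no more entropy than the upper
   one. *)
pose kap (J : nat) := tau * L J.
have kap0 (J : 'I_top.+1) : 0 < kap J by rewrite mulr_gt0.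
have kapE (J : 'I_top.+1) : 4 * rho * 4^-1 ^+ J = kap J * L J.
  by rewrite /kap -[RHS]mulrA -expr2 LE; field; rewrite gt_eqF.
have kaple (J : 'I_top.+1) : kap J <= 4 * rho * 4^-1 ^+ J / (1 + ln (L J)).
  rewrite ler_pdivlMr ?(lt_le_trans ltr01 (lam0 J))// kapE ler_wpM2l ?(ltW (kap0 J))//.
  by have := ln_le_subr1 (L0 J); lra.
have [XL XL1 HXL] := @uniform_light R r ns d Omega P d' Omega' P' Z T n B h M m V
  ind idd r2 nsn int_quad tau tau0.
have /choice[Xa HXa] : forall J : 'I_top.+1, exists Xi : Omega -> R,
  mean_le P Xi 1 /\
    (forall w (z : config), 0 < prior D Q z ->
    \sum_i (at_level J (X z) i)%:R * band tau (kap J) (clip M (T i w) * wt (X z) i) <=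
      expR 1 * V / tau * (\sum_i (at_level J (X z) i)%:R * wt (X z) i ^+ 2) +
      kap J / 1 * (- ln (prior D Q z) + Xi w)).
  move=> J; have [Xi X1 HX] := @uniform_band R r ns d Omega P d' Omega' P' Z T n B h M m V
    ind idd r2 nsn int_quad
    tau (kap J) 1 J tau0 (kap0 J) ltr01.
  by exists Xi.
(* The value [lam = 1 + ln L] makes [expR lam / kap J] equal to [expR 1 / tau]: the mean term is the
   same as for the lower band, while the entropy is divided by [1 + ln L]. *)
have /choice[Xb HXb] : forall J : 'I_top.+1, exists Xi : Omega -> R,
  mean_le P Xi 1 /\
    (forall w (z : config), 0 < prior D Q z ->
    \sum_i (at_level J (X z) i)%:R *
        band (kap J) (4 * rho * 4^-1 ^+ J) (clip M (T i w) * wt (X z) i) <=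
      expR (1 + ln (L J)) * V / kap J * (\sum_i (at_level J (X z) i)%:R * wt (X z) i ^+ 2) +
      (4 * rho * 4^-1 ^+ J) / (1 + ln (L J)) * (- ln (prior D Q z) + Xi w)).
  move=> J; have [Xi X1 HX] := @uniform_band R r ns d Omega P d' Omega' P' Z T n B h M m V
    ind idd r2 nsn int_quad
    (kap J) (4 * rho * 4^-1 ^+ J) (1 + ln (L J)) J (kap0 J) (hi0 J)
    (lt_le_trans ltr01 (lam0 J)).
  by exists Xi.
have eV : expR 1 * V / tau <= 4 * rho.
  rewrite -[leLHS]mulrA; apply: ler_pM => //; last exact: expR1_le4.
  by rewrite divr_ge0// ltW.
have eV' (J : 'I_top.+1) : expR (1 + ln (L J)) * V / kap J <= 4 * rho.
  apply: le_trans eV; rewrite expRD lnK ?posrE// /kap.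
  by rewrite le_eqVlt; apply/orP; left; apply/eqP; field; rewrite !gt_eqF.
have hilam (J : 'I_top.+1) :
    4 * rho * 4^-1 ^+ J / (1 + ln (L J)) <= 4 * rho * 4^-1 ^+ J.
  rewrite ler_pdivrMr ?(lt_le_trans ltr01 (lam0 J))// ler_peMr//.
  exact: ltW (hi0 J).
have W0 (J : 'I_top.+1) (z : config) : 0 <= \sum_i (at_level J (X z) i)%:R * wt (X z) i ^+ 2.
  by apply: sumr_ge0 => i _; rewrite mulr_ge0// sqr_ge0.
have levels w z (J : 'I_top.+1) : unit_config z ->
    \sum_i (at_level J (X z) i)%:R *
      (band tau (kap J) (clip M (T i w) * wt (X z) i) +
       band (kap J) (4 * rho * 4^-1 ^+ J) (clip M (T i w) * wt (X z) i)) <=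
    8 * rho * (\sum_i (at_level J (X z) i)%:R * wt (X z) i ^+ 2) +
    2 * rho * (4 * 4^-1 ^+ J / (1 + ln (L J)) * H (nz (grid_restrict h (2^-1 ^+ J) z))) +
    4 * rho * 4^-1 ^+ J * (Xa J w + Xb J w).
  move=> uz; set z' := grid_restrict h (2^-1 ^+ J) z.
  have [[_ Xa0 _] HA] := HXa J; have [[_ Xb0 _] HB] := HXb J.
  (* A zero restriction has prior 0 and gets no bound from the union bound; in that case no index
     lies on level [J]. *)
  have [z'0|z'p] := posnP (nz z').
    rewrite big1; last first.
      move=> i _; have [lJ|] := boolP (at_level J (X z) i); last by rewrite mul0r.
      suff : (0 < nz z')%N by rewrite z'0.
      apply: (@wt_neq0_nz _ i); rewrite wt_restrict//; apply/prodf_neq0 => k _.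
      have /andP[/forallP/(_ k) lk _] := lJ.
      by rewrite -normr_gt0; apply: lt_le_trans lk; exact: exp_half_gt0.
    rewrite z'0 /entropy mul0r !mulr0 addr0 addr_ge0//.
      by rewrite mulr_ge0 ?W0// mulr_ge0// ltW.
    by rewrite mulr_ge0 ?addr_ge0// ltW.
  have [pz lnp] := prior_gt0 uz z'p.
  under eq_bigr do rewrite mulrDr.
  rewrite big_split/=.
  have sumz (g : tensor_index ns -> R -> R) :
      \sum_i (at_level J (X z') i)%:R * g i (wt (X z') i) =
      \sum_i (at_level J (X z) i)%:R * g i (wt (X z) i).
    apply: eq_bigr => i _; rewrite at_level_restrict; have [lJ|] := boolP (at_level J (X z) i).
      by rewrite wt_restrict.
    by rewrite !mul0r.
  have := HA w z' pz; have := HB w z' pz; rewrite lnp.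
  rewrite (sumz (fun i t => band tau (kap J) (clip M (T i w) * t))).
  rewrite (sumz (fun i t => band (kap J) (4 * rho * 4^-1 ^+ J) (clip M (T i w) * t))).
  rewrite (sumz (fun i t => t ^+ 2)) divr1.
  set W := \sum_i _ * _ ^+ 2; set A := \sum_i _ * band tau _ _.
  set B' := \sum_i _ * band (kap J) _ _.
  have W0' : 0 <= W by exact: W0.
  have := ler_wpM2r W0' eV; have := ler_wpM2r W0' (eV' J).
  have H0 : 0 <= H (nz z').
    rewrite -lnp oppr_ge0 ln_le0//; exact: prior_le1.
  have := ler_wpM2r H0 (kaple J).
  have := ler_wpM2r (Xa0 w) (le_trans (kaple J) (hilam J)).
  have := ler_wpM2r (Xb0 w) (hilam J).
  have -> : 2 * rho * (4 * 4^-1 ^+ J / (1 + ln (L J)) * H (nz z')) =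
    2 * (4 * rho * 4^-1 ^+ J / (1 + ln (L J)) * H (nz z')).
    by set iL := _^-1; ring.
  set q := 4 * rho * 4^-1 ^+ J; set q' := q / _; set hh := H _.
  set e1 := _ / tau; set e2 := _ / kap J; set xa := Xa J w; set xb := Xb J w.
  set kk := kap J; clearbody q q' hh e1 e2 xa xb kk W A B'; lra.
(* The 100 collects 12 from the light part, 80 from the entropy of the levels and 8 from the mean
   terms of the two bands. *)
pose U w := M + 100 * r%:R ^+ 2 * rho + 2 * rho * XL w + r%:R / rho * F w +
  \sum_(J < top.+1) 4 * rho * 4^-1 ^+ J * (Xa J w + Xb J w).
have q0 (J : nat) : 0 <= 4 * rho * 4^-1 ^+ J by rewrite ltW.
have mU : mean_le P U (M + 100 * r%:R ^+ 2 * rho + 2 * rho * 1 +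
    r%:R / rho * rho ^+ 2 + \sum_(J < top.+1) 4 * rho * 4^-1 ^+ J * (1 + 1)).
  apply: mean_leD; [apply: mean_leD; [apply: mean_leD|]|].
  - apply: mean_le_cst; rewrite addr_ge0 ?(ltW M0)//.
    by rewrite mulr_ge0 ?(ltW rho0)// mulr_ge0// sqr_ge0.
  - by apply: mean_leZ => //; rewrite mulr_ge0// ltW.
  - by apply: mean_leZ => //; rewrite divr_ge0// ltW.
  - apply: mean_le_sum => J; apply: mean_leZ => //.
    by apply: mean_leD; [have [] := HXa J|have [] := HXb J].
exists U; split.
  apply: mean_le_trans mU.
  have S4 : \sum_(J < top.+1) 4 * rho * 4^-1 ^+ J * (1 + 1) <= 8 * rho * (4 / 3).
    have := subrX1 (4^-1 : R) top.+1; set S := \sum_(i < _) _ => E.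
    have -> : \sum_(J < top.+1) 4 * rho * 4^-1 ^+ J * (1 + 1) = 8 * rho * S.
      by rewrite mulr_sumr; apply: eq_bigr => J _; ring.
    rewrite ler_wpM2l ?mulr_ge0 ?(ltW rho0)//.
    have : 0 <= 4^-1 ^+ top.+1 :> R by rewrite exprn_ge0// invr_ge0.
    by move: E; set t := _ ^+ _; clearbody S t; lra.
  have -> : r%:R / rho * rho ^+ 2 = r%:R * rho by field; rewrite gt_eqF.
  have rrho : rho * (13 + r%:R) <= rho * (20 * r%:R ^+ 2).
    by rewrite ler_pM2l// expr2; have := ler_wpM2l (ler0n R r) rr; lra.
  by move: S4 rrho rho0; set S := \sum_(_ < _) _; clearbody S; lra.
move=> w z uz.
pose y i := clip M (T i w) * wt (X z) i.
have Uw4 : 0 <= \sum_(J < top.+1) 4 * rho * 4^-1 ^+ J * (Xa J w + Xb J w).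
  apply: sumr_ge0 => J _; rewrite mulr_ge0// addr_ge0//.
    by have [[]] := HXa J.
  by have [[]] := HXb J.
have XL0 : 0 <= XL w by have [] := XL1.
have light : `|\sum_i light_part tau (y i)| <= M + 12 * r%:R ^+ 2 * rho + 2 * rho * XL w.
  have [z0|zp] := posnP (nz z).
    rewrite big1 ?normr0; last first.
      move=> i _; suff -> : y i = 0 by rewrite /light_part; case: ifP.
      apply/eqP; rewrite mulf_eq0; apply/orP; right; apply: contraT => /wt_neq0_nz.
      by rewrite z0.
    rewrite !addr_ge0 ?(ltW M0)// !mulr_ge0 ?sqr_ge0// ltW//.
  have [pz lnp] : 0 < prior D Q z /\ - ln (prior D Q z) = H (nz z).
    by have := @prior_gt0 0 z uz; rewrite grid_restrict0; apply.
  apply: le_trans (HXL w z pz) _.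
  rewrite lnM ?posrE ?invr_gt0// lnV ?posrE//.
  rewrite big_split/= -!mulr_suml.
  have amM : (\sum_i `|wt (X z) i|) * m <= M by rewrite mulr_suml; exact: sum_wt_mean.
  have W1 := sum_wt uz; move: amM W1.
  set a := \sum_i _; set W := \sum_i _ ^+ 2 => amM W1.
  have -> : 2 * tau * (a / (2 * tau) * m + W / tau ^+ 2 * V -
      (ln (prior D Q z) - ln 2) + XL w) =
      a * m + 2 * (W * (V / tau)) + 2 * tau * (- ln (prior D Q z) + ln 2 + XL w).
    by field; rewrite !gt_eqF.
  rewrite lnp.
  have WV : W * (V / tau) <= rho.
    by apply: le_trans Vtau; rewrite ler_piMl// divr_ge0// ltW.
  (* Whatever the support, the entropy is at most a multiple of the dimension [r * n], and the
     factor [tau = rho / n] cancels [n]. This is what fixes the threshold for light entries. *)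
  have HD : H (nz z) <= D * (7 + r%:R).
    apply: entropy_le_dim => //; apply: le_trans (card_coord_le R nsn).
    by rewrite ler_nat max_card.
  have tH : tau * H (nz z) <= rho * r%:R * (7 + r%:R).
    apply: le_trans (ler_wpM2l (ltW tau0) HD) _.
    by rewrite le_eqVlt; apply/orP; left; apply/eqP; field; rewrite gt_eqF.
  have tr : tau <= rho by rewrite ler_pdivrMr// ler_peMr ?(ltW rho0)// ler1n.
  have tX : tau * XL w <= rho * XL w by rewrite ler_wpM2r.
  have tl : tau * ln 2 <= rho.
    have l2 := @ln_le_subr1 R 2 (ltr0n _ 2).
    by apply: le_trans tr; rewrite ler_piMr ?(ltW tau0)//; lra.
  have rrho : rho * (4 + 14 * r%:R) <= rho * (10 * r%:R ^+ 2).
    by rewrite ler_pM2l// expr2; have := ler_wpM2l (ler0n R r) rr; lra.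
  move: amM WV tH tX tl rrho rho0.
  set t1 := a * m; set t2 := W * _; set hh := H _; set x := XL w.
  set l := ln 2; set t := tau; set q := r%:R.
  clearbody t1 t2 hh x l t q; rewrite ?expr2; lra.
have heavy : `|\sum_i (y i - light_part tau (y i))| <= r%:R / rho * F w +
    (8 * rho + 80 * r%:R ^+ 2 * rho +
     \sum_(J < top.+1) 4 * rho * 4^-1 ^+ J * (Xa J w + Xb J w)).
  apply: le_trans (ler_norm_sum _ _ _) _.
  apply: le_trans (ler_sum _ _) _.
    move=> i _; exact: (@heavy_decomposition R r ns rho n top (clip M (T i w)) (X z) kap i
      r0 n0 rho0 ntop (gridvec_le1 uz)).
  rewrite big_split/=; apply: lerD.
    have -> : r%:R / rho * F w = \sum_(k < r) F w / rho.
      by rewrite sumr_const card_ord -[RHS]mulr_natl mulrAC mulrA.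
    rewrite exchange_big/=; apply: ler_sum => k _.
    rewrite -mulr_suml ler_wpM2r ?invr_ge0 ?(ltW rho0)//.
    apply: fiber_sum_le => //; first by have /andP[] := nsn k.
    by have [] := meanF.
  rewrite exchange_big/=.
  apply: le_trans (ler_sum _ (fun J _ => levels w z J uz)) _.
  rewrite !big_split/= lerD2r -!mulr_sumr lerD//.
    rewrite -[leRHS]mulr1 ler_wpM2l ?mulr_ge0 ?(ltW rho0)//.
    exact: sum_wt_at_level.
  have := @sum_level_entropy_le R r ns h B n top L z h0 n0 r2 HL sL uz.
  by move=> /(ler_wpM2l (mulr_ge0 (ler0n _ 2) (ltW rho0))) /le_trans; apply; lra.
have -> : \sum_i clip M (T i w) * wt (X z) i =
    \sum_i light_part tau (y i) + \sum_i (y i - light_part tau (y i)).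
  by rewrite -big_split/=; apply: eq_bigr => i _; rewrite addrC subrK.
apply: le_trans (ler_normD _ _) _; apply: le_trans (lerD light heavy) _.
rewrite /U.
have : 8 * rho <= 8 * r%:R ^+ 2 * rho.
  by rewrite ler_wpM2r ?(ltW rho0)// ler_peMr// expr_ge1//; lra.
by lra.
Qed.
End core.

(** * The largest entry *)

Section excess.
Context (R : realType).
Implicit Types M t : R.

Definition excess M t : R := if M < `|t| then `|t| else 0.

Lemma excess_ge0 M t : 0 <= excess M t.
Proof. by rewrite /excess; case: ifP. Qed.

Lemma measurable_excess M : measurable_fun setT (excess M).
Proof.
apply: measurable_fun_ifT => //.
by apply: measurable_fun_ltr => //; exact: normr_measurable.
Qed.

Lemma clip_sub_le M t : 0 <= M -> `|t - clip M t| <= excess M t.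
Proof.
move=> M0; rewrite /clip /excess [M < `|t|]ltNge; have [tM|tM] := lerP `|t| M.
  by rewrite subrr normr0.
rewrite /=; have [Mt|tM'] := ltP M t.
  by rewrite !ger0_norm; lra.
have t0 : t < 0 by case: (ltrP t 0) => // t0; move: tM; rewrite ger0_norm// => ?; lra.
by move: tM; rewrite ltr0_norm// => tM; rewrite ler0_norm; lra.
Qed.

Lemma clip_le M t : 0 <= M -> `|clip M t| <= M.
Proof.
move=> M0; rewrite /clip; have [//|tM] := lerP `|t| M.
by case: ifP; rewrite ?normrN ger0_norm.
Qed.

Lemma clip_le_norm M t : 0 <= M -> `|clip M t| <= `|t|.
Proof.
move=> M0; have [tM|/ltW tM] := lerP `|t| M; first by rewrite /clip tM.
exact: le_trans (clip_le _ M0) tM.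
Qed.
End excess.

Section max_entry.
Context (R : realType) (I : finType)
  (d : measure_display) (Omega : measurableType d) (P : probability Omega R)
  (d' : measure_display) (Omega' : measurableType d') (P' : probability Omega' R)
  (Z : {RV P' >-> R}) (T : I -> {RV P >-> R}).
Hypothesis ind : mutually_independent T.
Hypothesis idd : forall i, identically_distributed (T i) Z.
Hypothesis Z2 : ('E_P'[fun w => (Z w ^+ 2)%R] < +oo)%E.

Let mx w : R := \big[Num.max/0]_i `|T i w|.
Local Notation EM := (fine (\int[P]_w (mx w)%:E)%E).

Lemma integrable_of_sqr : P'.-integrable setT (EFin \o Z).
Proof.
apply/integrableP; split; first exact/measurable_EFinP.
apply: (@le_lt_trans _ _ (\int[P']_w ((1%:E + (Z w ^+ 2)%:E)))%E).
  apply: ge0_le_integralT => w; first exact: abse_ge0.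
  rewrite /= -EFinD lee_fin; have := sqr_ge0 (`|Z w| - 1).
  by rewrite -[Z w ^+ 2]real_normK ?num_real// !expr2; have := normr_ge0 (Z w); nra.
rewrite ge0_integralD//.
- rewrite integral_cst//= probability_setT mule1 lte_add_pinfty ?ltry//.
  by move: Z2; rewrite unlock.
- by move=> w _; rewrite lee_fin sqr_ge0.
- by apply/measurable_EFinP; exact: measurable_funX.
Qed.

Let m_ M : R := fine (\int[P']_w (excess M (Z w))%:E)%E.

Lemma int_excess M : (\int[P']_w (excess M (Z w))%:E = (m_ M)%:E)%E.
Proof.
rewrite /m_ fineK// ge0_fin_numE; last first.
  by apply: integral_ge0 => w _; rewrite lee_fin excess_ge0.
have /integrableP[_] := integrable_of_sqr; apply: le_lt_trans.
apply: ge0_le_integralT => w; rewrite ?lee_fin ?excess_ge0//=.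
by rewrite /excess; case: ifP.
Qed.

Lemma mx_ge0 w : 0 <= mx w.
Proof. by apply: (big_ind (fun x => 0 <= x)) => // x y x0 y0; rewrite le_max x0. Qed.

Lemma le_mx i w : `|T i w| <= mx w.
Proof. by rewrite /mx; exact: le_bigmax. Qed.

Lemma measurable_mx : measurable_fun setT mx.
Proof.
rewrite /mx; elim: (index_enum I) => [|i s IH].
  under eq_fun do rewrite big_nil.
  exact: measurable_cst.
under eq_fun do rewrite big_cons.
apply: measurable_maxr => //; apply: measurableT_comp => //; exact: normr_measurable.
Qed.

Lemma int_norm i : (\int[P]_w (`|T i w|)%:E < +oo)%E.
Proof.
have /integrableP[_] := integrable_of_sqr.
rewrite (@integral_identically_distributed _ _ _ _ _ _ _ (T i) Z Num.norm)//.
Qed.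

Lemma int_mx : (\int[P]_w (mx w)%:E = EM%:E)%E.
Proof.
rewrite fineK// ge0_fin_numE; last first.
  by apply: integral_ge0 => w _; rewrite lee_fin mx_ge0.
apply: (@le_lt_trans _ _ (\int[P]_w \sum_i (`|T i w|)%:E)%E).
  apply: ge0_le_integralT => w; first by rewrite lee_fin mx_ge0.
  rewrite sumEFin lee_fin; apply/bigmax_leP; split => [|i _].
    by apply: sumr_ge0.
  by rewrite (bigD1 i)//= lerDl sumr_ge0.
rewrite ge0_integral_sum//; first by apply: lte_sum_pinfty => i _; exact: int_norm.
by move=> i; apply/measurable_EFinP; apply: measurableT_comp => //; exact: normr_measurable.
Qed.

(* At most one of the events "entry i alone exceeds M" occurs, and all entries are
   below M with probability at least 1/2 by Markov's inequality. *)
Lemma card_mul_excess_le (M := 2 * EM) : 0 < M -> #|I|%:R * m_ M <= M.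
Proof.
move=> M0.
pose psi (t : R) : R := (`|t| <= M)%R%:R.
have psi0 t : 0 <= psi t by [].
have psi1 t : psi t <= 1 by rewrite /psi lern1 leq_b1.
have mpsi : measurable_fun setT psi.
  have -> : psi = fun t => if `|t| <= M then 1 else 0.
    by apply/funext => t; rewrite /psi; case: (`|t| <= M).
  apply: measurable_fun_ifT => //.
  by apply: measurable_fun_ler => //; exact: normr_measurable.
pose b : R := fine (\int[P']_w (psi (Z w))%:E)%E.
have le1 : (\int[P']_w (psi (Z w))%:E <= 1)%E.
  apply: (@le_trans _ _ (\int[P']_w (cst 1%:E w))%E).
    by apply: ge0_le_integralT => w; rewrite lee_fin.
  by rewrite integral_cst//= probability_setT mule1.
have bE : (\int[P']_w (psi (Z w))%:E = b%:E)%E.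
  rewrite /b fineK// ge0_fin_numE; first exact: le_lt_trans le1 (ltry _).
  by apply: integral_ge0 => w _; rewrite lee_fin.
have b0 : 0 <= b by apply: fine_ge0; apply: integral_ge0 => w _; rewrite lee_fin.
have b1 : b <= 1 by rewrite -lee_fin -bE.
have m0 : 0 <= m_ M.
  by apply: fine_ge0; apply: integral_ge0 => w _; rewrite lee_fin excess_ge0.
have Tpsi i : (\int[P]_w (psi (T i w))%:E = b%:E)%E.
  by rewrite (integral_identically_distributed (idd i)).
have Texc i : (\int[P]_w (excess M (T i w))%:E = (m_ M)%:E)%E.
  rewrite (integral_identically_distributed (idd i)) ?int_excess//.
    exact: measurable_excess.
  by move=> x; exact: excess_ge0.
have HA : (\int[P]_w (\prod_i psi (T i w))%:E = (b ^+ #|I|)%:E)%E.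
  by rewrite (@integral_prod_independent _ _ _ _ _ T (fun=> psi) (fun=> b))// prodr_const.
(* Pointwise, the product of the indicators plus [mx / M] is at least 1, and [EM / M = 1 / 2]. *)
have half : 2^-1 <= b ^+ #|I|.
  suff : (1 <= (b ^+ #|I| + M^-1 * EM)%:E)%E.
    have -> : M^-1 * EM = 2^-1.
      by move: M0; rewrite /M pmulr_rgt0// => E0; field; rewrite gt_eqF.
    by rewrite lee_fin; lra.
  rewrite EFinD EFinM -HA -int_mx -ge0_integralZl_EFin//; last 3 first.
  - by move=> w _; rewrite lee_fin mx_ge0.
  - by apply/measurable_EFinP; exact: measurable_mx.
  - by rewrite invr_ge0 ltW.
  rewrite -ge0_integralD//; last 4 first.
  - by move=> w _; rewrite lee_fin prodr_ge0.
  - apply/measurable_EFinP; apply: measurable_prod => i _.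
    by apply: measurableT_comp.
  - by move=> w _; rewrite -EFinM lee_fin mulr_ge0 ?mx_ge0// invr_ge0 ltW.
  - apply: measurable_funeM; apply/measurable_EFinP; exact: measurable_mx.
  apply: (@le_trans _ _ (\int[P]_w (cst 1%:E w))%E).
    by rewrite integral_cst//= probability_setT mule1.
  apply: ge0_le_integralT => w /=; first by rewrite lee_fin.
  rewrite -?EFinM -?EFinD lee_fin.
  have [/forallP H|/forallPn[i]] := boolP [forall i, `|T i w| <= M].
    rewrite big1 ?lerDl ?mulr_ge0 ?mx_ge0 ?invr_ge0 ?(ltW M0)// => i _.
    by rewrite /psi H.
  rewrite -ltNge => Mi; apply: ler_wpDl; first exact: prodr_ge0.
  by rewrite mulrC ler_pdivlMr// mul1r (le_trans (ltW Mi))// le_mx.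
(* The product of the [phi i j] is the excess of entry [i] when all other entries stay below [M].
   Its mean is at least [m_ M / 2] by [half]. These products have disjoint supports, so their sum
   over [i] is at most [mx]. *)
pose c (i j : I) : R := if j == i then m_ M else b.
pose phi (i j : I) : R -> R := if j == i then excess M else psi.
have HB i : (\int[P]_w (\prod_j phi i j (T j w))%:E = (\prod_j c i j)%:E)%E.
  apply: integral_prod_independent => //.
  - by move=> j; rewrite /phi; case: ifP => // _; exact: measurable_excess.
  - by move=> j x; rewrite /phi; case: ifP => // _; exact: excess_ge0.
  - by move=> j; rewrite /phi /c; case: ifP.
have cle i : m_ M / 2 <= \prod_j c i j.
  rewrite (bigD1 i)//= {1}/c eqxx ler_wpM2l//; apply: le_trans half _.
  rewrite -prodr_const (bigD1 i)//=.
  rewrite [leRHS](eq_bigr (fun=> b)); last by move=> j /negbTE ji; rewrite /c ji.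
  by rewrite ler_piMl// prodr_ge0.
have sumle : \sum_i \prod_j c i j <= EM.
  rewrite -lee_fin -int_mx -sumEFin.
  under eq_bigr do rewrite -HB.
  rewrite -ge0_integral_sum//; last 2 first.
  - move=> i; apply/measurable_EFinP; apply: measurable_prod => j _.
    rewrite /phi; case: (j == i); apply: measurableT_comp => //.
    exact: measurable_excess.
  - move=> i w _; rewrite lee_fin; apply: prodr_ge0 => j _; rewrite /phi.
    by case: ifP => // _; exact: excess_ge0.
  have phi0 i j t : 0 <= phi i j t.
    by rewrite /phi; case: ifP => // _; exact: excess_ge0.
  apply: ge0_le_integralT => w; rewrite sumEFin lee_fin.
    by apply: sumr_ge0 => i _; exact: prodr_ge0.
  have [/forallP H|/forallPn[i]] := boolP [forall i, `|T i w| <= M].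
    rewrite big1 ?mx_ge0// => i _; rewrite (bigD1 i)//= /phi eqxx /excess.
    by rewrite ltNge H/= mul0r.
  rewrite -ltNge => Mi; rewrite (bigD1 i)//= [X in _ + X]big1 ?addr0; last first.
    move=> j ji; rewrite (bigD1 i)//= /phi eq_sym (negbTE ji) /psi.
    by rewrite leNgt Mi mul0r.
  rewrite (bigD1 i)//= {1}/phi eqxx /excess Mi.
  apply: le_trans (le_mx i w); rewrite ler_piMr//.
  apply: prodr_ile1 => j /negbTE ji; rewrite /phi ji psi0 psi1//.
have := le_trans (ler_sum _ (fun i _ => cle i)) sumle.
rewrite sumr_const -mulr_natl => K.
by rewrite {2}/M; lra.
Qed.

Hypothesis Z0 : ('E_P'[Z] = 0)%E.

(** Since [Z] has mean zero, the mean of the clipped variable equals that of [clip M Z - Z], which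
    is dominated by the excess. *)
Lemma int_clip_quad (M a c : R) : 0 <= M -> 0 <= c ->
  (\int[P']_w (1 + a * clip M (Z w) + c * clip M (Z w) ^+ 2)%:E <=
    (1 + `|a| * m_ M + c * fine (\int[P']_w (clip M (Z w) ^+ 2)%:E)%E)%:E)%E.
Proof.
move=> M0 c0.
have iZ := integrable_of_sqr.
have mY : measurable_fun setT (fun w => clip M (Z w)).
  by apply: measurableT_comp => //; exact: measurable_clip.
have iY : P'.-integrable setT (EFin \o (fun w => clip M (Z w))).
  apply: le_integrable iZ => //; first exact/measurable_EFinP.
  by move=> w _; rewrite /= lee_fin clip_le_norm.
have i1 (k : R) : P'.-integrable setT (fun=> k%:E).
  by apply: finite_measure_integrable_cst.
have iY2 : P'.-integrable setT (EFin \o (fun w => clip M (Z w) ^+ 2)).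
  apply: le_integrable (i1 (M ^+ 2)) => //.
    by apply/measurable_EFinP; exact: measurable_funX.
  move=> w _; rewrite /= lee_fin !normrX lerXn2r ?nnegrE//.
  by rewrite [leRHS]ger0_norm// clip_le.
have absY : (`|\int[P']_w (clip M (Z w))%:E| <= (m_ M)%:E)%E.
  have -> : (\int[P']_w (clip M (Z w))%:E = \int[P']_w ((clip M (Z w))%:E - (Z w)%:E))%E.
    rewrite (integralB_EFin measurableT iY iZ).
    by move: Z0; rewrite unlock => ->; rewrite sube0.
  apply: le_trans (le_abse_integral _ _ _) _ => //.
    by apply/measurable_EFinP; exact: measurable_funB.
  rewrite -int_excess; apply: ge0_le_integralT => w; first exact: abse_ge0.
  by rewrite /= lee_fin distrC clip_sub_le.
have fY : (\int[P']_w (clip M (Z w))%:E \is a fin_num)%E.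
  by apply: integrable_fin_num.
have fY2 : (\int[P']_w (clip M (Z w) ^+ 2)%:E \is a fin_num)%E.
  by apply: integrable_fin_num.
have -> : (\int[P']_w (1 + a * clip M (Z w) + c * clip M (Z w) ^+ 2)%:E =
   1%:E + a%:E * \int[P']_w (clip M (Z w))%:E + c%:E * \int[P']_w (clip M (Z w) ^+ 2)%:E)%E.
  under eq_integral do rewrite !EFinD !EFinM.
  rewrite integralD//; last 2 first.
  - by apply: integrableD => //; exact: integrableZl.
  - exact: integrableZl.
  rewrite integralD//; last exact: integrableZl.
  by rewrite !integralZl// integral_cst//= probability_setT mule1.
move: absY; rewrite -(fineK fY) -(fineK fY2) /= lee_fin => absY.
rewrite -!EFinM -!EFinD lee_fin lerD2r lerD2l.
by apply: le_trans (ler_norm _) _; rewrite normrM ler_wpM2l.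
Qed.
End max_entry.

(** * Fiber norms *)

Section fibers.
Context (R : realType) (r : nat) (ns : 'I_r -> nat)
  (d : measure_display) (Omega : measurableType d) (P : probability Omega R)
  (d' : measure_display) (Omega' : measurableType d') (P' : probability Omega' R)
  (Z : {RV P' >-> R}) (T : tensor_index ns -> {RV P >-> R}) (n : nat).
Hypothesis ind : mutually_independent T.
Hypothesis idd : forall i, identically_distributed (T i) Z.
Hypothesis r2 : (2 <= r)%N.
Hypothesis n2 : (2 <= n)%N.
Hypothesis nsn : forall k, (0 < ns k <= n)%N.

Let N := #|{: tensor_index ns}|.

Lemma card_tensor : N = (\prod_k ns k)%N.
Proof.
apply/eqP; rewrite -(eqr_nat R) natr_prod /N -sum1_card natr_sum.
apply/eqP; transitivity (\prod_k \sum_(j < ns k) (1 : R)).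
  by rewrite -(sum_prod_tensor (fun k _ => 1)); apply: eq_bigr => i _; rewrite big1.
by apply: eq_bigr => k _; rewrite sumr_const card_ord.
Qed.

(** The logarithmic cost of all fibers, indexed by a mode and a base point: both [r] and the number
    of entries are at most [n ^ r]. *)
Lemma ln_card : ln (r%:R * N%:R : R) <= 2 * r%:R * ln n%:R.
Proof.
have n1 : 1 <= n%:R :> R by rewrite ler1n; exact: ltnW.
have np : 0 < n%:R :> R by exact: lt_le_trans ltr01 n1.
have NP : (0 < N)%N by rewrite card_tensor prodn_gt0// => k; have /andP[] := nsn k.
have r0 : (0 < r)%N by exact: ltn_trans r2.
apply: (@le_trans _ _ (ln (n%:R ^+ (r + r)))); last first.
  by rewrite lnXn// -[leLHS]mulr_natl natrD; lra.
rewrite ler_ln ?posrE ?exprn_gt0// ?mulr_gt0 ?ltr0n// exprD ler_pM//.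
  rewrite -natrX ler_nat; apply: leq_trans (ltnW (ltn_expl r n2)) _ => //.
rewrite card_tensor natr_prod -[in leRHS](card_ord r) -prodr_const.
apply: ler_prod => k _; rewrite ler0n ler_nat.
by have /andP[] := nsn k.
Qed.

(** Uses [expR (lam * g) <= 1 + lam * expR lam * g] for [g] with values in the unit interval, and
    equal weights on the fibers. [lam] stays free: ordinary entries take [lam = 1], rare large ones
    a multiple of [ln n]. *)
Lemma uniform_fiber (g : R -> R) (v lam : R) :
  measurable_fun setT g -> (forall t, 0 <= g t <= 1) -> 0 < lam -> 0 <= v ->
  (forall c, 0 <= c -> (\int[P']_w (1 + c * g (Z w))%:E <= (1 + c * v)%:E)%E) ->
  exists2 Xi : Omega -> R, mean_le P Xi 1 &
    forall w k i, \sum_(j | same_fiber k i j) g (T j w) <=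
      expR lam * (n%:R * v) + lam^-1 * (2 * r%:R * ln n%:R + Xi w).
Proof.
move=> mg g01 l0 v0 Hg.
have g0 t : 0 <= g t by have /andP[] := g01 t.
have g1 t : g t <= 1 by have /andP[] := g01 t.
have r0 : (0 < r)%N by exact: ltn_trans r2.
have NP : (0 < N)%N by rewrite card_tensor prodn_gt0// => k; have /andP[] := nsn k.
have rN : 0 < r%:R * N%:R :> R by rewrite mulr_gt0 ?ltr0n.
pose f (s : 'I_r * tensor_index ns) j t : R := (same_fiber s.1 s.2 j)%:R * (lam * g t).
pose b (s : 'I_r * tensor_index ns) j : R := (same_fiber s.1 s.2 j)%:R * (lam * expR lam * v).
pose p (s : 'I_r * tensor_index ns) : R := (r%:R * N%:R)^-1.
have [||||Xi Xi1 HXi] := @uniform_mgf R _ _ P _ _ P' _ _ T Z f b p ind idd.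
- by move=> s i; apply: measurable_funM => //; exact: measurable_funM.
- move=> s j; pose c : R := (same_fiber s.1 s.2 j)%:R * (lam * expR lam).
  have c0 : 0 <= c by rewrite mulr_ge0// mulr_ge0 ?expR_ge0// ltW.
  apply: le_trans (ge0_le_integralT P' (g := fun t => (1 + c * g (Z t))%:E) _ _) _.
  + by move=> t; rewrite lee_fin expR_ge0.
  + move=> t; rewrite lee_fin /f /c; case: same_fiber; last first.
      by rewrite !mul0r expR0 addr0.
    rewrite !mul1r; set u := lam * g (Z t).
    have ul : u <= lam by rewrite /u ler_piMr// ltW.
    have u0 : 0 <= u by rewrite mulr_ge0// ltW.
    have : expR u <= 1 + u * expR u.
      have := expR_ge1Dx (- u); rewrite expRN => H; have e0 := expR_gt0 u.
      have : (1 - u) * expR u <= 1 by rewrite -ler_pdivlMr// mul1r.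
      by lra.
    move=> /le_trans; apply; rewrite lerD2l [leRHS]mulrAC -/u ler_wpM2l//.
    by rewrite ler_expR.
  apply: le_trans (Hg c c0) _.
  by rewrite /b /c -[_%:R * (lam * expR lam) * v]mulrA.
- by move=> s; rewrite invr_ge0 ltW.
- by rewrite /p sumr_const card_prod card_ord -[leLHS]mulr_natr natrM mulVf// gt_eqF.
exists Xi => // w k i.
have := HXi w (k, i); rewrite invr_gt0 => /(_ rN).
rewrite /f /b /p/= lnV ?posrE// opprK -mulr_suml.
under eq_bigr do rewrite mulrCA.
rewrite -mulr_sumr -ler_pdivlMl// card_fiber.
have -> : \sum_j (same_fiber k i j)%:R * g (T j w) = \sum_(j | same_fiber k i j) g (T j w).
  by rewrite [RHS]big_mkcond/=; apply: eq_bigr => j _; case: same_fiber; rewrite ?mul1r ?mul0r.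
move=> /le_trans; apply.
rewrite -addrA mulrDr lerD//.
  rewrite (_ : lam^-1 * _ = expR lam * ((ns k)%:R * v)); last by field; rewrite gt_eqF.
  rewrite ler_wpM2l ?expR_ge0// ler_wpM2r// ler_nat.
  by have /andP[] := nsn k.
by rewrite ler_wpM2l ?invr_ge0 ?(ltW l0)// lerD2r ln_card.
Qed.

(** Up to [ln n = 8 * K / eps] a plain union bound suffices, its logarithm being absorbed in the
    [M ^ 2] term. Beyond it the squares are cut by size into two sums with different tilts, so that
    neither keeps a logarithm; in this regime the last hypothesis lets [V] control [sigma]. *)
Lemma fiber_bound (M V K eps sigma : R) :
  0 < M -> 0 <= V -> 1 <= K -> 0 < eps < 1 -> 0 <= sigma ->
  (forall c, 0 <= c ->
    (\int[P']_w (1 + c * clip M (Z w) ^+ 2)%:E <= (1 + c * V)%:E)%E) ->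
  (forall c, 0 <= c -> (\int[P']_w (1 + c * `|Z w| `^ (2 + eps))%:E
     <= (1 + c * (K * sigma `^ (2 + eps)))%:E)%E) ->
  (8 * K / eps < ln n%:R -> sigma ^+ 2 <= 2 * V) ->
  exists2 F : Omega -> R,
    mean_le P F (3 * r%:R ^+ 2 * (n%:R * V) + 17 * (r%:R * K / eps) * M ^+ 2) &
    forall w k i, \sum_(j | same_fiber k i j) clip M (T j w) ^+ 2 <= F w.
Proof.
move=> M0 V0 K1 /andP[e0 e1] s0 HV HK Hs.
have n1 : 1 <= n%:R :> R by rewrite ler1n; exact: ltnW.
have np : 0 < n%:R :> R by exact: lt_le_trans ltr01 n1.
have l0 : 0 < ln n%:R :> R by rewrite ln_gt0// ltr1n.
have rr : 2 <= r%:R :> R by rewrite ler_nat.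
have M2 : 0 < M ^+ 2 by rewrite exprn_gt0.
have nV : 0 <= n%:R * V by rewrite mulr_ge0// ltW.
have rKe : r%:R * 1 <= r%:R * K / eps.
  by rewrite ler_pdivlMr// -mulrA ler_wpM2l// mul1r; lra.
set l := ln n%:R in l0 Hs *.
have mclip2 : measurable_fun setT (fun t : R => clip M t ^+ 2).
  by apply: measurable_funX; exact: measurable_clip.
have gfull t : 0 <= clip M t ^+ 2 / M ^+ 2 <= 1.
  rewrite divr_ge0 ?sqr_ge0//= ler_pdivrMr// mul1r -[leLHS]real_normK ?num_real//.
  by rewrite lerXn2r ?nnegrE ?(ltW M0)// clip_le// ltW.
have full lam : 0 < lam -> exists2 Xi : Omega -> R, mean_le P Xi 1 &
    forall w k i, \sum_(j | same_fiber k i j) clip M (T j w) ^+ 2 <=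
      expR lam * (n%:R * V) + M ^+ 2 / lam * (2 * r%:R * l + Xi w).
  move=> lam0.
  have [|c c0|Xi Xi1 HXi] := @uniform_fiber (fun t => clip M t ^+ 2 / M ^+ 2)
    (V / M ^+ 2) lam _ gfull lam0 (divr_ge0 V0 (sqr_ge0 M)).
  - exact: measurable_funM.
  - have := HV (c / M ^+ 2) (divr_ge0 c0 (sqr_ge0 M)).
    under eq_integral do rewrite mulrAC -mulrA.
    by rewrite [c / _ * V]mulrAC -mulrA.
  exists Xi => // w k i; have := HXi w k i; rewrite -mulr_suml ler_pdivrMr//.
  move=> /le_trans; apply; rewrite -/l le_eqVlt; apply/orP; left; apply/eqP.
  by field; rewrite !gt_eqF.
have [le|gt] := lerP l (8 * K / eps).
  have [Xi Xi1 HXi] := full 1 ltr01.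
  exists (fun w => 4 * (n%:R * V) + M ^+ 2 * (2 * r%:R * l) + M ^+ 2 * Xi w).
    apply: (@mean_le_trans _ _ _ _ _ (4 * (n%:R * V) + M ^+ 2 * (2 * r%:R * l) + M ^+ 2 * 1)).
      have -> : 17 * (r%:R * K / eps) * M ^+ 2 =
          M ^+ 2 * (2 * r%:R * (8 * K / eps)) + M ^+ 2 * (r%:R * K / eps).
        by field; rewrite gt_eqF.
      have a1 : M ^+ 2 * (2 * r%:R * l) <= M ^+ 2 * (2 * r%:R * (8 * K / eps)).
        by rewrite ler_pM2l// ler_wpM2l// mulr_ge0.
      have a2 : M ^+ 2 * 1 <= M ^+ 2 * (r%:R * K / eps).
        by rewrite ler_pM2l//; apply: le_trans rKe; rewrite mulr1; lra.
      have a3 : 4 * (n%:R * V) <= 3 * r%:R ^+ 2 * (n%:R * V).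
        rewrite ler_wpM2r// expr2; have := ler_wpM2l (ler0n R r) rr; lra.
      by rewrite addrA; apply: lerD => //; apply: lerD.
    apply: mean_leD; last by apply: mean_leZ => //; exact: ltW.
    by apply: mean_le_cst; rewrite addr_ge0 ?mulr_ge0// ltW.
  move=> w k i; apply: le_trans (HXi w k i) _.
  rewrite divr1 mulrDr addrA lerD2r lerD2r ler_wpM2r//; exact: expR1_le4.
have el : 8 * K < eps * l by move: gt; rewrite ltr_pdivrMr// [l * _]mulrC.
have l8 : 8 <= l.
  have : eps * l <= l by exact: ler_piMl (ltW l0) (ltW e1).
  by lra.
(* For [V = 0] the cut below would degenerate. Here [lam = ln n] removes the logarithm at once, as
   [expR lam] multiplies [n * V = 0]. *)
move: V0; rewrite le_eqVlt => /predU1P[V0|V0].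
  have [Xi Xi1 HXi] := full l l0.
  exists (fun w => M ^+ 2 * (2 * r%:R) + M ^+ 2 * Xi w).
    apply: (@mean_le_trans _ _ _ _ _ (M ^+ 2 * (2 * r%:R) + M ^+ 2 * 1)).
      rewrite -V0 !mulr0 add0r -mulrDr mulrC ler_wpM2r ?(ltW M2)//.
      by lra.
    apply: mean_leD; last by apply: mean_leZ => //; exact: ltW.
    by apply: mean_le_cst; rewrite mulr_ge0 ?mulr_ge0// ltW.
  move=> w k i; apply: le_trans (HXi w k i) _; rewrite -V0 !mulr0 add0r.
  have Xi0 : 0 <= Xi w by have [] := Xi1.
  rewrite -mulrA -mulrDr ler_pM2l// mulrDr; apply: lerD.
    by rewrite [2 * _ * l]mulrC mulrA mulVf ?mul1r// gt_eqF.
  by rewrite ler_piMl// invf_le1//; lra.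
(* With this cut the union bound for the squares below [b ^ 2] costs
   [b ^ 2 * 2 * r * ln n = 2 * r * n * V]. *)
pose b2 := n%:R * V / l.
have b20 : 0 < b2 by rewrite divr_gt0// mulr_gt0.
pose b := Num.sqrt b2; have b0 : 0 < b by rewrite sqrtr_gt0.
have bE : b ^+ 2 = b2 by rewrite sqr_sqrtr// ltW.
pose gs t : R := if `|clip M t| <= b then clip M t ^+ 2 / b2 else 0.
pose gb t : R := if b < `|clip M t| then clip M t ^+ 2 / M ^+ 2 else 0.
have mnc : measurable_fun setT (fun t : R => `|clip M t|).
  by apply: measurableT_comp; [exact: normr_measurable|exact: measurable_clip].
have mgs : measurable_fun setT gs.
  apply: measurable_fun_ifT => //; last exact: measurable_funM.
  exact: measurable_fun_ler.
have mgb : measurable_fun setT gb.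
  apply: measurable_fun_ifT => //; last exact: measurable_funM.
  exact: measurable_fun_ltr.
have gs01 t : 0 <= gs t <= 1.
  rewrite /gs; case: ifP => [tb|_]; last by rewrite lexx ler01.
  rewrite divr_ge0 ?sqr_ge0 ?(ltW b20)//= ler_pdivrMr// mul1r -bE.
  by rewrite -[leLHS]real_normK ?num_real// lerXn2r ?nnegrE// ltW.
have gb01 t : 0 <= gb t <= 1 by rewrite /gb; case: ifP => _ //; rewrite lexx ler01.
have split t : clip M t ^+ 2 = b2 * gs t + M ^+ 2 * gb t.
  rewrite /gs /gb ltNge; case: ifP => _ /=.
    by rewrite mulr0 addr0 mulrC divfK// gt_eqF.
  by rewrite mulr0 add0r mulrC divfK// gt_eqF.
(* Above the cut, [clip ^ 2 <= |Z| ^ (2 + eps) / b ^ eps]; [vb] is the resulting bound on the mean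
   of [gb]. *)
pose vb := K * sigma `^ (2 + eps) / (b `^ eps * M ^+ 2).
have be0 : 0 < b `^ eps by exact: powR_gt0.
have vb0 : 0 <= vb.
  by rewrite divr_ge0 ?mulr_ge0 ?powR_ge0 ?sqr_ge0//; lra.
have [c c0|Xs Xs1 HXs] := @uniform_fiber gs (V / b2) 1 mgs gs01 ltr01 (divr_ge0 (ltW V0) (ltW b20)).
  apply: le_trans (ge0_le_integralT P' (g := fun t => (1 + c / b2 * clip M (Z t) ^+ 2)%:E) _ _) _.
  - by move=> w; rewrite lee_fin addr_ge0// mulr_ge0//; have /andP[] := gs01 (Z w).
  - move=> w; rewrite lee_fin lerD2l mulrAC -mulrA ler_wpM2l// /gs; case: ifP => // _.
    by rewrite divr_ge0 ?sqr_ge0// ltW.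
  apply: le_trans (HV _ (divr_ge0 c0 (ltW b20))) _.
  by rewrite [c / _ * V]mulrAC -mulrA.
(* Dividing by this [lam] turns [2 * r * ln n] into [16 * r / eps], while [expR lam = n ^ (eps / 8)]
   is compensated by the power [b ^ eps] in the denominator of [vb]. *)
have lam0 : 0 < eps * l / 8 by rewrite divr_gt0// mulr_gt0.
have [c c0|Xb Xb1 HXb] := @uniform_fiber gb vb (eps * l / 8) mgb gb01 lam0 vb0.
  pose c' := c / (b `^ eps * M ^+ 2).
  have c'0 : 0 <= c' by rewrite divr_ge0// mulr_ge0 ?powR_ge0// sqr_ge0.
  apply: le_trans (ge0_le_integralT P' (g := fun t => (1 + c' * `|Z t| `^ (2 + eps))%:E) _ _) _.
  - by move=> w; rewrite lee_fin addr_ge0// mulr_ge0//; have /andP[] := gb01 (Z w).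
  - move=> w; rewrite lee_fin lerD2l /gb; case: ifP => [bc|_]; last first.
      by rewrite mulr0 mulr_ge0// powR_ge0.
    have cz : `|clip M (Z w)| <= `|Z w| by exact: clip_le_norm (ltW M0).
    have z0 : 0 < `|Z w| by apply: lt_le_trans cz; exact: lt_trans bc.
    rewrite powRD; last by apply/implyP => _; rewrite gt_eqF.
    rewrite powR_mulrn// /c'.
    have -> : c / (b `^ eps * M ^+ 2) * (`|Z w| ^+ 2 * `|Z w| `^ eps) =
       c * (`|Z w| ^+ 2 / M ^+ 2 * (`|Z w| `^ eps / b `^ eps)).
      by field; rewrite !gt_eqF.
    rewrite ler_wpM2l//.
    apply: (@le_trans _ _ (`|Z w| ^+ 2 / M ^+ 2)).
      rewrite ler_wpM2r ?invr_ge0 ?sqr_ge0// -[leLHS]real_normK ?num_real//.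
      by rewrite lerXn2r ?nnegrE.
    rewrite ler_peMr ?divr_ge0 ?sqr_ge0// ler_pdivlMr// mul1r.
    rewrite ge0_ler_powR ?nnegrE ?(ltW e0) ?(ltW b0)//.
    exact: le_trans (ltW bc) cz.
  apply: le_trans (HK c' c'0) _.
  by rewrite lee_fin lerD2l /c' /vb mulrAC [leRHS]mulrA.
(* By [sigma ^ 2 <= 2 * V] and the value of [b], the powers of [n] and [l] have logarithm
   [eps * l * (1/8 - 1/2) + eps / 2 * ln l], at most [- eps * l / 8] since [ln l <= l / 2]. As
   [eps * l > 8 * K], there remains at most [K * e ^ (- K) * 2 ^ (1 + eps / 2) * V]; now
   [K * e ^ (- K) < 1] and [2 ^ (3 / 2) <= 3]. *)
have key : expR (eps * l / 8) * (M ^+ 2 * vb) <= 3 * V.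
  have -> : M ^+ 2 * vb = K * sigma `^ (2 + eps) / b `^ eps.
    by rewrite /vb; field; rewrite !gt_eqF.
  move: s0; rewrite le_eqVlt => /predU1P[s0|s0].
    rewrite -s0 powR0 ?mulr0 ?mul0r ?mulr0 ?mulr_ge0 ?(ltW V0)//.
    by rewrite gt_eqF//; lra.
  have K0 : 0 < K by lra.
  have -> : expR (eps * l / 8) * (K * sigma `^ (2 + eps) / b `^ eps) =
      expR (eps * l / 8 + ln K + (2 + eps) * ln sigma - eps * ln b).
    rewrite !expRD expRN lnK ?posrE// /powR !gt_eqF//.
    by rewrite !mulrA.
  have -> : 3 * V = expR (ln 3 + ln V) by rewrite expRD !lnK ?posrE.
  rewrite ler_expR.
  have lnb : 2 * ln b = l + ln V - ln l.
    rewrite mulr_natl -lnXn// bE /b2 lnM ?posrE ?invr_gt0// ?mulr_gt0//.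
    by rewrite lnM ?posrE// lnV ?posrE.
  have lns : 2 * ln sigma <= ln 2 + ln V.
    by rewrite mulr_natl -lnXn// -lnM ?posrE// ler_ln ?posrE ?exprn_gt0 ?mulr_gt0// Hs.
  have ln32 : 3 * ln 2 <= 2 * ln 3 :> R.
    by rewrite !mulr_natl -!lnXn// ler_ln ?posrE ?exprn_gt0// -!natrX ler_nat.
  have lnK1 := ln_le_subr1 K0.
  have lnl : ln l <= l / 2.
    have := ln_le_subr1 (divr_gt0 l0 (ltr0n R 2)); rewrite lnM ?posrE// lnV ?posrE//.
    by have := @ln_le_subr1 R 2 (ltr0n R 2); lra.
  have ln2 : 0 <= ln 2 :> R by rewrite ln_ge0// ler1n.
  have p1 : eps * (2 * ln sigma) <= eps * (ln 2 + ln V) by rewrite ler_pM2l.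
  have p2 : eps * ln l <= eps * (l / 2) by rewrite ler_pM2l.
  have p3 : eps * (2 * ln b) = eps * (l + ln V - ln l) by rewrite lnb.
  have p4 : eps * ln 2 <= 1 * ln 2 by rewrite ler_wpM2r// ltW.
  move: el lns ln32 lnK1 ln2 p1 p2 p3 p4.
  set x2 := ln 2; set x3 := ln 3; set xV := ln V; set xs := ln sigma; set xb := ln b.
  set xK := ln K; set xl := ln l; clearbody l x2 x3 xV xs xb xK xl; lra.
have nVp : 0 < n%:R * V by rewrite mulr_gt0.
exists (fun w => (4 + 2 * r%:R) * (n%:R * V) + n%:R * V * Xs w +
   (3 * (n%:R * V) + M ^+ 2 * (16 * r%:R / eps) + M ^+ 2 * Xb w)).
  apply: (@mean_le_trans _ _ _ _ _ ((4 + 2 * r%:R) * (n%:R * V) + n%:R * V * 1 +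
   (3 * (n%:R * V) + M ^+ 2 * (16 * r%:R / eps) + M ^+ 2 * 1))).
    have a1 : (8 + 2 * r%:R) * (n%:R * V) <= 3 * r%:R ^+ 2 * (n%:R * V).
      by rewrite ler_wpM2r// expr2; have := ler_wpM2l (ler0n R r) rr; lra.
    have a2 : M ^+ 2 * (16 * r%:R / eps) <= M ^+ 2 * (16 * (r%:R * K / eps)).
      rewrite ler_pM2l// -mulrA ler_wpM2l// ler_wpM2r ?invr_ge0 ?(ltW e0)//.
      by rewrite ler_peMr.
    have a3 : M ^+ 2 * 1 <= M ^+ 2 * (r%:R * K / eps).
      by rewrite ler_pM2l//; apply: le_trans rKe; rewrite mulr1; lra.
    move: a1 a2 a3; set q := r%:R * K / eps; set q' := _ / eps; set x := n%:R * V.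
    by clearbody q q' x; lra.
  apply: mean_leD; (apply: mean_leD; [apply: mean_le_cst|apply: mean_leZ => //; exact: ltW]).
    by rewrite mulr_ge0// addr_ge0// mulr_ge0.
  by rewrite addr_ge0// mulr_ge0// ?divr_ge0 ?mulr_ge0// ltW.
move=> w k i.
under eq_bigr do rewrite split.
rewrite big_split/= -!mulr_sumr; apply: lerD.
  apply: le_trans (ler_wpM2l (ltW b20) (HXs w k i)) _.
  have Xs0 : 0 <= Xs w by have [] := Xs1.
  rewrite -/l invr1 mul1r mulrDr.
  have -> : b2 * (expR 1 * (n%:R * (V / b2))) = expR 1 * (n%:R * V).
    by field; rewrite gt_eqF.
  have -> : b2 * (2 * r%:R * l + Xs w) = 2 * r%:R * (n%:R * V) + b2 * Xs w.
    by rewrite mulrDr /b2; field; rewrite gt_eqF.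
  have b2le : b2 * Xs w <= n%:R * V * Xs w.
    rewrite ler_wpM2r// /b2 ler_pdivrMr// ler_peMr//; lra.
  by have := ler_wpM2r nV (expR1_le4 R); lra.
apply: le_trans (ler_wpM2l (ltW M2) (HXb w k i)) _.
have Xb0 : 0 <= Xb w by have [] := Xb1.
have el0 : 0 < eps * l by rewrite mulr_gt0.
rewrite -/l.
have -> : M ^+ 2 * (expR (eps * l / 8) * (n%:R * vb) +
    (eps * l / 8)^-1 * (2 * r%:R * l + Xb w)) =
  n%:R * (expR (eps * l / 8) * (M ^+ 2 * vb)) + M ^+ 2 * (16 * r%:R / eps) +
  M ^+ 2 * ((eps * l / 8)^-1 * Xb w).
  by field; rewrite !gt_eqF.
apply: lerD; [rewrite lerD2r|].
  by apply: le_trans (ler_wpM2l (ltW np) key) _; rewrite mulrCA.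
rewrite ler_pM2l// ler_piMl// invf_le1//.
by lra.
Qed.
End fibers.

(** * The lower bound *)

Section inj_norm_lower.
Context (R : realType) (r : nat) (ns : 'I_r -> nat).
Hypothesis n0 : forall k, (0 < ns k)%N.
Implicit Types T : tensor R ns.

Lemma fiber_le_inj_norm T k (i : tensor_index ns) :
  Num.sqrt (\sum_(j | same_fiber k i j) T j ^+ 2) <= inj_norm T.
Proof.
set S := \sum_(j | _) _.
have S0 : 0 <= S by apply: sumr_ge0 => j _; exact: sqr_ge0.
(* Basis vectors at [i] off mode [k] and the fiber itself in mode [k]: the pairing is the square of
   the fiber norm, the product of the norms the fiber norm. The sum at [a] has a single term, the
   index of the fiber with coordinate [a]. *)
pose y l (a : 'I_(ns l)) : R := if l == k then
  \sum_(j | same_fiber k i j && (j l == a)) T j else (a == i l)%:R.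
have yk j : same_fiber k i j -> y k (j k) = T j.
  move=> /forallP ij; rewrite /y eqxx (big_pred1 j)// => j' /=.
  apply/andP/eqP => [[/forallP ij' /eqP jk]|->]; last by split=> //; apply/forallP.
  apply/ffunP => l; have [->//|lk] := eqVneq l k.
  by have /implyP/(_ lk)/eqP -> := ij l; have /implyP/(_ lk)/eqP -> := ij' l.
have ysum : \sum_a y k a ^+ 2 = S.
  rewrite /S (partition_big (fun j : tensor_index ns => j k) predT)//=.
  apply: eq_bigr => a _; rewrite expr2 {1}/y eqxx mulr_suml.
  by apply: eq_bigr => j /andP[ij /eqP <-]; rewrite yk// expr2.
have := inj_norm_wt T y n0.
have -> : \sum_j T j * wt y j = S.
  rewrite /S [RHS]big_mkcond/=; apply: eq_bigr => j _.
  rewrite /wt (bigD1 k)//=; have [ij|ij] := boolP (same_fiber k i j).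
    rewrite yk// big1 ?mulr1 ?expr2// => l lk; rewrite /y (negbTE lk).
    by move/forallP: ij => /(_ l)/implyP/(_ lk) ->.
  move/forallPn: ij => [l]; rewrite negb_imply => /andP[lk jl].
  by rewrite (bigD1 l)//= {2}/y (negbTE lk) (negbTE jl) mul0r !mulr0.
have -> : \prod_l Num.sqrt (\sum_a y l a ^+ 2) = Num.sqrt S.
  rewrite (bigD1 k)//= ysum big1 ?mulr1// => l lk.
  rewrite (bigD1 (i l))//= big1 ?addr0; last first.
    by move=> a /negbTE ai; rewrite /y (negbTE lk) ai expr0n.
  by rewrite /y (negbTE lk) eqxx expr1n sqrtr1.
rewrite ger0_norm// -{1}(sqr_sqrtr S0) expr2.
have := sqrtr_ge0 S; rewrite le_eqVlt => /predU1P[<- _|sp].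
  exact: inj_norm_ge0.
by rewrite ler_pM2r.
Qed.

Lemma norm_inf_le_inj_norm T : (0 < r)%N -> tensor_norm_inf T <= inj_norm T.
Proof.
move=> r0; apply/bigmax_leP; split => [|i _]; first exact: inj_norm_ge0.
apply: le_trans (fiber_le_inj_norm T (Ordinal r0) i).
rewrite -sqrtr_sqr ler_sqrt; last by apply: sumr_ge0 => j _; exact: sqr_ge0.
rewrite (bigD1 i)/=; first by rewrite lerDl sumr_ge0// => j _; exact: sqr_ge0.
by apply/forallP => l; rewrite eqxx implybT.
Qed.
End inj_norm_lower.

Section lower_bound.
Context (R : realType) (r : nat) (ns : 'I_r -> nat)
  (d : measure_display) (Omega : measurableType d) (P : probability Omega R)
  (d' : measure_display) (Omega' : measurableType d') (P' : probability Omega' R)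
  (Z : {RV P' >-> R}) (T : tensor_index ns -> {RV P >-> R}).
Hypothesis ind : mutually_independent T.
Hypothesis idd : forall i, identically_distributed (T i) Z.
Hypothesis n0 : forall k, (0 < ns k)%N.

(* [sqrt u >= 1 - expR (- u)], so the Laplace transform of the square norm of a
   fiber bounds the mean of its norm from below. *)
Lemma fiber_mean_lower (M V : R) (k : 'I_r) :
  0 <= M -> (\int[P']_w (clip M (Z w) ^+ 2)%:E = V%:E)%E ->
  M ^+ 2 <= (ns k)%:R * V ->
  ((Num.sqrt ((ns k)%:R * V) / 3)%:E <= \int[P]_w (inj_norm (fun i => T i w))%:E)%E.
Proof.
move=> M0 HV MV; set s2 := (ns k)%:R * V in MV *.
have V0 : 0 <= V by rewrite -lee_fin -HV integral_ge0// => w _; rewrite lee_fin sqr_ge0.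
have nk : 0 < (ns k)%:R :> R by rewrite ltr0n.
have : 0 <= s2 by rewrite mulr_ge0// ltW.
rewrite le_eqVlt => /predU1P[<-|s20].
  by rewrite sqrtr0 mul0r; apply: integral_ge0 => w _; rewrite lee_fin inj_norm_ge0.
set s := Num.sqrt s2; have s0 : 0 < s by rewrite sqrtr_gt0.
have sE : s ^+ 2 = s2 by rewrite sqr_sqrtr// ltW.
pose i : tensor_index ns := [ffun k => Ordinal (n0 k)].
pose e (t : R) : R := expR (- (clip M t ^+ 2 / s2)).
have me : measurable_fun setT e.
  apply: measurableT_comp => //; apply: measurableT_comp => //.
  apply: measurable_funM => //; apply: measurable_funX; exact: measurable_clip.
have e0 t : 0 <= e t by exact: expR_ge0.
pose c : R := fine (\int[P']_w (e (Z w))%:E)%E.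
have mclip2 : measurable_fun setT (fun w => clip M (Z w) ^+ 2).
  by apply: measurable_funX; apply: measurableT_comp => //; exact: measurable_clip.
(* The assumption [M ^ 2 <= s2] keeps [u = clip ^ 2 / s2] within the unit interval, where
   [exp (- u) <= 1 - u / 2]. *)
have le1 : (\int[P']_w (e (Z w))%:E + (V / (2 * s2))%:E <= 1)%E.
  have -> : (V / (2 * s2))%:E = (\int[P']_w ((2 * s2)^-1 * clip M (Z w) ^+ 2)%:E)%E.
    under eq_integral do rewrite EFinM.
    have p0 : 0 <= (2 * s2)^-1 by rewrite invr_ge0 mulr_ge0// ltW.
    have q0 w : setT w -> (0 <= (clip M (Z w) ^+ 2)%:E)%E by rewrite lee_fin sqr_ge0.
    have mq : measurable_fun setT (EFin \o (fun w => clip M (Z w) ^+ 2)).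
      exact/measurable_EFinP.
    by rewrite (ge0_integralZl_EFin P' measurableT q0 mq p0) /= HV -EFinM mulrC.
  rewrite -ge0_integralD//; last 4 first.
  - by move=> w _; rewrite lee_fin.
  - by apply/measurable_EFinP; apply: measurableT_comp.
  - by move=> w _; rewrite lee_fin mulr_ge0 ?sqr_ge0// invr_ge0 mulr_ge0// ltW.
  - by apply/measurable_EFinP; exact: measurable_funM.
  apply: (@le_trans _ _ (\int[P']_w (cst 1%:E w))%E); last first.
    by rewrite integral_cst//= probability_setT mule1.
  apply: ge0_le_integralT => w /=.
    by rewrite -EFinD lee_fin addr_ge0// mulr_ge0 ?sqr_ge0// invr_ge0 mulr_ge0// ltW.
  rewrite -EFinD lee_fin /e.
  have -> : (2 * s2)^-1 * clip M (Z w) ^+ 2 = clip M (Z w) ^+ 2 / s2 / 2.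
    by field; rewrite gt_eqF.
  set u := clip M (Z w) ^+ 2 / s2.
  have u0 : 0 <= u by rewrite divr_ge0 ?sqr_ge0// ltW.
  have u1 : u <= 1.
    rewrite /u ler_pdivrMr// mul1r; apply: le_trans MV.
    by rewrite -[leLHS]real_normK ?num_real// lerXn2r ?nnegrE// clip_le.
  have := expR_ge1Dx u; rewrite expRN => eu.
  have ep := expR_gt0 u.
  suff : (expR u)^-1 <= 1 - u / 2 by lra.
  rewrite -[leLHS]mul1r ler_pdivrMr//.
  apply: (@le_trans _ _ ((1 - u / 2) * (1 + u))).
    by rewrite -subr_ge0 (_ : _ - 1 = u * (1 - u) / 2); [rewrite divr_ge0// mulr_ge0//; lra|field].
  by rewrite ler_wpM2l//; lra.
have cE : (\int[P']_w (e (Z w))%:E = c%:E)%E.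
  rewrite /c fineK// ge0_fin_numE; last by apply: integral_ge0 => w _; rewrite lee_fin.
  apply: le_lt_trans (ltry 1); apply: le_trans le1; rewrite leeDl// lee_fin.
  by rewrite divr_ge0// mulr_ge0// ltW.
have c0 : 0 <= c by apply: fine_ge0; apply: integral_ge0 => w _; rewrite lee_fin.
have cexp : c <= expR (- (V / (2 * s2))).
  apply: le_trans (expR_ge1Dx _).
  by move: le1; rewrite cE -EFinD lee_fin; lra.
(* The exponents add up to [- 1 / 2], and [exp (1 / 2) >= 3 / 2]. What is left, [1 - 2 / 3], is the
   1/3 of the conclusion. *)
have cn : c ^+ ns k <= 2 / 3.
  apply: (@le_trans _ _ (expR (- (V / (2 * s2))) ^+ ns k)).
    by rewrite lerXn2r// nnegrE// expR_ge0.
  rewrite -expRM_natl (_ : _ * _ = - 2^-1); last first.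
    have Vp : 0 < V by move: s20; rewrite /s2 pmulr_rgt0.
    by rewrite /s2; field; rewrite !gt_eqF.
  have := expR_ge1Dx (2^-1 : R); rewrite expRN => h.
  rewrite -[leRHS]invf_div lef_pV2 ?posrE ?expR_gt0 ?divr_gt0//; lra.
pose phi (j : tensor_index ns) (t : R) : R := if same_fiber k i j then e t else 1.
pose W w : R := \sum_(j | same_fiber k i j) clip M (T j w) ^+ 2.
have prodE w : \prod_j phi j (T j w) = expR (- (W w / s2)).
  rewrite /W mulr_suml -sumrN expR_sum [RHS]big_mkcond/=.
  by apply: eq_bigr => j _; rewrite /phi; case: ifP.
have mphi j : measurable_fun setT (phi j) by rewrite /phi; case: same_fiber.
have intE : (\int[P]_w (expR (- (W w / s2)))%:E = (c ^+ ns k)%:E)%E.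
  under eq_integral do rewrite -prodE.
  pose cc j : R := if same_fiber k i j then c else 1.
  rewrite (@integral_prod_independent _ _ _ _ _ T phi cc)//.
  - have cardf : #|[pred j | same_fiber k i j]| = ns k.
      apply/eqP; rewrite -(eqr_nat R) -(card_fiber R k i) -sum1_card natr_sum.
      rewrite big_mkcond/=; apply/eqP; apply: eq_bigr => j _.
      by rewrite inE; case: (same_fiber k i j).
    congr EFin; rewrite /cc -big_mkcond/= -cardf -prodr_const.
    by apply: eq_bigl => j; rewrite inE.
  - by move=> j t; rewrite /phi; case: ifP.
  - move=> j; rewrite /phi /cc; case: ifP => _.
      by rewrite (integral_identically_distributed (idd j)).
    by rewrite integral_cst//= probability_setT mule1.
have mW : measurable_fun setT (fun w => expR (- (W w / s2))).
  under eq_fun do rewrite -prodE.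
  by apply: measurable_prod => j _; apply: measurableT_comp.
pose f w : R := s * (1 - expR (- (W w / s2))).
have W0 w : 0 <= W w by apply: sumr_ge0 => j _; exact: sqr_ge0.
have u0 w : 0 <= W w / s2 by rewrite divr_ge0// ltW.
have ew1 w : expR (- (W w / s2)) <= 1 by rewrite -expR0 ler_expR oppr_le0.
have f0 w : 0 <= f w by rewrite mulr_ge0 ?(ltW s0)// subr_ge0.
have mf : measurable_fun setT f.
  by apply: measurable_funM => //; exact: measurable_funB.
apply: (@le_trans _ _ (\int[P]_w (f w)%:E)%E); last first.
  apply: ge0_le_integralT => w; rewrite lee_fin//.
  apply: (@le_trans _ _ (Num.sqrt (W w))).
    have -> : Num.sqrt (W w) = s * Num.sqrt (W w / s2).
      by rewrite sqrtrM// sqrtrV ?(ltW s20)// -/s mulrCA divff ?mulr1// gt_eqF.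
    rewrite ler_pM2l//; set u := W w / s2; have u0' : 0 <= u by exact: u0.
    have [u1|/ltW u1] := leP u 1.
      apply: (@le_trans _ _ u).
        by have := expR_ge1Dx (- u); lra.
      rewrite -{1}(sqr_sqrtr u0') expr2 ler_piMl ?sqrtr_ge0//.
      by rewrite -sqrtr1 ler_sqrt.
    apply: (@le_trans _ _ 1); first by have := expR_ge0 (- u); lra.
    by rewrite -sqrtr1 ler_sqrt.
  apply: le_trans (fiber_le_inj_norm n0 (fun i => T i w) k i).
  rewrite ler_sqrt; last by apply: sumr_ge0 => j _; exact: sqr_ge0.
  apply: ler_sum => j _; rewrite -[leLHS]real_normK ?num_real// -[leRHS]real_normK ?num_real//.
  by rewrite lerXn2r ?nnegrE// clip_le_norm.
have : (s%:E <= \int[P]_w (f w)%:E + (s * c ^+ ns k)%:E)%E.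
  have -> : (s * c ^+ ns k)%:E = (\int[P]_w (s * expR (- (W w / s2)))%:E)%E.
    under eq_integral do rewrite EFinM.
    rewrite ge0_integralZl_EFin ?intE//; first exact/measurable_EFinP.
    exact: ltW.
  rewrite -ge0_integralD//; last 4 first.
  - by move=> w _; rewrite lee_fin.
  - exact/measurable_EFinP.
  - by move=> w _; rewrite lee_fin mulr_ge0// ltW.
  - by apply/measurable_EFinP; exact: measurable_funM.
  under eq_integral do rewrite -EFinD /f -mulrDr subrK mulr1.
  by rewrite integral_cst//= probability_setT mule1.
rewrite -leeBlDr// -EFinB => /(le_trans _); apply; rewrite lee_fin.
have := ler_wpM2l (ltW s0) cn; lra.
Qed.
End lower_bound.

(** * The variance that survives clipping *)

Section sigma.
Context (R : realType) (d' : measure_display) (Omega' : measurableType d')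
  (P' : probability Omega' R) (Z : {RV P' >-> R}).

(** Above [M], either [|Z| >= t] and the [2 + eps] moment controls [Z ^ 2], or [|Z| <= t] and
    [Z ^ 2 <= t ^ 2 / M * excess], whose mean is at most [t ^ 2 / N]. If clipping lost more than
    half of the variance, these two terms would have to supply it; this forces [N < 4 * E ^ 2],
    against [ln N >= ln n > 8 * K / eps]. *)
Lemma sigma_sqr_le (M V m K eps sigma : R) (n N : nat) :
  0 < M -> 0 <= V -> 1 <= K -> 0 < eps < 1 -> 0 <= sigma -> (0 < n <= N)%N ->
  (\int[P']_w (clip M (Z w) ^+ 2)%:E = V%:E)%E ->
  (\int[P']_w (excess M (Z w))%:E = m%:E)%E -> N%:R * m <= M ->
  (\int[P']_w (Z w ^+ 2)%:E = (sigma ^+ 2)%:E)%E ->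
  (\int[P']_w (`|Z w| `^ (2 + eps))%:E <= (K * sigma `^ (2 + eps))%:E)%E ->
  8 * K / eps < ln n%:R -> sigma ^+ 2 <= 2 * V.
Proof.
move=> M0 V0 K1 /andP[e0 e1] s0 /andP[n0 nN] HV Hm Nm Hs HK gt.
rewrite leNgt; apply/negP => Vs.
have {}s0 : 0 < sigma.
  rewrite lt_def s0 andbT; apply: contraTneq Vs => ->.
  by rewrite expr0n/= -leNgt mulr_ge0.
have K0 : 0 < K by lra.
have K4 : 0 < 4 * K by lra.
(* [E] is [(4 * K) ^ (1 / eps)], so that [t ^ eps = 4 * K * sigma ^ eps] and the moment term has
   mean at most [sigma ^ 2 / 4]. *)
pose E := expR (ln (4 * K) / eps); have E0 : 0 < E by exact: expR_gt0.
pose t := E * sigma; have t0 : 0 < t by rewrite mulr_gt0.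
have te : t `^ eps = 4 * K * sigma `^ eps.
  rewrite powRM ?(ltW E0) ?(ltW s0)//; congr (_ * _).
  by rewrite /E -expRM divfK ?gt_eqF// lnK ?posrE.
have se0 : 0 < sigma `^ eps by exact: powR_gt0.
have te0 : 0 < t `^ eps by exact: powR_gt0.
have m0 : 0 <= m.
  by rewrite -lee_fin -Hm; apply: integral_ge0 => w _; rewrite lee_fin excess_ge0.
have mclip2 : measurable_fun setT (fun w => clip M (Z w) ^+ 2).
  by apply: measurable_funX; apply: measurableT_comp => //; exact: measurable_clip.
have mpow : measurable_fun setT (fun w => `|Z w| `^ (2 + eps)).
  apply: (@measurableT_comp _ _ _ _ _ _ (@powR R ^~ (2 + eps))).
    exact: measurable_powR.
  by apply: measurableT_comp => //; exact: normr_measurable.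
have mexc : measurable_fun setT (fun w => excess M (Z w)).
  by apply: measurableT_comp => //; exact: measurable_excess.
have M1 : mean_le P' (fun w => clip M (Z w) ^+ 2) V.
  by split => // [w|]; rewrite ?sqr_ge0// HV.
have M2 : mean_le P' (fun w => `|Z w| `^ (2 + eps)) (K * sigma `^ (2 + eps)).
  by split => // w; exact: powR_ge0.
have M3 : mean_le P' (fun w => excess M (Z w)) m.
  by split => // [w|]; rewrite ?excess_ge0// Hm.
have tei : 0 <= (t `^ eps)^-1 by rewrite invr_ge0 ltW.
have tM : 0 <= t ^+ 2 / M by rewrite divr_ge0 ?sqr_ge0// ltW.
have [_ _] := mean_leD (mean_leD M1 (mean_leZ tei M2)) (mean_leZ tM M3).
have : (\int[P']_w (Z w ^+ 2)%:E <= \int[P']_w (clip M (Z w) ^+ 2 +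
    (t `^ eps)^-1 * `|Z w| `^ (2 + eps) + t ^+ 2 / M * excess M (Z w))%:E)%E.
  apply: ge0_le_integralT => w; first by rewrite lee_fin sqr_ge0.
  rewrite lee_fin.
  have a0 : 0 <= (t `^ eps)^-1 * `|Z w| `^ (2 + eps) by rewrite mulr_ge0// powR_ge0.
  have a1 : 0 <= t ^+ 2 / M * excess M (Z w) by rewrite mulr_ge0// excess_ge0.
  have [zM|zM] := lerP `|Z w| M.
    by rewrite {1}/clip zM -addrA lerDl addr_ge0.
  have c0 := sqr_ge0 (clip M (Z w)).
  have zp : 0 < `|Z w| by exact: lt_trans zM.
  rewrite -[Z w ^+ 2]real_normK ?num_real//.
  have [tz|/ltW tz] := leP t `|Z w|.
    suff : `|Z w| ^+ 2 <= (t `^ eps)^-1 * `|Z w| `^ (2 + eps) by lra.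
    rewrite powRD; last by apply/implyP => _; rewrite gt_eqF.
    rewrite powR_mulrn// mulrCA ler_peMr ?sqr_ge0//.
    rewrite mulrC ler_pdivlMr// mul1r.
    by rewrite ge0_ler_powR ?nnegrE ?(ltW e0) ?(ltW t0).
  suff : `|Z w| ^+ 2 <= t ^+ 2 / M * excess M (Z w) by lra.
  rewrite /excess zM -mulrA; apply: (@le_trans _ _ (t ^+ 2)).
    by rewrite lerXn2r ?nnegrE ?(ltW t0).
  by rewrite ler_peMr ?sqr_ge0// mulrC ler_pdivlMr// mul1r ltW.
rewrite Hs => /le_trans H /H; rewrite lee_fin => {}H.
have N1 : (0 < N)%N by exact: leq_trans n0 nN.
have Np : 0 < N%:R :> R by rewrite ltr0n.
have p2 : (t `^ eps)^-1 * (K * sigma `^ (2 + eps)) = sigma ^+ 2 / 4.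
  rewrite te powRD; last by apply/implyP => _; rewrite gt_eqF.
  rewrite powR_mulrn ?(ltW s0)//.
  by field; rewrite !gt_eqF.
have p3 : t ^+ 2 / M * m <= E ^+ 2 * sigma ^+ 2 / N%:R.
  rewrite -mulrA -exprMn ler_wpM2l ?sqr_ge0// mulrC ler_pdivrMr// mulrC.
  by rewrite ler_pdivlMr// mulrC.
have {}H : sigma ^+ 2 / 4 < E ^+ 2 * sigma ^+ 2 / N%:R.
  move: p3 H Vs; rewrite p2; set a := t ^+ 2 / M * m; set X := _ / N%:R.
  by clearbody a X; lra.
have {}H : N%:R < 4 * E ^+ 2.
  move: H; rewrite ltr_pdivlMr// mulrC [_ / 4]mulrC mulrA.
  rewrite ltr_pM2r ?exprn_gt0// ltr_pdivrMr// [_ * 4]mulrC//.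
have : ln n%:R < ln (4 * E ^+ 2).
  by rewrite ltr_ln ?posrE ?ltr0n ?mulr_gt0 ?exprn_gt0//; apply: le_lt_trans H; rewrite ler_nat.
rewrite lnM ?posrE ?exprn_gt0// lnXn// expRK -[_ / eps *+ 2]mulr_natl.
have -> : ln 4 = 2 * ln 2 :> R by rewrite (_ : 4 = 2 ^+ 2) ?lnXn ?mulr_natl//; ring.
have l2 := @ln_le_subr1 R 2 (ltr0n R 2); have lK := ln_le_subr1 K4.
have q1 : 2 <= 2 / eps by rewrite ler_pdivlMr//; lra.
have q2 : ln (4 * K) / eps <= (4 * K - 1) / eps by rewrite ler_wpM2r ?invr_ge0 ?(ltW e0).
move: gt; have -> : 8 * K / eps = 2 * ((4 * K - 1) / eps) + 2 / eps by field; rewrite gt_eqF.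
by move: q1 q2; set x := 2 / eps; set y := ln (4 * K) / eps; set z := (4 * K - 1) / eps; lra.
Qed.
End sigma.

(** * The two-sided estimate *)

Section final_lemmas.
Context (R : realType).

Lemma ln2_ge_half : 2^-1 <= ln 2 :> R.
Proof.
rewrite -ler_expR lnK ?posrE//; apply: le_trans (expR_le_quad (lexx _)) _.
by rewrite expr2; lra.
Qed.

(** The left side is of order [r ^ 3 * s + (r ^ 3 * K / eps) * M]. As [r / eps >= 2], the squared
    logarithm is at least 1/4, so four times the stated coefficient of [M] dominates
    [r ^ 3 * K / eps]. This turns the factor [4 + 2 * 120 * 5 = 1204] into 4816, rounded up to
    5000. *)
Lemma upper_constant_le (r : nat) (eps K M s rho : R) :
  (2 <= r)%N -> 0 < eps < 1 -> 1 <= K -> 0 <= M -> 0 <= s -> 0 <= rho ->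
  rho ^+ 2 = 3 * r%:R ^+ 2 * s ^+ 2 + 17 * (r%:R * K / eps) * M ^+ 2 ->
  2 * (M + 120 * r%:R ^+ 2 * rho + M) <=
  5000 * (r%:R ^+ 3 * s + r%:R ^+ 5 * ln (r%:R / eps) ^+ 2 / eps ^+ 6 * K * M).
Proof.
move=> r2 /andP[e0 e1] K1 M0 s0 rho0 rhoE.
have rr : 2 <= r%:R :> R by rewrite ler_nat.
set x := r%:R in rr rhoE *.
have [q qE] : {q | q = x * K / eps} by exists (x * K / eps).
have q1 : 1 <= q.
  rewrite qE ler_pdivlMr// mul1r.
  by have := ler_pM ler01 ler01 (ltW (lt_le_trans (ltr1n R 2) rr)) K1; lra.
have x0 : 0 <= x by lra.
have q0 : 0 <= q by exact: le_trans ler01 q1.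
have rhole : rho <= 2 * x * s + 5 * q * M.
  rewrite -(@ler_pXn2r _ 2)// ?nnegrE ?addr_ge0 ?mulr_ge0//.
  rewrite rhoE -qE sqrrD.
  have p1 : 0 <= (2 * x * s) * (5 * q * M) by rewrite !mulr_ge0.
  have p2 : 17 * q * M ^+ 2 <= (5 * q * M) ^+ 2.
    rewrite !exprMn ler_wpM2r ?sqr_ge0//.
    by have := ler_wpM2l q0 q1; move: q0; rewrite !expr2; lra.
  have p3 : 3 * x ^+ 2 * s ^+ 2 <= (2 * x * s) ^+ 2.
    rewrite !exprMn ler_wpM2r ?sqr_ge0//.
    by have := sqr_ge0 x; rewrite !expr2; lra.
  by rewrite mulr2n; lra.
have {}x0 : 0 < x by lra.
set lg := ln (x / eps).
have lg2 : 4^-1 <= lg ^+ 2.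
  have : 2^-1 <= lg.
    apply: le_trans ln2_ge_half _; rewrite ler_ln ?posrE ?divr_gt0//.
    by rewrite ler_pdivlMr//; lra.
  by move=> h; have := ler_pM _ _ h h; rewrite expr2 => /(_ _ _)/(le_trans _); apply; lra.
have x3 : x ^+ 3 <= x ^+ 5 by apply: ler_weXn2l => //; lra.
have e6 : eps^-1 <= (eps ^+ 6)^-1.
  rewrite lef_pV2 ?posrE ?exprn_gt0//.
  by rewrite exprS ler_piMr ?(ltW e0)// exprn_ile1// ltW.
have G : x ^+ 3 * K / eps <= 4 * (x ^+ 5 * lg ^+ 2 / eps ^+ 6 * K).
  have -> : 4 * (x ^+ 5 * lg ^+ 2 / eps ^+ 6 * K) =
      (x ^+ 5 * (4 * lg ^+ 2)) * K * (eps ^+ 6)^-1 by ring.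
  apply: ler_pM => //.
  - by rewrite mulr_ge0 ?exprn_ge0//; lra.
  - by rewrite invr_ge0 ltW.
  - apply: ler_pM => //; [by rewrite exprn_ge0//; lra|lra|].
    by rewrite -[leLHS]mulr1 ler_pM ?exprn_ge0//; lra.
have G1 : 1 <= x ^+ 3 * K / eps.
  have -> : x ^+ 3 * K / eps = x ^+ 2 * q by rewrite qE exprSr -!mulrA.
  rewrite -[leLHS]mulr1 ler_pM// expr_ge1//; lra.
have step : 120 * x ^+ 2 * rho <= 120 * x ^+ 2 * (2 * x * s + 5 * q * M).
  by rewrite ler_wpM2l// mulr_ge0// sqr_ge0.
have eq1 : 120 * x ^+ 2 * (2 * x * s + 5 * q * M) =
    240 * (x ^+ 3 * s) + 600 * (x ^+ 3 * K / eps) * M.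
  by rewrite qE; field; rewrite gt_eqF.
have g1 : (x ^+ 3 * K / eps) * M <= 4 * (x ^+ 5 * lg ^+ 2 / eps ^+ 6 * K) * M.
  by rewrite ler_wpM2r.
have g2 : 1 * M <= (x ^+ 3 * K / eps) * M by rewrite ler_wpM2r.
have xs : 0 <= x ^+ 3 * s by rewrite mulr_ge0// exprn_ge0// ltW.
move: step g1 g2 xs; rewrite eq1; set a := x ^+ 3 * K / eps * M.
set y := x ^+ 3 * s; set g := x ^+ 5 * _ / _ * K; set z := 120 * x ^+ 2 * rho.
rewrite (_ : 600 * (x ^+ 3 * K / eps) * M = 600 * a); last by rewrite /a -[LHS]mulrA.
by clearbody a y g z; lra.
Qed.
End final_lemmas.

Section upper_bound.
Context (R : realType) (r : nat) (ns : 'I_r -> nat)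
  (d : measure_display) (Omega : measurableType d) (P : probability Omega R)
  (d' : measure_display) (Omega' : measurableType d') (P' : probability Omega' R)
  (Z : {RV P' >-> R}) (T : tensor_index ns -> {RV P >-> R}).
Hypothesis ind : mutually_independent T.
Hypothesis idd : forall i, identically_distributed (T i) Z.
Hypothesis r2 : (2 <= r)%N.
Hypothesis ns2 : forall k, (2 <= ns k)%N.
Hypothesis Z0 : ('E_P'[Z] = 0)%E.
Hypothesis Z2 : ('E_P'[fun w => (Z w ^+ 2)%R] < +oo)%E.

Let n := \max_(k < r) ns k.
Let EM : R := fine (\int[P]_w (tensor_norm_inf (fun i => T i w))%:E)%E.
Let M := 2 * EM.
Let V : R := fine (\int[P']_w (clip M (Z w) ^+ 2)%:E)%E.

Let n0 k : (0 < ns k)%N. Proof. exact: ltn_trans (ns2 k). Qed.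
Let r0 : (0 < r)%N. Proof. exact: ltn_trans r2. Qed.
Let nsn k : (0 < ns k <= n)%N. Proof. by rewrite n0 /n leq_bigmax. Qed.

Let max_attained : exists k, ns k = n.
Proof.
have [|k _ H] := @eq_bigmax_cond _ (@predT 'I_r) ns; first by rewrite card_ord.
by exists k; rewrite -H; apply: eq_bigl.
Qed.

Let n2 : (2 <= n)%N. Proof. by have [k <-] := max_attained. Qed.

Let n_le_card : (n <= #|{: tensor_index ns}|)%N.
Proof.
have [k <-] := max_attained; rewrite (card_tensor R) (bigD1 k)//= leq_pmulr//.
by rewrite prodn_gt0.
Qed.

Let EM_ge0 : 0 <= EM.
Proof.
by apply: fine_ge0; apply: integral_ge0 => w _; rewrite lee_fin; exact: mx_ge0.
Qed.

Let M_ge0 : 0 <= M. Proof. by rewrite mulr_ge0. Qed.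

Let int_clip2 : (\int[P']_w (clip M (Z w) ^+ 2)%:E = V%:E)%E.
Proof.
rewrite /V fineK// ge0_fin_numE; last first.
  by apply: integral_ge0 => w _; rewrite lee_fin sqr_ge0.
apply: le_lt_trans Z2; rewrite unlock; apply: ge0_le_integralT => w.
  by rewrite lee_fin sqr_ge0.
rewrite lee_fin -[leLHS]real_normK ?num_real// -[leRHS]real_normK ?num_real//.
by rewrite lerXn2r ?nnegrE// clip_le_norm.
Qed.

Let V_ge0 : 0 <= V.
Proof. by apply: fine_ge0; apply: integral_ge0 => w _; rewrite lee_fin sqr_ge0. Qed.

Lemma injective_norm_lower :
  ((10^-1 * (Num.sqrt (n%:R * V) + M))%:E <=
    \int[P]_w (inj_norm (fun i => T i w))%:E)%E.
Proof.
have low1 : (EM%:E <= \int[P]_w (inj_norm (fun i => T i w))%:E)%E.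
  rewrite -(int_mx idd Z2); apply: ge0_le_integralT => w; rewrite lee_fin.
    exact: mx_ge0.
  exact: norm_inf_le_inj_norm.
(* [fiber_mean_lower] needs [M ^ 2 <= n * V]. In the other case [sqrt (n * V) <= M], and the largest
   entry alone gives the bound. *)
have [MV|/ltW MV] := leP (M ^+ 2) (n%:R * V).
  have low2 : ((Num.sqrt (n%:R * V) / 3)%:E <= \int[P]_w (inj_norm (fun i => T i w))%:E)%E.
    have [k kn] := max_attained; rewrite -kn in MV *.
    exact: (fiber_mean_lower ind idd n0 M_ge0 int_clip2 MV).
  have [ME|ME] := leP EM (Num.sqrt (n%:R * V) / 3).
    apply: le_trans low2; rewrite lee_fin /M; move: ME.
    by have := sqrtr_ge0 (n%:R * V); set s := Num.sqrt _; lra.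
  apply: le_trans low1; rewrite lee_fin /M; move: ME.
  by have := sqrtr_ge0 (n%:R * V); set s := Num.sqrt _; lra.
apply: le_trans low1; rewrite lee_fin.
have : Num.sqrt (n%:R * V) <= M.
  by rewrite -[leRHS]ger0_norm// -sqrtr_sqr ler_sqrt// sqr_ge0.
by have := EM_ge0; rewrite /M; lra.
Qed.

Variables (eps K : R).
Hypothesis eps01 : 0 < eps < 1.
Hypothesis K1 : 1 <= K.
Let sigma := Num.sqrt (fine (\int[P']_w (Z w ^+ 2)%:E)%E).
Hypothesis Zmoment : (\int[P']_w (`|Z w| `^ (2 + eps))%:E
  <= (K * sigma `^ (2 + eps))%:E)%E.

Lemma injective_norm_upper :
  (\int[P]_w (inj_norm (fun i => T i w))%:E <=
    (5000 * (r%:R ^+ 3 * Num.sqrt (n%:R * V) +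
      r%:R ^+ 5 * ln (r%:R / eps) ^+ 2 / eps ^+ 6 * K * M))%:E)%E.
Proof.
have np : 0 < n%:R :> R by rewrite ltr0n; exact: ltn_trans n2.
have rp : 0 < r%:R :> R by rewrite ltr0n.
have sn : 0 < Num.sqrt n%:R :> R by rewrite sqrtr_gt0.
(* The largest mesh allowed by [inj_norm_grid]; [B] is then taken large enough for the grid to cover
   the interval from -1 to 1. *)
pose h : R := (2 * r%:R * Num.sqrt n%:R)^-1.
have h0 : 0 < h by rewrite invr_gt0 !mulr_gt0.
pose B := (truncn h^-1).+1.
have hB : 1 <= h * B%:R.
  by rewrite -ler_pdivrMl// mulr1; apply: ltW; exact: truncnS_gt.
have hn : h * Num.sqrt n%:R <= (2 * r%:R)^-1.
  by rewrite /h invfM mulfVK// gt_eqF.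
have wt1 (x : forall k, 'I_(ns k) -> R) i :
    (forall k, \sum_j x k j ^+ 2 <= 1) -> `|wt x i| <= 1.
  move=> x1; rewrite -(expr_le1 (n := 2))// real_normK ?num_real//.
  apply: (@le_trans _ _ (\sum_i wt x i ^+ 2)).
    by rewrite (bigD1 i)//= lerDl sumr_ge0// => j _; exact: sqr_ge0.
  rewrite wt_sqr_sum; apply: prodr_ile1 => k _; rewrite x1 andbT.
  by apply: sumr_ge0 => j _; exact: sqr_ge0.
have net w := @inj_norm_grid R r ns (fun i => T i w) n h B r0 nsn h0 hB hn.
have inj0 w : 0 <= inj_norm (fun i => T i w) by exact: inj_norm_ge0.
(* For [M = 0] the largest entry has mean 0, and a crude bound by the number of entries times the
   largest one shows that the injective norm has mean 0 too. The main argument divides by [M]. *)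
move: M_ge0; rewrite le_eqVlt => /predU1P[Meq|Mgt].
  have EM0 : EM = 0 by move: Meq; rewrite /M; lra.
  rewrite -Meq !mulr0 addr0.
  have z0 : mean_le P (fun w => 2 * (#|{: tensor_index ns}|%:R * tensor_norm_inf (fun i => T i w)))
      (2 * (#|{: tensor_index ns}|%:R * 0)).
    apply: mean_leZ => //; apply: mean_leZ => //; split.
    - exact: measurable_mx.
    - by move=> w; exact: mx_ge0.
    - by rewrite (int_mx idd Z2) -/EM EM0.
  have [_ _ le0] := z0.
  apply: (@le_trans _ _ 0%E); last first.
    by rewrite lee_fin mulr_ge0 ?ler0n// mulr_ge0 ?sqrtr_ge0 ?exprn_ge0.
  rewrite !mulr0 in le0; apply: le_trans le0.
  apply: ge0_le_integralT => w; rewrite lee_fin//.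
  have [z /= [uz]] := net w; move=> /le_trans; apply; rewrite ler_wpM2l//.
  apply: le_trans (ler_norm_sum _ _ _) _.
  rewrite mulr_natl -sumr_const; apply: ler_sum => i _.
  rewrite normrM; apply: le_trans (ler_piMr _ (wt1 _ i uz)) _ => //.
  exact: le_mx.
pose m : R := fine (\int[P']_w (excess M (Z w))%:E)%E.
have mE : (\int[P']_w (excess M (Z w))%:E = m%:E)%E by exact: int_excess.
have m0 : 0 <= m.
  by apply: fine_ge0; apply: integral_ge0 => w _; rewrite lee_fin excess_ge0.
have Nm : #|{: tensor_index ns}|%:R * m <= M by exact: card_mul_excess_le.
have int_quad a c : 0 <= c ->
    (\int[P']_w (1 + a * clip M (Z w) + c * clip M (Z w) ^+ 2)%:E
       <= (1 + `|a| * m + c * V)%:E)%E.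
  by move=> c0; exact: int_clip_quad.
have s0 : 0 <= sigma by exact: sqrtr_ge0.
have sE : (\int[P']_w (Z w ^+ 2)%:E = (sigma ^+ 2)%:E)%E.
  have z0 : (0 <= \int[P']_w (Z w ^+ 2)%:E)%E.
    by apply: integral_ge0 => w _; rewrite lee_fin sqr_ge0.
  rewrite /sigma sqr_sqrtr ?fine_ge0// fineK// ge0_fin_numE//.
  by move: Z2; rewrite unlock.
have mclip2 : measurable_fun setT (fun w => clip M (Z w) ^+ 2).
  by apply: measurable_funX; apply: measurableT_comp => //; exact: measurable_clip.
have mpow : measurable_fun setT (fun w => `|Z w| `^ (2 + eps)).
  apply: (@measurableT_comp _ _ _ _ _ _ (@powR R ^~ (2 + eps))).
    exact: measurable_powR.
  by apply: measurableT_comp => //; exact: normr_measurable.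
have meanV : mean_le P' (fun w => clip M (Z w) ^+ 2) V.
  by split => // [w|]; rewrite ?sqr_ge0// int_clip2.
have meanK : mean_le P' (fun w => `|Z w| `^ (2 + eps)) (K * sigma `^ (2 + eps)).
  by split => // w; exact: powR_ge0.
have [|||F meanF HF] := @fiber_bound R r ns d Omega P d' Omega' P' Z T n ind idd r2 n2 nsn
    M V K eps sigma Mgt V_ge0 K1 eps01 s0.
- move=> c c0.
  by have [] := mean_leD (mean_le_cst P' ler01) (mean_leZ c0 meanV).
- move=> c c0.
  by have [] := mean_leD (mean_le_cst P' ler01) (mean_leZ c0 meanK).
- move=> gt; apply: (sigma_sqr_le Mgt V_ge0 K1 eps01 s0 _ int_clip2 mE Nm sE Zmoment gt).
  by rewrite (ltn_trans _ n2)//= n_le_card.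
have /andP[e0 e1] := eps01.
pose s := Num.sqrt (n%:R * V).
have nV0 : 0 <= n%:R * V by rewrite mulr_ge0// ltW.
have sqE : s ^+ 2 = n%:R * V by rewrite sqr_sqrtr.
(* The bound on the mean of the largest squared fiber norm from [fiber_bound], so that the term
   [r / rho * F] of the decomposition has mean at most [r * rho]. *)
pose rho2 := 3 * r%:R ^+ 2 * (n%:R * V) + 17 * (r%:R * K / eps) * M ^+ 2.
have rho20 : 0 < rho2.
  apply: ltr_wpDl; first by rewrite mulr_ge0// mulr_ge0// sqr_ge0.
  rewrite mulr_gt0 ?exprn_gt0// mulr_gt0// divr_gt0// mulr_gt0//.
  exact: lt_le_trans ltr01 K1.
pose rho := Num.sqrt rho2; have rho0 : 0 < rho by rewrite sqrtr_gt0.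
have rhoE : rho ^+ 2 = rho2 by rewrite sqr_sqrtr// ltW.
have Vrho : n%:R * V <= rho ^+ 2.
  rewrite rhoE /rho2; apply: ler_wpDr.
    rewrite mulr_ge0 ?sqr_ge0// mulr_ge0// divr_ge0 ?(ltW e0)// mulr_ge0//.
    exact: le_trans ler01 K1.
  rewrite ler_peMl// expr2; have : 2 <= r%:R :> R by rewrite ler_nat.
  by move=> rr; have := ler_pM (ler0n R 2) (ler0n R 2) rr rr; lra.
rewrite -/rho2 -rhoE in meanF.
have [U [meanU HU]] := @core_bound R r ns d Omega P d' Omega' P' Z T n B h M m V rho F
  ind idd r2 n2 nsn V_ge0 Mgt m0 Nm int_quad rho0 Vrho meanF HF erefl.
have meanE : mean_le P (fun w => \sum_i excess M (T i w)) M.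
  apply: (@mean_le_trans _ _ _ _ _ (\sum_(i : tensor_index ns) m)).
    by rewrite sumr_const -[leLHS]mulr_natl.
  apply: mean_le_sum => i; split.
  - by apply: measurableT_comp => //; exact: measurable_excess.
  - by move=> w; exact: excess_ge0.
  - rewrite (integral_identically_distributed (idd i)) ?mE//.
      exact: measurable_excess.
    by move=> x; exact: excess_ge0.
have [_ _] := mean_leZ (ler0n R 2) (mean_leD meanU meanE).
move=> le1; apply: le_trans (_ : (_ <= (2 * (M + 120 * r%:R ^+ 2 * rho + M))%:E)%E) _; last first.
  rewrite lee_fin; apply: (upper_constant_le r2 eps01 K1 (ltW Mgt) (sqrtr_ge0 _) (ltW rho0)).
  by rewrite -/s sqE rhoE.
apply: le_trans le1; apply: ge0_le_integralT => w; rewrite lee_fin//.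
have [z /= [uz]] := net w; move=> /le_trans; apply; rewrite ler_wpM2l//.
have -> : \sum_i T i w * wt (gridvec h z) i =
    \sum_i clip M (T i w) * wt (gridvec h z) i +
    \sum_i (T i w - clip M (T i w)) * wt (gridvec h z) i.
  by rewrite -big_split/=; apply: eq_bigr => i _; rewrite -mulrDl addrC subrK.
apply: le_trans (ler_normD _ _) _; apply: lerD; first exact: HU.
apply: le_trans (ler_norm_sum _ _ _) _; apply: ler_sum => i _.
rewrite normrM; apply: le_trans (ler_piMr _ (wt1 _ i uz)) _ => //.
by apply: clip_sub_le; exact: ltW.
Qed.
End upper_bound.

Theorem theorem5p1 (R : realType) :
  exists c C : R, [/\ 0 < c, 0 < C &
    forall (r : nat) (ns : 'I_r -> nat) (eps K : R)
      (d : measure_display) (Omega : measurableType d)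
      (P : probability Omega R)
      (d' : measure_display) (Omega' : measurableType d')
      (P' : probability Omega' R)
      (Z : {RV P' >-> R}) (T : tensor_index ns -> {RV P >-> R}),
    (2 <= r)%N ->
    (forall k, (2 <= ns k)%N) ->
    0 < eps < 1 ->
    1 <= K ->
    mutually_independent T ->
    (forall i, identically_distributed (T i) Z) ->
    ('E_P'[Z] = 0)%E ->
    ('E_P'[fun w => (Z w ^+ 2)%R] < +oo)%E ->
    let sigma := Num.sqrt (fine ('E_P'[fun w => (Z w ^+ 2)%R])%E) in
    ('E_P'[fun w => (`|Z w| `^ (2 + eps))%R]
       <= (K * sigma `^ (2 + eps))%:E)%E ->
    let M := 2 * fine ('E_P[fun w => tensor_norm_inf (fun i => T i w)])%E in
    let n := \max_(k < r) ns k in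
    let V := fine ('E_P'[fun w => (clip M (Z w) ^+ 2)%R])%E in
    ((c * (Num.sqrt (n%:R * V) + M))%:E
       <= 'E_P[fun w => inj_norm (fun i => T i w)])%E /\
    ('E_P[fun w => inj_norm (fun i => T i w)]
       <= (C * (r%:R ^+ 3 * Num.sqrt (n%:R * V)
                + r%:R ^+ 5 * ln (r%:R / eps) ^+ 2 / eps ^+ 6 * K * M))%:E)%E].
Proof.
exists 10^-1, 5000; split; [by rewrite invr_gt0 ltr0n|by rewrite ltr0n|].
move=> r ns eps K d Omega P d' Omega' P' Z T r2 ns2 eps01 K1 ind idd Z0 Z2.
have EE (f : Omega -> R) : ('E_P[f] = \int[P]_w (f w)%:E)%E by rewrite unlock.
have EE' (f : Omega' -> R) : ('E_P'[f] = \int[P']_w (f w)%:E)%E by rewrite unlock.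
move=> sigma Zmoment M n V; move: Zmoment.
rewrite /sigma /V /M !EE' !EE => Zmoment.
split; [exact: injective_norm_lower|exact: injective_norm_upper].
Qed.
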